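(* Let $\rho>0$, let $n\ge 1$ be an integer and let $0<r<r'$. Let $X$ be a homogeneous Poisson point process on $\mathbb{R}^2$ with intensity $\rho$, observed on $A_n=[0,n]^2$. Then $$\operatorname{var}(\widehat K_{1,n}(r))=\frac{2e_{r,n}}{\rho^2}+\frac{4n^2e_{r,n}^2}{\rho}+\frac{4n^2}{\rho}\mathbb{E}h_1^2(U,r),$$ $$\operatorname{cov}(\widehat K_{1,n}(r),\widehat K_{1,n}(r'))=\frac{2e_{r,n}}{\rho^2}+\frac{4n^2e_{r',n}e_{r,n}}{\rho}+\frac{4n^2}{\rho}\operatorname{cov}(h_1(U,r'),h_1(U,r)),$$ $$\begin{aligned}\operatorname{var}(\widehat K_{2,n}(r))=\;&2n^4\,\mathbb{E}\left(\frac{\mathbf 1\{N>1\}}{N(N-1)}\right)\left(e_{r,n}-e_{r,n}^2\right)+4n^4\,\mathbb{E}\left(\frac{\mathbf 1\{N>1\}(N-2)}{N(N-1)}\right)\mathbb{E}h_1^2(U,r)\\&+n^4e^{-\rho n^2}(1+\rho n^2)\left(1-e^{-\rho n^2}-\rho n^2e^{-\rho n^2}\right)e_{r,n}^2,\end{aligned}$$ $$\begin{aligned}\operatorname{cov}(\widehat K_{2,n}(r),\widehat K_{2,n}(r'))=\;&2n^4\,\mathbb{E}\left(\frac{\mathbf 1\{N>1\}}{N(N-1)}\right)\left(e_{r,n}-e_{r',n}e_{r,n}\right)\\&+4n^4\,\mathbb{E}\left(\frac{\mathbf 1\{N>1\}(N-2)}{N(N-1)}\right)\operatorname{cov}(h_1(U,r'),h_1(U,r))\\&+n^4e^{-\rho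 n^2}(1+\rho n^2)\left(1-e^{-\rho n^2}-\rho n^2e^{-\rho n^2}\right)e_{r',n}e_{r,n},\end{aligned}$$ where $$e_{r,n}=\frac{\pi r^2}{n^2}-\frac{8r^3}{3n^3}+\frac{r^4}{2n^4}$$ (and likewise for $e_{r',n}$ with $r'$ in place of $r$), and $$\mathbb{E}h_1^2(U,r)=\frac{r^5}{n^5}\left(\frac83\pi-\frac{256}{45}\right)+\frac{r^6}{n^6}\left(\frac{11}{48}\pi-\frac{56}{9}\right)+\frac83\frac{r^7}{n^7}-\frac14\frac{r^8}{n^8}.$$
   Context: Let $S=\{X_1,\dots,X_N\}$ be the (random) finite set of points of $X$ lying in the square $A_n=[0,n]^2$, so that $N$ is Poisson distributed with mean $\rho n^2$. Let $d(\cdot,\cdot)$ be the Euclidean distance and $\mathbf 1\{\cdot\}$ the indicator function. The Ripley statistics are $$\widehat K_{1,n}(r)=\frac{1}{n^2\rho^2}\sum_{X_i\ne X_j\in S}\mathbf 1\{d(X_i,X_j)\le r\},\qquad \widehat K_{2,n}(r)=\frac{n^2}{N(N-1)}\sum_{X_i\ne X_j\in S}\mathbf 1\{d(X_i,X_j)\le r\},$$ where the sums run over ordered pairs of distinct points of $S$, and $\widehat K_{2,n}(r)=0$ by convention when $N\le 1$; likewise $\mathbf 1\{N>1\}/(N(N-1))$ and $\mathbf 1\{N>1\}(N-2)/(N(N-1))$ are read as $0$ when $N\le1$. Let $U,V$ be independent random points, each uniformly distributed on $A_n$. Define, for $r>0$ and $x,y\in A_n$, $e_{r,n}=\mathbb{E}(\mathbf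 1\{d(U,V)\le r\})$, $h(x,y,r)=\mathbf 1\{d(x,y)\le r\}-e_{r,n}$, and $h_1(x,r)=\mathbb{E}(h(U,V,r)\mid V=x)$.
   Formalization: The closed form for e_{r,n} (and e_{r',n}) is stated only for radius at most n, and the one for E h_1^2(U,r) only for 2r ≤ n; without such bounds they fail (r=10n gives e>1). The four variance and covariance identities hold for all 0<r<r'. *)

(* Defs.v *)
From HB Require Import structures.
From mathcomp Require Import all_boot all_order all_algebra finmap.
From mathcomp Require Import all_classical all_reals all_analysis.

Set Implicit Arguments.
Unset Strict Implicit.
Unset Printing Implicit Defensive.

Import Order.TTheory GRing.Theory Num.Theory.
Import numFieldNormedType.Exports.

Local Open Scope classical_set_scope.
Local Open Scope ring_scope.

Notation plane R := (R * R)%type.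

Section Plane.
Context {R : realType}.

Definition area : set (plane R) -> \bar R :=
  (@lebesgue_measure R \x @lebesgue_measure R)%E.

(* The norm of the library on [R * R] is the sup norm. *)
Definition dist (x y : plane R) : R :=
  Num.sqrt ((x.1 - y.1) ^+ 2 + (x.2 - y.2) ^+ 2).

Definition dist_le (r : R) (x y : plane R) : R := (dist x y <= r)%R%:R.

Definition square (n : nat) : set (plane R) :=
  `[0, n%:R]%classic `*` `[0, n%:R]%classic.

End Plane.

Section Independence.
Context {d : measure_display} {T : measurableType d} {R : realType}.
Variable P : probability T R.

(* The product rule for subfamilies is obtained with [A i := setT]. *)
Definition mutually_independent {d' : measure_display}
    {T' : measurableType d'} (m : nat) (Y : 'I_m -> T -> T') : Prop :=
  forall A : 'I_m -> set T', (forall i, measurable (A i)) ->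
    P (\bigcap_i (Y i @^-1` A i)) = (\prod_(i < m) P (Y i @^-1` A i))%E.

Definition independent {d1 d2 : measure_display} {T1 : measurableType d1}
    {T2 : measurableType d2} (Y : T -> T1) (Z : T -> T2) : Prop :=
  forall A B, measurable A -> measurable B ->
    P (Y @^-1` A `&` Z @^-1` B) = (P (Y @^-1` A) * P (Z @^-1` B))%E.

(* [g] is a version of [x |-> E(Y | V = x)]. *)
Definition cond_expectation {d' : measure_display} {T' : measurableType d'}
    (Y : T -> R) (V : {RV P >-> T'}) (g : T' -> R) : Prop :=
  [/\ measurable_fun setT g,
      (distribution P V).-integrable setT (EFin \o g) &
      forall B, measurable B ->
        (\int[distribution P V]_(x in B) (g x)%:E =
         \int[P]_(w in V @^-1` B) (Y w)%:E)%E].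

End Independence.

Section PointProcess.
Context {d : measure_display} {T : measurableType d} {R : realType}.
Variable P : probability T R.
Implicit Types (X : T -> set (plane R)) (B : set (plane R)).

(* [fset_set] is the empty set on infinite sets; [poisson_process] makes
   [X w `&` B] finite for bounded [B]. *)
Definition num_points X B (w : T) : nat := #|` fset_set (X w `&` B)|%fset.

(* The second argument of [poisson_prob] is unused. Contrary to
   [poisson_pmf], [poisson_prob] is the Dirac mass at 0 for rate 0. *)
Record poisson_process (rho : R) X : Prop := PoissonProcess {
  pp_locally_finite : forall w B, bounded_set B -> finite_set (X w `&` B) ;
  pp_measurable : forall B, measurable B -> bounded_set B ->
    measurable_fun setT (num_points X B) ;
  pp_law : forall B, measurable B -> bounded_set B -> forall k : set nat,
    P (num_points X B @^-1` k) = poisson_prob (rho * fine (area B)) 0 k ;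
  pp_independent : forall (m : nat) (B : 'I_m -> set (plane R)),
    (forall i, measurable (B i)) -> (forall i, bounded_set (B i)) ->
    trivIset setT B ->
    mutually_independent P (fun i => num_points X (B i)) }.

Definition uniform_on_square (n : nat) (U : {RV P >-> plane R}) : Prop :=
  forall B, measurable B ->
    distribution P U B = (fine (area (B `&` square n)) / n%:R ^+ 2)%:E.

End PointProcess.

Section Ripley.
Context {d : measure_display} {T : measurableType d} {R : realType}.
Implicit Types (X : T -> set (plane R)) (n : nat) (r : R).

(* The index set is finite for a locally finite [X w]; [\sum_(_ \in _)] is 0
   on infinite supports. *)
Definition close_pairs n X r (w : T) : R :=
  \sum_(p \in [set p : plane R * plane R |
                [/\ (X w `&` square n) p.1, (X w `&` square n) p.2
                  & p.1 <> p.2]])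
    dist_le r p.1 p.2.

Definition ripley1 (rho : R) n X r (w : T) : R :=
  (n%:R ^+ 2 * rho ^+ 2)^-1 * close_pairs n X r w.

Definition ripley2 n X r (w : T) : R :=
  let N := num_points X (square n) w in
  if (1 < N)%N then n%:R ^+ 2 / (N%:R * (N%:R - 1)) * close_pairs n X r w
  else 0.

Definition inv_pairs n X (w : T) : R :=
  let N := num_points X (square n) w in
  if (1 < N)%N then 1 / (N%:R * (N%:R - 1)) else 0.

Definition inv_pairs_sub2 n X (w : T) : R :=
  let N := num_points X (square n) w in
  if (1 < N)%N then (N%:R - 2) / (N%:R * (N%:R - 1)) else 0.

End Ripley.

Section UniformPair.
Context {d : measure_display} {T : measurableType d} {R : realType}.
Variables (Q : probability T R) (U V : T -> plane R).

Definition mean_close (r : R) : R :=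
  fine 'E_Q[fun w => dist_le r (U w) (V w)].

Definition hker (x y : plane R) (r : R) : R :=
  dist_le r x y - mean_close r.

End UniformPair.

(* Main.v *)
(* Write N for the number of points in the square A_n, S_r for the number of ordered pairs of distinct
   points at distance at most r, and a = rho n^2. Given N = k the points are k independent uniform
   points, so that E(S_r S_r' | N = k) is obtained by sorting pairs of ordered pairs by the number of
   points that they share:
     2k(k-1) e_r + 4k(k-1)(k-2) E(g_r g_r') + k(k-1)(k-2)(k-3) e_r e_r',
   where g_r(x) = P(d(U, x) <= r). As a Poisson process is only known here through the counts in
   disjoint sets, this is proved for a finite grid, where the counts given N = k are multinomial and
   "d(x, y) <= r" is replaced with "the cells of x and y contain points at distance at most r", and
   the mesh is sent to 0 by dominated convergence. Both Ripley statistics have the form phi(N) S_r, so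
   their covariances follow from the factorial moments E(N(N-1)...(N-j+1)) = a^j.
   With z = y - x, the mean of g_r is the integral over the disc of the area of A_n \cap (A_n - z),
   and the mean of g_r^2 the integral over two copies of the disc of the area of
   A_n \cap (A_n - z) \cap (A_n - z'). These areas are products over the two coordinates, which leaves
   one-dimensional integrals of polynomials in t and sqrt(r^2 - t^2). *)

Require Import Defs.
From HB Require Import structures.
From mathcomp Require Import all_boot all_order all_algebra finmap.
From mathcomp Require Import all_classical all_reals all_analysis.
From mathcomp Require Import measurable_realfun.
From mathcomp Require Import ring lra.

Set Implicit Arguments.
Unset Strict Implicit.
Unset Printing Implicit Defensive.

Import Order.TTheory GRing.Theory Num.Theory.
Import numFieldNormedType.Exports.

Local Open Scope classical_set_scope.
Local Open Scope ring_scope.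

(** The covariance formulas hold for all radii; only the closed forms restrict them. For r <= n, A_n
    and A_n - z overlap in a rectangle with sides n - |s| and n - |u|. In the second moment two
    displacements may have opposite signs, and the common part of the three squares then has a side
    n - |s| - |t|; it is nonnegative for all displacements in the disc if 2r <= n. The function h_1
    is determined up to null sets, and g_r - e_r is a version of it. Hence E h_1^2 = E g_r^2 -
    e_r^2, which also explains why pi^2 is absent from its closed form: the leading term (pi r^2 /
    n^2)^2 of E g_r^2 is that of e_r^2. The factor e^(-a) (1 + a) (1 - e^(-a) - a e^(-a)) is the
    variance of the indicator of N > 1. The hypotheses on X make the counts measurable, not S_r;
    measurability of S_r is a second product of the grids, as S_r is a pointwise limit of functions
    of counts. The measures on the line and the plane are variables, known through their integrals;
    they are replaced with [leb] and [lebesgue_plane] at the end. *)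

Section Lebesgue.
Context {R : realType}.

(* [lebesgue_measure] is a measure on the type [measurableTypeR R], whose measurable structure has
   the same measurable sets as [R] but is not the one inferred for [R] and [R * R]. *)
Definition leb (B : set R) : \bar R := lebesgue_measure B.

Let leb0 : leb set0 = 0%E.
Proof. exact: measure0. Qed.

Let leb_ge0 B : (0 <= leb B)%E.
Proof. exact: measure_ge0. Qed.

Let leb_sigma_additive : semi_sigma_additive leb.
Proof. exact: (@measure_semi_sigma_additive _ _ _ (@lebesgue_measure R)). Qed.

HB.instance Definition _ := isMeasure.Build _ _ _ leb leb0 leb_ge0 leb_sigma_additive.

Let leb_sigma_finite : sigma_finite setT leb.
Proof. exact: (sigma_finiteT (@lebesgue_measure R)). Qed.

HB.instance Definition _ := Measure_isSigmaFinite.Build _ _ _ leb leb_sigma_finite.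

(** The identity map [phi] from [measurableTypeR R] to [R] is measurable and pushes
    [lebesgue_measure] forward to [leb]. *)
Lemma ge0_integral_leb (D : set R) (f : R -> \bar R) : measurable D ->
  measurable_fun D f -> (forall x, D x -> 0 <= f x)%E ->
  (\int[leb]_(x in D) f x = \int[lebesgue_measure]_(x in D) f x)%E.
Proof.
move=> mD mf f0; pose phi (x : measurableTypeR R) : R := x.
have mphi : measurable_fun setT phi by move=> _ B mB; rewrite setTI.
have := @ge0_integral_pushforward _ _ _ _ R phi mphi lebesgue_measure D f mD mf.
move=> <-; last by move=> x /set_mem; exact: f0.
by apply: eq_measure_integral => B mB _.
Qed.

Lemma integral_leb (D : set R) (f : R -> \bar R) : measurable D -> measurable_fun D f ->
  (\int[leb]_(x in D) f x = \int[lebesgue_measure]_(x in D) f x)%E.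
Proof.
move=> mD mf; rewrite integralE [RHS]integralE; congr (_ - _)%E; apply: ge0_integral_leb => //.
- exact: measurable_funepos.
- exact: measurable_funeneg.
Qed.

Lemma areaE (B : set (plane R)) : measurable B -> area B = (leb \x leb)%E B.
Proof.
move=> mB; rewrite /area /product_measure1 ge0_integral_leb//.
exact: (measurable_fun_xsection leb mB).
Qed.

End Lebesgue.

(** * Integrals over the line and the plane *)

Section Line.
Context {R : realType}.
Local Notation mu := (@lebesgue_measure R).
Implicit Types (f F : R -> R) (a b : R).

(** The derivative is asked for in the open interval only, because the half chords integrated below
    have no derivative at the end point r. *)
Lemma integral_itv_derive f F a b : a <= b -> continuous f -> continuous F ->
  (forall x, a < x < b -> is_derive x 1 F (f x)) ->
  (\int[mu]_(x in `[a, b]) (f x)%:E = (F b - F a)%:E)%E.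
Proof.
move=> + cf cF dF; rewrite le_eqVlt => /predU1P[<-|ab].
  by rewrite set_itv1 integral_set1 subrr.
have dF' x : x \in `]a, b[ -> is_derive x 1 F (f x).
  by rewrite in_itv/=; exact: dF.
rewrite (@continuous_FTC2 _ f F)//.
- exact: continuous_subspaceT.
- split.
  + by move=> x /dF'[].
  + exact/cvg_at_right_filter/cF.
  + exact/cvg_at_left_filter/cF.
- by move=> x /dF'[_ Fx]; rewrite derive1E.
Qed.

(** The line is cut at 0 and its negative half is reflected; the point 0 has measure 0. *)
Lemma integral_fold (f : R -> \bar R) :
  measurable_fun [set: R] f -> (forall x, 0 <= f x)%E ->
  (\int[mu]_x f x = \int[mu]_(x in `[0%R, +oo[) (f x + f (- x)%R))%E.
Proof.
move=> mf f0.
rewrite ge0_integralD//; first last.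
- by apply: measurable_funTS; apply: measurableT_comp.
- exact: measurable_funTS.
have <- : (`]-oo, 0%R[ `|` `[(0 : R), +oo[ = [set: R])%classic.
  apply/seteqP; split => // x _; rewrite /= !in_itv/= andbT.
  by case: (ltP x 0); [left|right].
rewrite ge0_integral_setU//=; first last.
- apply/disj_setPS => x /=; rewrite !in_itv/= andbT => -[].
  by rewrite ltNge => /negbTE ->.
- exact: measurable_funTS.
rewrite addeC; congr (_ + _)%E.
rewrite (@ge0_integration_by_substitution0 _ (fun x => f (- x)))//; last first.
  by apply: measurableT_comp.
rewrite integral_itv_bndo_bndc; last exact: measurable_funTS.
by apply: eq_integral => x _; rewrite opprK.
Qed.

(** The translate of Lebesgue measure gives half-open intervals their length, hence is Lebesgue
    measure by uniqueness. *)
Lemma integral_translation (f : R -> \bar R) a :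
  measurable_fun [set: R] f -> (forall x, 0 <= f x)%E ->
  (\int[mu]_x f (a + x)%R = \int[mu]_x f x)%E.
Proof.
move=> mf f0; pose phi (x : measurableTypeR R) : measurableTypeR R := a + x.
have mphi : measurable_fun setT phi by exact: measurable_funD.
rewrite -(@ge0_integral_pushforward _ _ _ _ _ phi mphi mu setT f)//.
apply: eq_measure_integral => /= A mA _; apply/esym/lebesgue_measure_unique => //.
move=> _ [[x y]] _ <-; rewrite /= /pushforward.
have -> : (phi @^-1` `]x, y] = `]x - a, y - a])%classic.
  apply/seteqP; split => z /=; rewrite /phi !in_itv/= ltrBlDl lerBrDl//.
by rewrite !lebesgue_measure_itv/= !lte_fin ltrD2r -!EFinD opprD opprK addrACA addNr addr0.
Qed.

End Line.

Section PlaneIntegral.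
Context {R : realType}.
Variable mu : {sigma_finite_measure set R -> \bar R}.

Lemma measurable_natr_bool d (T : measurableType d) (b : T -> bool) :
  measurable_fun setT b -> measurable_fun setT (fun x => (b x)%:R : R).
Proof.
move=> mb; rewrite (_ : (fun _ => _) = fun x => if b x then 1 else 0).
  exact: measurable_fun_ifT.
by apply/funext => x; case: (b x).
Qed.

Lemma mule2_add (x : \bar R) : (2%:E * x = x + x)%E.
Proof. by rewrite mule_natl mule2n. Qed.

Lemma integral_restrict_fiber (f : R * R -> \bar R) (D : set (R * R)) x :
  (\int[mu]_(y in xsection D x) f (x, y) = \int[mu]_y (f \_ D) (x, y))%E.
Proof.
rewrite integral_mkcond; apply: eq_integral => y _.
by rewrite /patch mem_xsection.
Qed.

Lemma measurable_fiber_integral (f : R * R -> \bar R) (D : set (R * R)) :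
  measurable_fun [set: R * R] f -> (forall z, 0 <= f z)%E -> measurable D ->
  measurable_fun [set: R] (fun x => \int[mu]_(y in xsection D x) f (x, y))%E.
Proof.
move=> mf f0 mD; under eq_fun do rewrite integral_restrict_fiber.
apply: (measurable_fun_fubini_tonelli_F (m2 := mu) (f \_ D)).
  by apply/(measurable_restrictT _ mD); exact: measurable_funTS.
by move=> z; rewrite /patch; case: ifP.
Qed.

Lemma fubini_tonelli_fiber (f : R * R -> \bar R) (D : set (R * R)) :
  measurable_fun [set: R * R] f -> (forall z, 0 <= f z)%E -> measurable D ->
  (\int[mu]_x \int[mu]_(y in xsection D x) f (x, y) =
   \int[mu]_y \int[mu]_(x in ysection D y) f (x, y))%E.
Proof.
move=> mf f0 mD; under eq_integral do rewrite integral_restrict_fiber.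
apply: (etrans (fubini_tonelli (m1 := mu) (m2 := mu) (f \_ D) _ _)).
- by apply/(measurable_restrictT _ mD); exact: measurable_funTS.
- by move=> z; rewrite /patch; case: ifP.
- apply: eq_integral => y _; rewrite [RHS]integral_mkcond.
  by apply: eq_integral => x _; rewrite /patch mem_ysection.
Qed.

Hypothesis muE : forall (D : set R) (f : R -> \bar R), measurable D -> measurable_fun D f ->
  (\int[mu]_(x in D) f x = \int[lebesgue_measure]_(x in D) f x)%E.

Let integral_foldm (f : R -> \bar R) :
  measurable_fun [set: R] f -> (forall x, 0 <= f x)%E ->
  (\int[mu]_x f x = \int[mu]_(x in `[0%R, +oo[) (f x + f (- x)%R))%E.
Proof.
move=> mf f0; have mfN : measurable_fun [set: R] (fun x => f x + f (- x)%R)%E.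
  by apply: emeasurable_funD => //; exact: measurableT_comp.
by rewrite !muE//; [exact: integral_fold|exact: measurable_funTS].
Qed.

Lemma integral_fold2 (f : R * R -> \bar R) :
  measurable_fun [set: R * R] f -> (forall z, 0 <= f z)%E ->
  (\int[mu]_x \int[mu]_y f (x, y) =
   \int[mu]_(x in `[0%R, +oo[) \int[mu]_(y in `[0%R, +oo[)
     (f (x, y) + f (x, - y)%R + (f (- x, y)%R + f (- x, - y)%R)))%E.
Proof.
move=> mf f0.
pose g z := (f z + f (z.1, - z.2)%R)%E.
have mg : measurable_fun [set: R * R] g.
  apply: emeasurable_funD => //; apply: measurableT_comp => //.
  apply: measurable_fun_pair => //; exact: measurableT_comp.
have g0 z : (0 <= g z)%E by rewrite adde_ge0.
have mpos : measurable ([set: R] `*` `[(0 : R), +oo[) by exact: measurableX.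
have xs x : xsection ([set: R] `*` `[(0 : R), +oo[) x = `[0, +oo[%classic.
  by rewrite in_xsectionX// inE.
transitivity (\int[mu]_x \int[mu]_(y in `[0%R, +oo[) g (x, y))%E.
  apply: eq_integral => x _; rewrite integral_foldm//.
  exact: measurableT_comp.
rewrite integral_foldm; first last.
- by move=> x; exact: integral_ge0.
- have := measurable_fiber_integral mg g0 mpos.
  by under eq_fun do rewrite xs.
apply: eq_integral => x _; rewrite -ge0_integralD//.
- by apply: measurable_funTS; exact: measurableT_comp.
- by apply: measurable_funTS; exact: measurableT_comp.
Qed.

(** The quadrant is cut along the diagonal into [D1] and [D2]. Tonelli's theorem and the symmetry of
    [f] turn the integral over [D2] into the one over [D1]. *)
Lemma integral_triangle (f : R * R -> \bar R) :
  measurable_fun [set: R * R] f -> (forall z, 0 <= f z)%E ->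
  (forall x y, f (x, y) = f (y, x)) ->
  (\int[mu]_(x in `[0%R, +oo[) \int[mu]_(y in `[0%R, +oo[) f (x, y) =
   2%:E * \int[mu]_(x in `[0%R, +oo[) \int[mu]_(y in `[0%R, x]) f (x, y))%E.
Proof.
move=> mf f0 fC.
(* The diagonal belongs to [D1] only, so the sections of [D2] are half-open and have to be closed
   before the comparison. *)
have no_atom (g : R -> \bar R) x : measurable_fun [set: R] g ->
    (\int[mu]_(y in `[0%R, x[) g y = \int[mu]_(y in `[0%R, x]) g y)%E.
  by move=> mg; rewrite !muE ?integral_itv_bndo_bndc//; exact: measurable_funTS.
pose D1 : set (R * R) := [set z | (0 <= z.2 <= z.1)%R].
pose D2 : set (R * R) := [set z | (0 <= z.1 < z.2)%R].
have mD1 : measurable D1.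
  have: measurable_fun [set: R * R] (fun z : R * R => (0 <= z.2) && (z.2 <= z.1)).
    by apply: measurable_and; exact: measurable_fun_ler.
  by move=> /(_ measurableT [set true] I); rewrite setTI.
have mD2 : measurable D2.
  have: measurable_fun [set: R * R] (fun z : R * R => (0 <= z.1) && (z.1 < z.2)).
    by apply: measurable_and; [exact: measurable_fun_ler|exact: measurable_fun_ltr].
  by move=> /(_ measurableT [set true] I); rewrite setTI.
have xs1 x : xsection D1 x = `[0, x]%classic.
  by apply/seteqP; split => y; rewrite /xsection/= inE /D1/= in_itv.
have ys2 y : ysection D2 y = `[0, y[%classic.
  by apply/seteqP; split => x; rewrite /ysection/= inE /D2/= in_itv.
have xs2 x : 0 <= x -> xsection D2 x = `]x, +oo[%classic.
  by move=> x0; apply/seteqP; split => y; rewrite /xsection/= inE /D2/= in_itv/= x0 andbT.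
have mfx x : measurable_fun [set: R] (fun y => f (x, y)) by exact: measurableT_comp.
have itv_lt0 (x : R) : x < 0 -> `[0, x]%classic = set0.
  by move=> x0; rewrite set_itv_ge// bnd_simp -ltNge.
have F1E : (\int[mu]_(x in `[0%R, +oo[) \int[mu]_(y in `[0%R, x]) f (x, y) =
            \int[mu]_x \int[mu]_(y in xsection D1 x) f (x, y))%E.
  rewrite [LHS]integral_mkcond; apply: eq_integral => x _; rewrite xs1 /patch.
  case: ifPn => //; rewrite notin_setE/= in_itv/= andbT => /negP; rewrite -ltNge => x0.
  by rewrite itv_lt0// integral_set0.
have F2E : (\int[mu]_x \int[mu]_(y in xsection D2 x) f (x, y) =
            \int[mu]_x \int[mu]_(y in xsection D1 x) f (x, y))%E.
  apply: (etrans (fubini_tonelli_fiber mf f0 mD2)); apply: eq_integral => y _; rewrite ys2 xs1.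
  rewrite -no_atom; last exact: mfx.
  by apply: eq_integral => x _; rewrite fC.
have m1 := measurable_fiber_integral mf f0 mD1.
have m2 := measurable_fiber_integral mf f0 mD2.
have p1 x : [set: R] x -> (0 <= \int[mu]_(y in xsection D1 x) f (x, y))%E.
  by move=> _; exact: integral_ge0.
have p2 x : [set: R] x -> (0 <= \int[mu]_(y in xsection D2 x) f (x, y))%E.
  by move=> _; exact: integral_ge0.
have sumE := ge0_integralD mu measurableT p1 m1 p2 m2.
rewrite F1E mule2_add.
transitivity (\int[mu]_x (\int[mu]_(y in xsection D1 x) f (x, y)
  + \int[mu]_(y in xsection D2 x) f (x, y)))%E; last first.
  rewrite sumE F2E; reflexivity.
clear F1E F2E sumE p1 p2 m1 m2.
rewrite [LHS]integral_mkcond; apply: eq_integral => x _; rewrite /patch.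
case: ifPn => [|]; last first.
  rewrite notin_setE/= in_itv/= andbT => /negP; rewrite -ltNge => x0.
  rewrite xs1 itv_lt0// integral_set0 add0e (_ : xsection D2 x = set0) ?integral_set0//.
  apply/seteqP; split => y //; rewrite /xsection/= inE /D2/= => /andP[].
  by rewrite leNgt x0.
rewrite inE/= in_itv/= andbT => x0; rewrite xs1 xs2// -ge0_integral_setU//=.
- congr (integral _ _ _); apply/seteqP; split => y /=; rewrite !in_itv/= !andbT.
    by move=> y0; case: (leP y x) => xy; [left; rewrite y0|right].
  by move=> [/andP[]//|/ltW]; exact: le_trans.
- exact: measurable_funTS.
- apply/disj_setPS => y /=; rewrite !in_itv/= andbT => -[/andP[_]].
  by rewrite leNgt => /negP.
Qed.

End PlaneIntegral.

Ltac measurability :=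
  repeat first
    [ exact: measurable_cst | exact: measurable_id | exact: measurable_fst | exact: measurable_snd
    | assumption
    | apply: measurable_natr_bool | apply: measurable_and | apply: measurable_fun_ler
    | apply: measurable_funM | apply: measurable_funD | apply: measurable_funB
    | apply: measurable_funX | apply: measurable_funN | apply: measurable_maxr | apply: measurable_minr
    | apply: (measurableT_comp (f := fst)) | apply: (measurableT_comp (f := snd)) ].

(** * Translates of the square *)

Section Overlap.
Context {R : realType}.
Variable mu : {sigma_finite_measure set R -> \bar R}.
Hypothesis muE : forall (D : set R) (f : R -> \bar R), measurable D -> measurable_fun D f ->
  (\int[mu]_(x in D) f x = \int[lebesgue_measure]_(x in D) f x)%E.
Variable A : {sigma_finite_measure set (R * R)%type -> \bar R}.
Hypothesis integral_area : forall f : R * R -> \bar R,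
  measurable_fun [set: R * R] f -> (forall z, 0 <= f z)%E ->
  (\int[A]_z f z = \int[mu]_x \int[mu]_y f (x, y))%E.

Definition inside (a x : R) : R := ((0 <= x) && (x <= a))%R%:R.

Lemma inside_ge0 a x : 0 <= inside a x.
Proof. exact: ler0n. Qed.

Lemma measurable_inside d (T : measurableType d) a (f : T -> R) :
  measurable_fun setT f -> measurable_fun setT (fun x => inside a (f x)).
Proof. by move=> mf; rewrite /inside; measurability. Qed.

(** The length of the intersection of [0, a], [0, a] - s and [0, a] - t: the least right end minus
    the greatest left end, cut off at 0 when the intersection is empty. *)
Definition overlap (a s t : R) : R :=
  Num.max 0 (Num.min (Num.min a (a - s)) (a - t) - Num.max (Num.max 0 (- s)) (- t)).

Lemma overlap_ge0 a s t : 0 <= overlap a s t.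
Proof. by rewrite /overlap le_max lexx. Qed.

Lemma measurable_overlap d (T : measurableType d) a (f g : T -> R) :
  measurable_fun setT f -> measurable_fun setT g ->
  measurable_fun setT (fun x => overlap a (f x) (g x)).
Proof. by move=> mf mg; rewrite /overlap; measurability. Qed.

Lemma measurable_inside3 a s t : measurable_fun [set: R]
  (fun x => inside a x * (inside a (x + s) * inside a (x + t))).
Proof.
apply: measurable_funM; first exact: measurable_inside.
by apply: measurable_funM; apply: measurable_inside; measurability.
Qed.

Lemma integral_inside3 a s t :
  (\int[mu]_x (inside a x * (inside a (x + s) * inside a (x + t)))%:E = (overlap a s t)%:E)%E.
Proof.
set M := Num.max (Num.max 0 (- s)) (- t); set m := Num.min (Num.min a (a - s)) (a - t).
transitivity (\int[lebesgue_measure]_x (\1_(`[M, m] : set R) x)%:E)%E.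
  rewrite muE//; last by apply/measurable_EFinP; exact: measurable_inside3.
  apply: eq_integral => x _; rewrite indicE mem_setE in_itv/= /inside.
  rewrite /M /m !ge_max !le_min -!natrM !mulnb; congr (_ %:R%:E).
  have e1 c : (0 <= x + c) = (- c <= x) by rewrite -lerBlDr sub0r.
  rewrite !e1 !lerBrDr.
  by do 6 (case: (_ <= _); rewrite ?andbF//).
rewrite integral_indic//= setIT lebesgue_measure_itv/= lte_fin /overlap -/M -/m.
case: ltP => mM; first by rewrite -EFinB max_r// subr_ge0 ltW.
by rewrite max_l// subr_le0.
Qed.

Lemma integral_area_prod (p q : R -> R) (c P Q : R) :
  measurable_fun setT p -> measurable_fun setT q ->
  (forall x, 0 <= p x) -> (forall x, 0 <= q x) -> 0 <= c ->
  (\int[mu]_x (p x)%:E = P%:E)%E -> (\int[mu]_x (q x)%:E = Q%:E)%E ->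
  (\int[A]_z (c * p z.1 * q z.2)%:E = (c * P * Q)%:E)%E.
Proof.
move=> mp mq p0 q0 c0 eP eQ.
have Q0 : 0 <= Q by rewrite -lee_fin -eQ; apply: integral_ge0 => y _; rewrite lee_fin.
rewrite integral_area/=; last 2 first.
- by apply/measurable_EFinP; measurability; exact: measurableT_comp.
- by move=> z; rewrite lee_fin !mulr_ge0.
transitivity (\int[mu]_x ((c * Q)%:E * (p x)%:E))%E.
  apply: eq_integral => x _.
  transitivity (\int[mu]_y ((c * p x)%:E * (q y)%:E))%E.
    by apply: eq_integral => y _; rewrite -EFinM.
  rewrite ge0_integralZl//; first by rewrite eQ -!EFinM; congr EFin; ring.
  - exact/measurable_EFinP.
  - by move=> y _; rewrite lee_fin.
  - by rewrite lee_fin mulr_ge0.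
rewrite ge0_integralZl//; first by rewrite eP -!EFinM; congr EFin; ring.
- exact/measurable_EFinP.
- by move=> y _; rewrite lee_fin.
- by rewrite lee_fin mulr_ge0.
Qed.

Variable D : R * R -> R.
Hypothesis mD : measurable_fun setT D.
Hypothesis D0 : forall z, 0 <= D z.

Definition inside2 a (x : R * R) : R := inside a x.1 * inside a x.2.

(** When [D] is the indicator of a disc around 0, the integral over z is the area of the part of the
    square that lies in the disc around x. *)
Definition shifted (a : R) (x z : R * R) : R :=
  D z * (inside a (x.1 + z.1) * inside a (x.2 + z.2)).

Lemma shifted_ge0 a x z : 0 <= shifted a x z.
Proof. by rewrite !mulr_ge0// inside_ge0. Qed.

Lemma measurable_shifted d (T : measurableType d) a (f g : T -> R * R) :
  measurable_fun setT f -> measurable_fun setT g ->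
  measurable_fun setT (fun x => shifted a (f x) (g x)).
Proof.
move=> mf mg; rewrite /shifted; apply: measurable_funM; first exact: measurableT_comp.
by apply: measurable_funM; apply: measurable_inside; measurability.
Qed.

Lemma inside3_ge0 a s t x : 0 <= inside a x * (inside a (x + s) * inside a (x + t)).
Proof. by rewrite !mulr_ge0// inside_ge0. Qed.

Lemma inside_idem a x : inside a x * inside a x = inside a x.
Proof. by rewrite -natrM mulnb andbb. Qed.

Lemma inside2_ge0 a x : 0 <= inside2 a x.
Proof. by rewrite mulr_ge0// inside_ge0. Qed.

Lemma measurable_inside2 d (T : measurableType d) a (f : T -> R * R) :
  measurable_fun setT f -> measurable_fun setT (fun x => inside2 a (f x)).
Proof.
by move=> mf; apply: measurable_funM; apply: measurable_inside; measurability.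
Qed.

(** For a fixed displacement z the integral over x splits into the two coordinates. A single shift
    is treated as two equal ones, which is harmless because [inside] is idempotent, so that
    [overlap] serves both moments. *)
Lemma mean_overlap a :
  (\int[A]_x ((inside2 a x)%:E * \int[A]_z (shifted a x z)%:E) =
   \int[mu]_s \int[mu]_u (D (s, u) * overlap a s s * overlap a u u)%:E)%E.
Proof.
pose F (w : (R * R) * (R * R)) : \bar R := (inside2 a w.1 * shifted a w.1 w.2)%:E.
have mF : measurable_fun [set: _] F.
  apply/measurable_EFinP; apply: measurable_funM; last exact: measurable_shifted.
  by apply: measurable_inside2; measurability.
have F0 w : (0 <= F w)%E by rewrite lee_fin mulr_ge0 ?shifted_ge0// inside2_ge0.
transitivity (\int[A]_x \int[A]_z F (x, z))%E.
  apply: eq_integral => x _; rewrite -ge0_integralZl//.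
  - by apply/measurable_EFinP; exact: measurable_shifted.
  - by move=> z _; rewrite lee_fin shifted_ge0.
  - by rewrite lee_fin inside2_ge0.
apply: (etrans (fubini_tonelli (m1 := A) (m2 := A) F mF F0)).
transitivity (\int[A]_z (D z * overlap a z.1 z.1 * overlap a z.2 z.2)%:E)%E; last first.
  rewrite integral_area//.
  - apply/measurable_EFinP; apply: measurable_funM; last by apply: measurable_overlap; measurability.
    by apply: measurable_funM => //; apply: measurable_overlap; measurability.
  - by move=> z; rewrite lee_fin !mulr_ge0// overlap_ge0.
apply: eq_integral => -[s u] _ /=.
rewrite -(integral_area_prod (measurable_inside3 a s s) (measurable_inside3 a u u)
  (inside3_ge0 a s s) (inside3_ge0 a u u) (D0 _) (integral_inside3 a s s) (integral_inside3 a u u)).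
apply: eq_integral => -[x y] _ /=; congr EFin; rewrite /F /inside2 /shifted/= !inside_idem; ring.
Qed.

(** The square of the inner integral is a double integral over displacements z and z'. Moving x
    innermost and integrating over it leaves one [overlap] factor per coordinate. *)
Lemma mean_sqr_overlap a :
  (\int[A]_x ((inside2 a x)%:E *
     (\int[A]_z (shifted a x z)%:E * \int[A]_z (shifted a x z)%:E)) =
   \int[mu]_s \int[mu]_t \int[mu]_u \int[mu]_v
     (D (s, u) * D (t, v) * overlap a s t * overlap a u v)%:E)%E.
Proof.
pose F x z z' : \bar R := (inside2 a x * (shifted a x z * shifted a x z'))%:E.
have mF d (T : measurableType d) (f g h : T -> R * R) :
    measurable_fun setT f -> measurable_fun setT g -> measurable_fun setT h ->
    measurable_fun setT (fun w => F (f w) (g w) (h w)).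
  move=> mf mg mh; apply/measurable_EFinP; apply: measurable_funM; last first.
    by apply: measurable_funM; apply: measurable_shifted.
  exact: measurable_inside2.
have F0 x z z' : (0 <= F x z z')%E by rewrite lee_fin !mulr_ge0 ?shifted_ge0// inside_ge0.
have ms x : measurable_fun [set: R * R] (fun z => (shifted a x z)%:E).
  by apply/measurable_EFinP; exact: measurable_shifted.
have s0 x z : [set: R * R] z -> (0 <= (shifted a x z)%:E)%E by rewrite lee_fin shifted_ge0.
have expand x : ((inside2 a x)%:E *
     (\int[A]_z (shifted a x z)%:E * \int[A]_z (shifted a x z)%:E) =
     \int[A]_z \int[A]_z' F x z z')%E.
  rewrite -(ge0_integralZr A measurableT (ms x) (s0 x)); last by apply: integral_ge0; exact: s0.
  rewrite -ge0_integralZl//; last 3 first.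
  - apply: emeasurable_funM => //; exact: measurable_cst.
  - by move=> z _; rewrite mule_ge0 ?s0//; apply: integral_ge0; exact: s0.
  - by rewrite lee_fin inside2_ge0.
  apply: eq_integral => z _.
  rewrite -(ge0_integralZl A measurableT (ms x) (s0 x)) ?s0//.
  rewrite -ge0_integralZl//.
  - by apply: emeasurable_funM => //; exact: measurable_cst.
  - by move=> z' _; rewrite mule_ge0 ?s0.
  - by rewrite lee_fin inside2_ge0.
under eq_integral do rewrite expand.
pose F3 (w : (R * R) * (R * R)) : \bar R := (\int[A]_z' F w.1 w.2 z')%E.
have mF3 : measurable_fun [set: _] F3.
  have mF' : measurable_fun [set: _] (fun w : ((R * R) * (R * R)) * (R * R) => F w.1.1 w.1.2 w.2).
    by apply: mF; measurability.
  exact: (measurable_fun_fubini_tonelli_F (m2 := A) _ mF' (fun=> F0 _ _ _)).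
have F30 w : (0 <= F3 w)%E by exact: integral_ge0.
apply: (etrans (fubini_tonelli (m1 := A) (m2 := A) F3 mF3 F30)); rewrite /F3/=.
pose G (z z' : R * R) : \bar R :=
  (D z * D z' * overlap a z.1 z'.1 * overlap a z.2 z'.2)%:E.
have G0 z z' : (0 <= G z z')%E by rewrite lee_fin !mulr_ge0// overlap_ge0.
have mG d (T : measurableType d) (f g : T -> R * R) :
    measurable_fun setT f -> measurable_fun setT g ->
    measurable_fun setT (fun w => G (f w) (g w)).
  move=> mf mg; apply/measurable_EFinP; apply: measurable_funM; last first.
    by apply: measurable_overlap; measurability.
  apply: measurable_funM; last by apply: measurable_overlap; measurability.
  by apply: measurable_funM; exact: measurableT_comp.
transitivity (\int[A]_z \int[A]_z' G z z')%E.
  apply: eq_integral => z _.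
  have mFz : measurable_fun [set: _] (fun w : (R * R) * (R * R) => F w.1 z w.2).
    by apply: mF; measurability.
  apply: (etrans (fubini_tonelli (m1 := A) (m2 := A) _ mFz (fun=> F0 _ _ _))) => /=.
  apply: eq_integral => z' _; rewrite /G.
  rewrite -(integral_area_prod (measurable_inside3 a z.1 z'.1) (measurable_inside3 a z.2 z'.2)
    (inside3_ge0 a _ _) (inside3_ge0 a _ _) (mulr_ge0 (D0 _) (D0 _))
    (integral_inside3 a _ _) (integral_inside3 a _ _)).
  apply: eq_integral => x _ /=; congr EFin; rewrite /inside2 /shifted/=; ring.
rewrite integral_area; last 2 first.
- have mG' : measurable_fun [set: _] (fun w : (R * R) * (R * R) => G w.1 w.2).
    by apply: mG; measurability.
  exact: (measurable_fun_fubini_tonelli_F (m2 := A) _ mG' (fun=> G0 _ _)).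
- by move=> z; exact: integral_ge0.
apply: eq_integral => s _.
have mGs u : measurable_fun [set: R * R] (fun z' => G (s, u) z').
  by apply: mG; measurability.
transitivity (\int[mu]_u \int[mu]_t \int[mu]_v G (s, u) (t, v))%E.
  by apply: eq_integral => u _; rewrite integral_area.
have mGs' : measurable_fun [set: _] (fun w : (R * R) * R => G (s, w.1.1) (w.1.2, w.2)).
  by apply: mG; apply: measurable_fun_pair; measurability.
have := measurable_fun_fubini_tonelli_F (m2 := mu) _ mGs' (fun=> G0 _ _).
set G4 := fubini_F _ _ => mG4.
have G40 w : (0 <= G4 w)%E by exact: integral_ge0.
(* The variables now come in the order s, u, t, v; exchanging u and t groups them by coordinate. *)
exact: (fubini_tonelli (m1 := mu) (m2 := mu) G4 mG4 G40).
Qed.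

End Overlap.

(** * Rules for derivatives and continuity, driven by the syntax of the function *)

Section Derive1.
Context {R : realType}.
Implicit Types (f g : R -> R) (x a b c : R).

Lemma is_derive1_add f g x a b : is_derive x 1 f a -> is_derive x 1 g b ->
  is_derive x 1 (fun t => f t + g t) (a + b).
Proof. by move=> df dg; exact: (is_deriveD df dg). Qed.

Lemma is_derive1_sub f g x a b : is_derive x 1 f a -> is_derive x 1 g b ->
  is_derive x 1 (fun t => f t - g t) (a - b).
Proof. by move=> df dg; exact: (is_deriveB df dg). Qed.

Lemma is_derive1_mul f g x a b : is_derive x 1 f a -> is_derive x 1 g b ->
  is_derive x 1 (fun t => f t * g t) (a * g x + f x * b).
Proof.
move=> df dg; have := is_deriveM df dg; rewrite /GRing.scale/= addrC (mulrC (g x)).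
exact.
Qed.

Lemma is_derive1_exp f n x a : is_derive x 1 f a ->
  is_derive x 1 (fun t => f t ^+ n.+1) (n.+1%:R * f x ^+ n * a).
Proof.
by move=> df; have := is_deriveX n.+1 df; rewrite exprfctE.
Qed.

(** [derive1] finds the derivative by unification, in whatever form the rules produce; the
    comparison with the intended formula is left to [ring] or [field]. *)
Lemma is_derive1_ext f x a b : is_derive x 1 f a -> a = b -> is_derive x 1 f b.
Proof. by move=> + <-. Qed.

Lemma is_derive1_inv f x a : f x != 0 -> is_derive x 1 f a ->
  is_derive x 1 (fun t => (f t)^-1) (- a / f x ^+ 2).
Proof.
move=> fx0 df; have := is_deriveV fx0 df; rewrite /GRing.scale/=.
by rewrite (_ : - f x ^- 2 * a = - a / f x ^+ 2)//; field.
Qed.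

Lemma continuous_add1 f g : continuous f -> continuous g ->
  continuous (fun t => f t + g t).
Proof. by move=> cf cg t; apply: cvgD; [exact: cf|exact: cg]. Qed.

Lemma continuous_sub1 f g : continuous f -> continuous g ->
  continuous (fun t => f t - g t).
Proof. by move=> cf cg t; apply: cvgB; [exact: cf|exact: cg]. Qed.

Lemma continuous_mul1 f g : continuous f -> continuous g ->
  continuous (fun t => f t * g t).
Proof. by move=> cf cg t; apply: cvgM; [exact: cf|exact: cg]. Qed.

Lemma continuous_exp1 f n : continuous f -> continuous (fun t => f t ^+ n).
Proof.
move=> cf t; exact: (continuous_comp (cf t) (@exprn_continuous _ n (f t))).
Qed.

Lemma continuous_cst1 a : continuous (fun _ : R => a).
Proof. by move=> t; exact: cvg_cst. Qed.

Lemma continuous_id1 : continuous (fun t : R => t).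
Proof. by move=> t; exact: cvg_id. Qed.

End Derive1.

Ltac continuity1 :=
  lazymatch goal with
  | |- continuous (fun t => (@?f t - @?g t)%R) =>
      apply: (@continuous_sub1 _ f g); continuity1
  | |- continuous (fun t => (@?f t + @?g t)%R) =>
      apply: (@continuous_add1 _ f g); continuity1
  | |- continuous (fun t => (@?f t * @?g t)%R) =>
      apply: (@continuous_mul1 _ f g); continuity1
  | |- continuous (fun t => (@?f t ^+ ?n)%R) =>
      apply: (@continuous_exp1 _ f n); continuity1
  | |- _ => first [exact: continuous_id1 | assumption | exact: continuous_cst1]
  end.

Ltac derive1 :=
  lazymatch goal with
  | |- is_derive _ _ (fun t => (@?f t - @?g t)%R) _ =>
      apply: (@is_derive1_sub _ f g); derive1
  | |- is_derive _ _ (fun t => (@?f t + @?g t)%R) _ =>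
      apply: (@is_derive1_add _ f g); derive1
  | |- is_derive _ _ (fun t => (@?f t * @?g t)%R) _ =>
      apply: (@is_derive1_mul _ f g); derive1
  | |- is_derive _ _ (fun t => (@?f t ^+ (S ?n))%R) _ =>
      apply: (@is_derive1_exp _ f n); derive1
  | |- _ => first [exact: is_derive_id | eassumption | exact: is_derive_cst]
  end.

(** * Integrals over the disc *)

Section HalfChord.
Context {R : realType}.
Variable r : R.
Hypothesis r0 : 0 < r.
Implicit Types t : R.

(** As the square root of a negative number is 0, this function vanishes outside of the disc and is
    continuous on the whole line. *)
Definition half_chord t : R := Num.sqrt (r ^+ 2 - t ^+ 2).

(* The primitive of [half_chord] on [[0, r]]; the arctangent is half of the arcsine of [t / r]. *)
Definition strip_area t : R :=
  (t * half_chord t + r ^+ 2 * (2 * atan (t / (r + half_chord t)))) / 2.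

Lemma half_chord_ge0 t : 0 <= half_chord t.
Proof. exact: sqrtr_ge0. Qed.

Lemma half_chord_sqr t : 0 <= t <= r -> half_chord t ^+ 2 = r ^+ 2 - t ^+ 2.
Proof.
by move=> /andP[t0 tr]; rewrite sqr_sqrtr// subr_ge0 lerXn2r// nnegrE// (le_trans t0).
Qed.

Lemma half_chord0 : half_chord 0 = r.
Proof. by rewrite /half_chord expr0n subr0 sqrtr_sqr gtr0_norm. Qed.

Lemma half_chordr : half_chord r = 0.
Proof. by rewrite /half_chord subrr sqrtr0. Qed.

Lemma half_chord_gt0 t : 0 < t < r -> 0 < half_chord t.
Proof.
move=> /andP[t0 tr]; rewrite sqrtr_gt0 subr_gt0 ltrXn2r// ?nnegrE ltW// (lt_trans t0).
Qed.

Lemma half_chord_anti s t : 0 <= t <= s -> half_chord s <= half_chord t.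
Proof.
move=> /andP[t0 ts]; rewrite ler_wsqrtr// lerD2l lerN2 lerXn2r// nnegrE//.
exact: le_trans ts.
Qed.

Lemma half_chord_le s : 0 <= s -> half_chord s <= r.
Proof. by move=> s0; rewrite -[leRHS]half_chord0 half_chord_anti// lexx. Qed.

Lemma half_chord_den t : 0 < r + half_chord t.
Proof. by rewrite ltr_wpDr// half_chord_ge0. Qed.

Lemma continuous_half_chord : continuous half_chord.
Proof.
move=> t; apply: (continuous_comp (f := fun t => r ^+ 2 - t ^+ 2)).
  by apply: cvgB; [exact: cvg_cst|exact: exprn_continuous].
exact: sqrt_continuous.
Qed.

(** The denominator r + [half_chord] t never vanishes. This is the benefit of the half angle: the
    arctangent of t / [half_chord] t would be singular at t = r. *)
Lemma continuous_strip_area : continuous strip_area.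
Proof.
move=> t; apply: cvgM; last exact: cvg_cst.
apply: cvgD.
  by apply: cvgM; [exact: cvg_id|exact: continuous_half_chord].
apply: cvgM; first exact: cvg_cst.
apply: cvgM; first exact: cvg_cst.
apply: (continuous_comp (f := fun t => t / (r + half_chord t))); last exact: continuous_atan.
apply: cvgM; first exact: cvg_id.
apply: cvgV; first by rewrite gt_eqF// half_chord_den.
by apply: cvgD; [exact: cvg_cst|exact: continuous_half_chord].
Qed.

Lemma is_derive_half_chord t : 0 < t < r ->
  is_derive t 1 half_chord (- t / half_chord t).
Proof.
move=> tr; have h0 := half_chord_gt0 tr.
have dh : 0 < r ^+ 2 - t ^+ 2 by rewrite -sqrtr_gt0.
have ds := is_derive1_sqrt dh.
have dp : is_derive t 1 (fun t => r ^+ 2 - t ^+ 2) (0 - 2 * t ^+ 1 * 1) by derive1.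
have := is_derive1_comp (f := Num.sqrt) (g := fun t => r ^+ 2 - t ^+ 2) ds dp.
rewrite -/(half_chord t) (_ : _ * _ = - t / half_chord t)//; field.
by rewrite gt_eqF.
Qed.

Lemma is_derive_strip_area t : 0 < t < r ->
  is_derive t 1 strip_area (half_chord t).
Proof.
move=> tr; have h0 := half_chord_gt0 tr; have dh := is_derive_half_chord tr.
have d0 := half_chord_den t.
have hn0 : half_chord t != 0 by rewrite gt_eqF.
have dn0 : r + half_chord t != 0 by rewrite gt_eqF.
have dV : is_derive t 1 (fun t => (r + half_chord t)^-1)
    (- (0 + - t / half_chord t) / (r + half_chord t) ^+ 2).
  by apply: is_derive1_inv => //; derive1.
have dq : is_derive t 1 (fun t => t * (r + half_chord t)^-1)
  (1 * (r + half_chord t)^-1 + t * (- (0 + - t / half_chord t) / (r + half_chord t) ^+ 2)).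
  by derive1.
have da := is_derive1_comp (f := atan) (is_derive1_atan _) dq.
have := is_derive1_mul (is_derive1_add (is_derive1_mul (is_derive_id t (1 : R)) dh)
  (is_derive1_mul (is_derive_cst (r ^+ 2 : R) t (1 : R))
    (is_derive1_mul (is_derive_cst (2 : R) t (1 : R)) da))) (is_derive_cst (2^-1 : R) t (1 : R)).
have hh : half_chord t ^+ 2 = r ^+ 2 - t ^+ 2.
  by rewrite half_chord_sqr//; case/andP: tr => /ltW -> /ltW ->.
set v := (X in is_derive _ _ _ X -> _); suff -> : v = half_chord t by [].
rewrite {}/v.
have e2 : t ^+ 2 = r ^+ 2 - half_chord t ^+ 2 by rewrite hh opprB addrC subrK.
(* Here t^2 = (r - h)(r + h) with h the half chord at t, so the sum is ((r + h) + (r - h)) / (r +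
   h). *)
have e1 : 1 + (t * (r + half_chord t)^-1) ^+ 2 = 2 * r / (r + half_chord t).
  by rewrite exprMn e2; field.
rewrite e1.
have -> : 1 * (r + half_chord t)^-1 + t * (- (0 + - t / half_chord t) / (r + half_chord t) ^+ 2) =
   r / (half_chord t * (r + half_chord t)).
  have -> : t * (- (0 + - t / half_chord t) / (r + half_chord t) ^+ 2) =
    t ^+ 2 / (half_chord t * (r + half_chord t) ^+ 2) by field; rewrite hn0 dn0.
  by rewrite e2; field; rewrite hn0 dn0.
have -> : t * (- t / half_chord t) = - (t ^+ 2 / half_chord t) by field; rewrite hn0.
rewrite e2 /=; field; rewrite hn0 dn0 gt_eqF//.
Qed.

Lemma strip_area0 : strip_area 0 = 0.
Proof. by rewrite /strip_area mul0r mul0r atan0 !mulr0 addr0 mul0r. Qed.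

Lemma strip_arear : strip_area r = pi * r ^+ 2 / 4.
Proof.
rewrite /strip_area half_chordr addr0 divff ?gt_eqF// atan1; by field.
Qed.

End HalfChord.

Section Evaluate.
Context {R : realType}.
Variable mu : {sigma_finite_measure set R -> \bar R}.
Hypothesis muE : forall (D : set R) (f : R -> \bar R), measurable D -> measurable_fun D f ->
  (\int[mu]_(x in D) f x = \int[lebesgue_measure]_(x in D) f x)%E.
Variables r a : R.
Hypothesis r0 : 0 < r.

Local Notation h := (half_chord r).
Local Notation area_h := (strip_area r).

Definition disc (z : R * R) : R := (z.1 ^+ 2 + z.2 ^+ 2 <= r ^+ 2)%R%:R.

Lemma disc_ge0 z : 0 <= disc z.
Proof. exact: ler0n. Qed.

Lemma measurable_disc d (T : measurableType d) (f : T -> R * R) :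
  measurable_fun setT f -> measurable_fun setT (fun x => disc (f x)).
Proof. by move=> mf; rewrite /disc; measurability. Qed.

Lemma discN1 s u : disc (- s, u) = disc (s, u).
Proof. by rewrite /disc/= sqrrN. Qed.

Lemma discN2 s u : disc (s, - u) = disc (s, u).
Proof. by rewrite /disc/= sqrrN. Qed.

Lemma discE s u : 0 <= s <= r -> 0 <= u -> disc (s, u) = (u <= h s)%R%:R.
Proof.
move=> sr u0; rewrite /disc/= addrC -lerBrDr -half_chord_sqr//.
by rewrite ler_sqr// nnegrE// half_chord_ge0.
Qed.

Lemma disc_out s u : r < s -> disc (s, u) = 0.
Proof.
move=> rs; rewrite /disc/= leNgt (_ : _ < _)//.
have : 0 < (s - r) * (s + r) by apply: mulr_gt0; move: r0 rs; lra.
by have := sqr_ge0 u; lra.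
Qed.

Lemma integral_support (b : R) (F : R -> \bar R) :
  (forall x, b < x -> F x = 0%E) ->
  (\int[mu]_(x in `[0%R, +oo[) F x = \int[mu]_(x in `[0%R, b]) F x)%E.
Proof.
move=> F0; rewrite integral_mkcond [RHS]integral_mkcond; apply: eq_integral => x _.
rewrite /patch !mem_setE !in_itv/= andbT.
by case: (leP x b) => [|/F0]; rewrite ?andbT// andbF => ->; case: ifP.
Qed.

Lemma integral_itv_derivem (f F : R -> R) (x y : R) : x <= y -> continuous f -> continuous F ->
  (forall z, x < z < y -> is_derive z 1 F (f z)) ->
  (\int[mu]_(z in `[x, y]) (f z)%:E = (F y - F x)%:E)%E.
Proof.
move=> xy cf cF dF; rewrite muE//; first exact: integral_itv_derive.
by apply: measurable_funTS; apply/measurable_EFinP; exact: continuous_measurable_fun.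
Qed.

Lemma integral_slice s (F : R -> \bar R) : 0 <= s <= r ->
  (forall u, 0 <= u -> disc (s, u) = 0 -> F u = 0%E) ->
  (\int[mu]_(u in `[0%R, +oo[) F u = \int[mu]_(u in `[0%R, h s]) F u)%E.
Proof.
move=> sr F0; apply: integral_support => u hu.
have u0 : 0 <= u by rewrite (le_trans (half_chord_ge0 r s))// ltW.
by apply: F0 => //; rewrite discE// leNgt hu.
Qed.

Lemma overlapNN s : overlap a (- s) (- s) = overlap a s s.
Proof.
rewrite /overlap !opprK; congr Num.max; rewrite -!minA !minxx -!maxA !maxxx /Num.min /Num.max.
by do 4 (case: ltP => ?); lra.
Qed.

(** Symmetry reduces the disc to its quarter with a factor 4. There r <= a makes the overlaps a - s
    and a - u, without cut-off, and u runs up to [h s]. *)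
Lemma integral_mean_overlap : r <= a ->
  (\int[mu]_s \int[mu]_u (disc (s, u) * overlap a s s * overlap a u u)%:E =
   (pi * r ^+ 2 * a ^+ 2 - 8 / 3 * r ^+ 3 * a + r ^+ 4 / 2)%:E)%E.
Proof.
move=> ra.
pose f z : \bar R := (disc z * overlap a z.1 z.1 * overlap a z.2 z.2)%:E.
have mf : measurable_fun [set: R * R] f.
  apply/measurable_EFinP; apply: measurable_funM; last by apply: measurable_overlap; measurability.
  by apply: measurable_funM; [apply: measurable_disc|apply: measurable_overlap]; measurability.
have f0 z : (0 <= f z)%E by rewrite lee_fin !mulr_ge0 ?disc_ge0// overlap_ge0.
apply: (etrans (integral_fold2 muE mf f0)).
have fE s u : (f (s, u) + f (s, - u)%R + (f (- s, u)%R + f (- s, - u)%R) =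
    (4 * disc (s, u) * overlap a s s * overlap a u u)%:E)%E.
  rewrite /f/= !discN1 !discN2 !overlapNN -!EFinD; congr EFin; ring.
under eq_integral do under eq_integral do rewrite fE.
rewrite (@integral_support r); last first.
  move=> s rs; apply: integral0_eq => u _.
  by rewrite disc_out// mulr0 !mul0r.
have ovE s : 0 <= s <= r -> overlap a s s = a - s.
  move=> /andP[s0 sr]; rewrite /overlap -minA minxx -maxA maxxx /Num.min /Num.max.
  by case: (ltP a (a - s)) => ?; case: (ltP 0 (- s)) => ?; case: ltP => ?; lra.
transitivity (\int[mu]_(s in `[0%R, r]) (4 * (a - s) * (a * h s - (r ^+ 2 - s ^+ 2) / 2))%:E)%E.
  apply: eq_integral => s; rewrite inE/= in_itv/= => sr.
  have s0 : 0 <= s by case/andP: sr.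
  rewrite (@integral_slice s)//; last by move=> u _ ->; rewrite mulr0 !mul0r.
  transitivity (\int[mu]_(u in `[0%R, h s]) (4 * (a - s) * (a - u))%:E)%E.
    apply: eq_integral => u; rewrite inE/= in_itv/= => /andP[u0 us].
    by rewrite discE// us mulr1 !ovE ?u0 ?(le_trans us)// half_chord_le.
  pose F u := 4 * (a - s) * (a * u - u ^+ 2 / 2).
  transitivity (F (h s) - F 0)%:E; first apply: (@integral_itv_derivem _ F).
  - exact: half_chord_ge0.
  - by rewrite /F; continuity1.
  - by rewrite /F; continuity1.
  - move=> u _.
    have -> : 4 * (a - s) * (a - u) = 0 * (a * u - u ^+ 2 / 2) + 4 * (a - s) *
      ((0 * u + a * 1) - (2 * u ^+ 1 * 1 / 2 + u ^+ 2 * 0)) by field.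
    by rewrite /F; derive1.
  - rewrite /F -half_chord_sqr//; congr EFin; ring.
have ch : continuous h := @continuous_half_chord _ r.
have cA := continuous_strip_area r0.
(* A primitive term by term: h has the primitive [area_h], s h has - h^3 / 3, and the other terms
   are polynomials because h^2 = r^2 - s^2. *)
pose F s := 4 * (a ^+ 2 * area_h s + a / 3 * h s ^+ 3
  - a / 2 * (r ^+ 2 * s - s ^+ 3 / 3) + (r ^+ 2 * s ^+ 2 / 2 - s ^+ 4 / 4) / 2).
transitivity (F r - F 0)%:E; first apply: (@integral_itv_derivem _ F).
- exact: ltW.
- by rewrite /F; continuity1.
- by rewrite /F; continuity1.
- move=> s sr; have dh := is_derive_half_chord sr; have dA := is_derive_strip_area r0 sr.
  have h0 := half_chord_gt0 sr.
  eapply is_derive1_ext; first by rewrite /F; derive1.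
  have -> : r ^+ 2 = h s ^+ 2 + s ^+ 2.
    by rewrite half_chord_sqr ?subrK//; case/andP: sr => /ltW -> /ltW ->.
  by rewrite /GRing.scale/=; field; rewrite gt_eqF.
- rewrite /F half_chordr strip_arear// half_chord0// strip_area0; congr EFin; by field.
Qed.

(** The sum of the overlaps at the four points with coordinates plus or minus s and t, for s, t >=
    0: shifts of equal sign leave the length a - max(s, t), shifts of opposite signs a - s - t. *)
Definition fold_overlap s t : R := 4 * a - 2 * s - 2 * t - 2 * Num.max s t.

Definition fold_overlap4 s t : R :=
  overlap a s t + overlap a s (- t) + (overlap a (- s) t + overlap a (- s) (- t)).

Lemma overlapC s t : overlap a s t = overlap a t s.
Proof. by rewrite /overlap minAC maxAC. Qed.

Lemma fold_overlap4C s t : fold_overlap4 s t = fold_overlap4 t s.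
Proof.
by rewrite /fold_overlap4 !(overlapC t) (overlapC (- t) s) (overlapC (- t) (- s)); ring.
Qed.

Lemma fold_overlap4_ge0 s t : 0 <= fold_overlap4 s t.
Proof. by rewrite /fold_overlap4 !addr_ge0// overlap_ge0. Qed.

Lemma measurable_fold_overlap4 d (T : measurableType d) (f g : T -> R) :
  measurable_fun setT f -> measurable_fun setT g ->
  measurable_fun setT (fun x => fold_overlap4 (f x) (g x)).
Proof.
by move=> mf mg; rewrite /fold_overlap4; apply: measurable_funD;
  apply: measurable_funD; apply: measurable_overlap; measurability.
Qed.

Lemma overlapE s t : overlap a s t =
  Num.max 0 (a - Num.max (Num.max 0 s) t - Num.max (Num.max 0 (- s)) (- t)).
Proof.
rewrite /overlap; congr (Num.max _ (_ - _)).
by rewrite !oppr_max !addr_minr oppr0 addr0.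
Qed.

(** The bound 2r <= a gives s + t <= a, so that none of the four overlaps is cut off at 0. The
    condition on r in the closed form of E h_1^2 comes from here. *)
Lemma fold_overlap4E s t : 2 * r <= a -> 0 <= s <= r -> 0 <= t <= r ->
  fold_overlap4 s t = fold_overlap s t.
Proof.
move=> ra.
wlog st : s t / t <= s.
  move=> H; case: (leP t s) => [|/ltW]; first exact: H.
  move=> st sr tr; rewrite fold_overlap4C H// /fold_overlap maxC; ring.
move=> /andP[s0 sr] /andP[t0 tr]; rewrite /fold_overlap4 /fold_overlap !overlapE !opprK.
rewrite (max_l st) !(max_r s0) (max_l st).
have ns : - s <= 0 by rewrite oppr_le0.
have nt : - t <= 0 by rewrite oppr_le0.
rewrite !(max_l ns) !(max_l nt) (max_r t0) (@max_l _ _ s (- t)) ?(le_trans nt)//.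
by rewrite !max_r; lra.
Qed.

Definition disc2 s t : \bar R := (\int[mu]_u \int[mu]_v
  (disc (s, u) * disc (t, v) * overlap a u v)%:E)%E.

Lemma disc2_fold s t :
  (disc2 s t = \int[mu]_(u in `[0%R, +oo[) \int[mu]_(v in `[0%R, +oo[)
    (disc (s, u) * disc (t, v) * fold_overlap4 u v)%:E)%E.
Proof.
pose f (w : R * R) : \bar R := (disc (s, w.1) * disc (t, w.2) * overlap a w.1 w.2)%:E.
have mf : measurable_fun [set: R * R] f.
  apply/measurable_EFinP; apply: measurable_funM; last by apply: measurable_overlap; measurability.
  by apply: measurable_funM; apply: measurable_disc; apply: measurable_fun_pair; measurability.
have f0 z : (0 <= f z)%E by rewrite lee_fin !mulr_ge0 ?disc_ge0// overlap_ge0.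
apply: (etrans (integral_fold2 muE mf f0)).
apply: eq_integral => u _; apply: eq_integral => v _.
rewrite /f /= !discN2 -!EFinD /fold_overlap4; congr EFin; ring.
Qed.

(** The interval is cut at v = u, where the maximum changes its branch. The second hypothesis keeps
    the integrand nonnegative, which the additivity over the two pieces requires. *)
Lemma integral_fold_overlap u b : 0 <= u <= b -> 0 <= 4 * a - 2 * u - 4 * b ->
  (\int[mu]_(v in `[0%R, b]) (fold_overlap u v)%:E =
   (4 * a * b - 2 * u * b - 2 * b ^+ 2 - u ^+ 2)%:E)%E.
Proof.
move=> /andP[u0 ub] ab.
have <- : (`[0%R, u] `|` `]u, b] = `[0%R, b])%classic.
  apply/seteqP; split => v /=; rewrite !in_itv/=.
    by move=> [/andP[-> vu]|/andP[uv ->]]; [rewrite (le_trans vu)|rewrite (le_trans u0)// ltW].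
  by move=> /andP[v0 vb]; case: (leP v u) => vu; [left; rewrite v0|right].
have mF : measurable_fun [set: R] (fun v => (fold_overlap u v)%:E).
  by apply/measurable_EFinP; rewrite /fold_overlap; measurability.
rewrite ge0_integral_setU//=; last 3 first.
- exact: measurable_funTS.
- move=> v vb; rewrite lee_fin /fold_overlap.
  have {}vb : v <= b.
    by move: vb => /=; rewrite !in_itv/= => -[/andP[_ /le_trans->//]|/andP[]].
  have : Num.max u v <= b by rewrite ge_max ub.
  by move: ab vb; lra.
- apply/disj_setPS => y /=; rewrite !in_itv/= => -[/andP[_]].
  by rewrite leNgt => /negP h /andP[].
have -> : (\int[mu]_(v in `]u, b]) (fold_overlap u v)%:E =
    \int[mu]_(v in `[u, b]) (4 * a - 2 * u - 4 * v)%:E)%E.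
  rewrite muE//; last exact: measurable_funTS.
  rewrite integral_itv_obnd_cbnd; last exact: measurable_funTS.
  rewrite -muE//; last exact: measurable_funTS.
  apply: eq_integral => v; rewrite inE/= in_itv/= => /andP[uv _].
  by rewrite /fold_overlap max_r//; congr EFin; ring.
have -> : (\int[mu]_(v in `[0%R, u]) (fold_overlap u v)%:E =
    \int[mu]_(v in `[0%R, u]) (4 * a - 4 * u - 2 * v)%:E)%E.
  apply: eq_integral => v; rewrite inE/= in_itv/= => /andP[_ vu].
  by rewrite /fold_overlap max_l//; congr EFin; ring.
pose F1 v := (4 * a - 2 * u) * v - 2 * v ^+ 2.
pose F2 v := (4 * a - 4 * u) * v - v ^+ 2.
transitivity ((F2 u - F2 0)%:E + (F1 b - F1 u)%:E)%E; last first.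
  rewrite -EFinD /F1 /F2; congr EFin; ring.
congr (_ + _)%E.
- apply: (@integral_itv_derivem _ F2) => //; rewrite ?/F2; [by continuity1|by continuity1|].
  move=> v _; eapply is_derive1_ext; first by derive1.
  by rewrite /GRing.scale/=; ring.
- apply: (@integral_itv_derivem _ F1) => //; rewrite ?/F1; [by continuity1|by continuity1|].
  move=> v _; eapply is_derive1_ext; first by derive1.
  by rewrite /GRing.scale/=; ring.
Qed.

Definition disc2_val s t : R :=
  4 * a * h s * h t - h s ^+ 2 * h t - 2 * h s * h t ^+ 2 - h s ^+ 3 / 3.

(** For t <= s the half chord at s is the shorter one. Hence u <= [h s] <= [h t], and the integral
    over v up to [h t] passes the diagonal v = u. *)
Lemma disc2E s t : 2 * r <= a -> 0 <= t <= s -> s <= r ->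
  disc2 s t = (disc2_val s t)%:E.
Proof.
move=> ra /andP[t0 ts] sr; have s0 := le_trans t0 ts; have tr := le_trans ts sr.
have s0r : 0 <= s <= r by rewrite s0.
have t0r : 0 <= t <= r by rewrite t0.
have hst : h s <= h t by apply: half_chord_anti; rewrite t0.
have htr : h t <= r by exact: half_chord_le.
rewrite disc2_fold (@integral_slice s)//; last first.
  by move=> u u0 ->; apply: integral0_eq => v _; rewrite !mul0r.
transitivity (\int[mu]_(u in `[0%R, h s])
    (4 * a * h t - 2 * u * h t - 2 * h t ^+ 2 - u ^+ 2)%:E)%E.
  apply: eq_integral => u; rewrite inE/= in_itv/= => /andP[u0 us].
  rewrite (@integral_slice t)//; last by move=> v v0 ->; rewrite mulr0 !mul0r.
  have uh : 0 <= u <= h t by rewrite u0 (le_trans us).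
  rewrite -integral_fold_overlap//; last by move: ra uh htr => + /andP[_]; lra.
  apply: eq_integral => v; rewrite inE/= in_itv/= => /andP[v0 vt].
  rewrite !discE// us vt !mul1r fold_overlap4E// ?u0 ?v0/=.
  - by rewrite (le_trans us)// (le_trans hst).
  - by rewrite (le_trans vt).
pose F u := 4 * a * h t * u - u ^+ 2 * h t - 2 * h t ^+ 2 * u - u ^+ 3 / 3.
transitivity (F (h s) - F 0)%:E; last by rewrite /F /disc2_val; congr EFin; field.
apply: (@integral_itv_derivem _ F); rewrite ?half_chord_ge0// ?/F; [by continuity1|by continuity1|].
move=> u _; eapply is_derive1_ext; first by derive1.
by rewrite /GRing.scale/=; field.
Qed.

Lemma disc2_ge0 s t : (0 <= disc2 s t)%E.
Proof.
apply: integral_ge0 => u _; apply: integral_ge0 => v _.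
by rewrite lee_fin !mulr_ge0 ?disc_ge0// overlap_ge0.
Qed.

Lemma measurable_disc2 : measurable_fun [set: R * R] (fun w => disc2 w.1 w.2).
Proof.
pose g (w : ((R * R) * R) * R) : \bar R :=
  (disc (w.1.1.1, w.1.2) * disc (w.1.1.2, w.2) * overlap a w.1.2 w.2)%:E.
have mg : measurable_fun [set: _] g.
  apply/measurable_EFinP; apply: measurable_funM; last by apply: measurable_overlap; measurability.
  by apply: measurable_funM; apply: measurable_disc; apply: measurable_fun_pair; measurability.
have g0 w : (0 <= g w)%E by rewrite lee_fin !mulr_ge0 ?disc_ge0// overlap_ge0.
have m1 := measurable_fun_fubini_tonelli_F (m2 := mu) g mg g0.
apply: (measurable_fun_fubini_tonelli_F (m2 := mu) _ m1) => w.
by apply: integral_ge0 => v _; exact: g0.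
Qed.

Lemma disc2C s t : disc2 s t = disc2 t s.
Proof.
pose g (w : R * R) : \bar R := (disc (s, w.1) * disc (t, w.2) * overlap a w.1 w.2)%:E.
have mg : measurable_fun [set: R * R] g.
  apply/measurable_EFinP; apply: measurable_funM; last by apply: measurable_overlap; measurability.
  by apply: measurable_funM; apply: measurable_disc; apply: measurable_fun_pair; measurability.
have g0 w : (0 <= g w)%E by rewrite lee_fin !mulr_ge0 ?disc_ge0// overlap_ge0.
apply: (etrans (fubini_tonelli (m1 := mu) (m2 := mu) g mg g0)).
apply: eq_integral => v _; apply: eq_integral => u _.
by rewrite /g/= overlapC [disc (s, u) * _]mulrC.
Qed.

(** The weight is [fold_overlap s t] for t <= s. As [h s] is a constant here, only h, h^2, t h and t
    h^2 at t have to be integrated. *)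
Lemma integral_disc2_val s : 0 <= s <= r ->
  (\int[mu]_(t in `[0%R, s]) ((4 * a - 4 * s - 2 * t) * disc2_val s t)%:E =
  ((4 * a - 4 * s) * ((4 * a * h s - h s ^+ 2) * area_h s
     - 2 * h s * (r ^+ 2 * s - s ^+ 3 / 3) - h s ^+ 3 * s / 3)
   + 2 / 3 * (4 * a * h s - h s ^+ 2) * (h s ^+ 3 - r ^+ 3)
   + 2 * h s * (r ^+ 2 * s ^+ 2 - s ^+ 4 / 2) + h s ^+ 3 * s ^+ 2 / 3)%:E)%E.
Proof.
move=> /andP[s0 sr].
pose G t := (4 * a - 4 * s) * ((4 * a * h s - h s ^+ 2) * area_h t
     - 2 * h s * (r ^+ 2 * t - t ^+ 3 / 3) - h s ^+ 3 * t / 3)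
  - 2 * ((4 * a * h s - h s ^+ 2) * ((- 1 / 3) * h t ^+ 3)
     - 2 * h s * (r ^+ 2 * t ^+ 2 / 2 - t ^+ 4 / 4) - h s ^+ 3 * t ^+ 2 / 6).
have ch : continuous h := @continuous_half_chord _ r.
have cA := continuous_strip_area r0.
transitivity (G s - G 0)%:E; first apply: (@integral_itv_derivem _ G).
- exact: s0.
- by rewrite /disc2_val; continuity1.
- by rewrite /G; continuity1.
- move=> t /andP[t0 ts]; have tr : 0 < t < r by rewrite t0 (lt_le_trans ts).
  have dh := is_derive_half_chord tr; have dA := is_derive_strip_area r0 tr.
  have h0 := half_chord_gt0 tr.
  eapply is_derive1_ext; first by rewrite /G; derive1.
  rewrite /disc2_val; have -> : r ^+ 2 = h t ^+ 2 + t ^+ 2.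
    by rewrite half_chord_sqr ?subrK//; case/andP: tr => /ltW -> /ltW ->.
  by rewrite /GRing.scale/=; field; rewrite gt_eqF.
- by rewrite /G strip_area0 half_chord0//; congr EFin; field.
Qed.

(** As [disc2] is even in both arguments and symmetric, the outer double integral folds to the
    quadrant with the weight [fold_overlap4], and then to twice the triangle t <= s, where the
    formulas for ordered arguments apply. *)
Lemma integral_mean_sqr_overlap : 2 * r <= a ->
  (\int[mu]_s \int[mu]_t \int[mu]_u \int[mu]_v
     (disc (s, u) * disc (t, v) * overlap a s t * overlap a u v)%:E =
   (pi ^+ 2 * r ^+ 4 * a ^+ 2 - (8 / 3 * pi + 256 / 45) * r ^+ 5 * a
    + (59 / 48 * pi + 8 / 9) * r ^+ 6)%:E)%E.
Proof.
move=> ra.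
pose f (w : R * R) : \bar R := ((overlap a w.1 w.2)%:E * disc2 w.1 w.2)%E.
have mf : measurable_fun [set: R * R] f.
  apply: emeasurable_funM; last exact: measurable_disc2.
  by apply/measurable_EFinP; apply: measurable_overlap; measurability.
have f0 w : (0 <= f w)%E by rewrite mule_ge0 ?disc2_ge0// lee_fin overlap_ge0.
transitivity (\int[mu]_s \int[mu]_t f (s, t))%E.
  apply: eq_integral => s _; apply: eq_integral => t _.
  pose g w := (disc (s, w.1) * disc (t, w.2) * overlap a w.1 w.2)%:E.
  have mg : measurable_fun [set: R * R] g.
    apply/measurable_EFinP; apply: measurable_funM; last by apply: measurable_overlap; measurability.
    by apply: measurable_funM; apply: measurable_disc; apply: measurable_fun_pair; measurability.
  have g0 w : (0 <= g w)%E by rewrite lee_fin !mulr_ge0 ?disc_ge0// overlap_ge0.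
  have mgu u : measurable_fun [set: R] (fun v => g (u, v)) by exact: measurableT_comp.
  have g1 : measurable_fun [set: R] (fun u => \int[mu]_v g (u, v))%E.
    exact: (measurable_fun_fubini_tonelli_F (m2 := mu) g mg g0).
  rewrite /f /disc2 -ge0_integralZl//.
  - apply: eq_integral => u _; rewrite -ge0_integralZl//.
    + by apply: eq_integral => v _; rewrite -EFinM /=; congr EFin; ring.
    + exact: (mgu u).
    + by move=> v _; exact: (g0 (u, v)).
    + by rewrite lee_fin overlap_ge0.
  - by move=> u _; apply: integral_ge0 => v _; exact: (g0 (u, v)).
  - by rewrite lee_fin overlap_ge0.
have disc2N1 s t : disc2 (- s) t = disc2 s t.
  by apply: eq_integral => u _; apply: eq_integral => v _; rewrite discN1.
have disc2N2 s t : disc2 s (- t) = disc2 s t by rewrite disc2C disc2N1 disc2C.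
apply: (etrans (integral_fold2 muE mf f0)).
pose k (w : R * R) : \bar R := ((fold_overlap4 w.1 w.2)%:E * disc2 w.1 w.2)%E.
have mk : measurable_fun [set: R * R] k.
  apply: emeasurable_funM; last exact: measurable_disc2.
  by apply/measurable_EFinP; apply: measurable_fold_overlap4; measurability.
have k0 w : (0 <= k w)%E by rewrite mule_ge0 ?disc2_ge0// lee_fin fold_overlap4_ge0.
transitivity (\int[mu]_(s in `[0%R, +oo[) \int[mu]_(t in `[0%R, +oo[) k (s, t))%E.
  apply: eq_integral => s _; apply: eq_integral => t _.
  rewrite /f /k /= !(disc2N1, disc2N2) /fold_overlap4 !EFinD.
  by rewrite !ge0_muleDl ?adde_ge0 ?lee_fin ?overlap_ge0.
have kC x y : k (x, y) = k (y, x) by rewrite /k/= fold_overlap4C disc2C.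
apply: (etrans (integral_triangle muE mk k0 kC)).
pose Psi s := (4 * a - 4 * s) * ((4 * a * h s - h s ^+ 2) * area_h s
     - 2 * h s * (r ^+ 2 * s - s ^+ 3 / 3) - h s ^+ 3 * s / 3)
   + 2 / 3 * (4 * a * h s - h s ^+ 2) * (h s ^+ 3 - r ^+ 3)
   + 2 * h s * (r ^+ 2 * s ^+ 2 - s ^+ 4 / 2) + h s ^+ 3 * s ^+ 2 / 3.
have -> : (\int[mu]_(s in `[0%R, +oo[) \int[mu]_(t in `[0%R, s]) k (s, t) =
           \int[mu]_(s in `[0%R, r]) (Psi s)%:E)%E.
  rewrite (@integral_support r); last first.
    move=> s rs; apply: integral0_eq => t _.
    rewrite /k/= (_ : disc2 s t = 0%E) ?mule0//.
    by apply: integral0_eq => u _; apply: integral0_eq => v _; rewrite disc_out// !mul0r.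
  apply: eq_integral => s; rewrite inE/= in_itv/= => sr.
  rewrite -integral_disc2_val//; apply: eq_integral => t; rewrite inE/= in_itv/= => ts.
  have s0r : s <= r by case/andP: sr.
  have tr : 0 <= t <= r by case/andP: ts => -> /le_trans ->.
  rewrite /k/= disc2E// -EFinM fold_overlap4E// /fold_overlap max_l; last by case/andP: ts.
  congr EFin; ring.
(* [S2] and [S4] are primitives of s^2 h and s^4 h, obtained by lowering the power of s by parts. *)
pose S2 s := r ^+ 2 / 4 * area_h s - s * h s ^+ 3 / 4.
pose S4 s := r ^+ 2 / 2 * S2 s - s ^+ 3 * h s ^+ 3 / 6.
pose q s := - 4 * a * (r ^+ 2 * s - s ^+ 3 / 3) + 16 / 3 * a * h s ^+ 3 + 2 * r ^+ 2 * s ^+ 2 - s ^+ 4.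
(* In [Psi] the coefficient of [area_h] is 16 a^2 h plus the derivative of [q]. As [area_h] has the
   derivative h, the first part integrates to 8 a^2 [area_h]^2; the second gives [q] times [area_h]
   by parts. The remaining terms are primitives of what is left, including - [q] h. *)
pose Th s := 8 * a ^+ 2 * area_h s ^+ 2 + q s * area_h s
  + 4 / 3 * a * r ^+ 2 * h s ^+ 3 + 4 / 3 * a * (h s ^+ 5 / 5 - r ^+ 2 * h s ^+ 3 / 3)
  + 8 * r ^+ 2 * S2 s - 8 / 3 * S4 s
  - 8 / 3 * a * (r ^+ 4 * s - 2 / 3 * r ^+ 2 * s ^+ 3 + s ^+ 5 / 5)
  + 4 / 15 * a * h s ^+ 5 + 5 / 3 * (r ^+ 2 * S2 s - S4 s)
  - 2 / 3 * (r ^+ 4 * area_h s - 2 * r ^+ 2 * S2 s + S4 s) - 8 / 3 * a * r ^+ 3 * area_h s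
  + 2 / 3 * r ^+ 3 * (r ^+ 2 * s - s ^+ 3 / 3).
have ch : continuous h := @continuous_half_chord _ r.
have cA := continuous_strip_area r0.
have -> : (\int[mu]_(s in `[0%R, r]) (Psi s)%:E = (Th r - Th 0)%:E)%E.
  apply: (@integral_itv_derivem _ Th).
  - exact: ltW r0.
  - by rewrite /Psi; continuity1.
  - have cS2 : continuous S2 by rewrite /S2; continuity1.
    have cS4 : continuous S4 by rewrite /S4; continuity1.
    have cq : continuous q by rewrite /q; continuity1.
    by rewrite /Th; continuity1.
  - move=> s sr; have dh := is_derive_half_chord sr; have dA := is_derive_strip_area r0 sr.
    have h0 := half_chord_gt0 sr.
    have rE : r ^+ 2 = h s ^+ 2 + s ^+ 2.
      by rewrite half_chord_sqr ?subrK//; case/andP: sr => /ltW -> /ltW ->.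
    have hn0 : h s != 0 by rewrite gt_eqF.
    have dS2 : is_derive s 1 S2 (s ^+ 2 * h s).
      eapply is_derive1_ext; first by rewrite /S2; derive1.
      by rewrite rE /GRing.scale/=; field.
    have dS4 : is_derive s 1 S4 (s ^+ 4 * h s).
      eapply is_derive1_ext; first by rewrite /S4; derive1.
      by rewrite rE /GRing.scale/=; field.
    have dq : is_derive s 1 q (- 4 * a * h s ^+ 2 - 16 * a * s * h s + 4 * s * h s ^+ 2).
      eapply is_derive1_ext; first by rewrite /q; derive1.
      by rewrite rE /GRing.scale/=; field.
    eapply is_derive1_ext; first by rewrite /Th; derive1.
    (* The powers of r are written with r^2, which is then replaced by h^2 + s^2. This makes the
       identity one between rational functions of independent quantities. *)
    have -> : r ^+ 4 = (r ^+ 2) ^+ 2 by rewrite -exprM.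
    rewrite /Psi /q; have -> : r ^+ 3 = r * r ^+ 2 by rewrite exprS.
    by rewrite rE /GRing.scale/=; field.
rewrite -EFinM /Th /q /S4 /S2 half_chordr strip_arear// half_chord0// strip_area0.
congr EFin; by field.
Qed.

End Evaluate.

(** * Uniform points of the square *)

Section Uniform.
Context {R : realType}.
Variable mu : {sigma_finite_measure set R -> \bar R}.
Hypothesis muE : forall (D : set R) (f : R -> \bar R), measurable D -> measurable_fun D f ->
  (\int[mu]_(x in D) f x = \int[lebesgue_measure]_(x in D) f x)%E.
Variable A : {sigma_finite_measure set (R * R)%type -> \bar R}.
Hypothesis integral_area : forall f : R * R -> \bar R,
  measurable_fun [set: R * R] f -> (forall z, 0 <= f z)%E ->
  (\int[A]_z f z = \int[mu]_x \int[mu]_y f (x, y))%E.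
Variable n : nat.
Hypothesis n0 : (0 < n)%N.
Variable nu : {sigma_finite_measure set (R * R)%type -> \bar R}.
Hypothesis nuE : forall f : R * R -> \bar R,
  measurable_fun [set: R * R] f -> (forall z, 0 <= f z)%E ->
  (\int[nu]_z f z = (n%:R ^- 2)%:E * \int[A]_z ((inside2 n%:R z)%:E * f z))%E.

Lemma measurable_dist_le (r : R) d (T : measurableType d) (f g : T -> R * R) :
  measurable_fun setT f -> measurable_fun setT g ->
  measurable_fun setT (fun x => dist_le r (f x) (g x)).
Proof.
move=> mf mg; rewrite /dist_le /dist; apply: measurable_natr_bool.
apply: measurable_fun_ler => //; apply: measurableT_comp.
  by apply: continuous_measurable_fun; exact: sqrt_continuous.
by measurability.
Qed.

Lemma dist_leE (r : R) (x y : R * R) : 0 <= r -> dist_le r x y = disc r (y.1 - x.1, y.2 - x.2).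
Proof.
move=> r0; rewrite /dist_le /disc /dist/= -{1}(ger0_norm r0) -sqrtr_sqr.
rewrite ler_sqrt ?sqr_ge0//.
by rewrite -(sqrrN (x.1 - _)) opprB -(sqrrN (x.2 - _)) opprB.
Qed.

Variable r : R.
Hypothesis r0 : 0 < r.

(** The substitution y = x + z, one coordinate at a time. *)
Lemma integral_dist_le x : (\int[nu]_y (dist_le r x y)%:E =
  (n%:R ^- 2)%:E * \int[A]_z (shifted (disc r) n%:R x z)%:E)%E.
Proof.
rewrite nuE; last 2 first.
- by apply/measurable_EFinP; exact: measurable_dist_le.
- by move=> z; rewrite lee_fin ler0n.
congr (_ * _)%E; rewrite !integral_area; last 4 first.
- by apply/measurable_EFinP; apply: measurable_shifted => //; exact: measurable_disc.
- by move=> z; rewrite lee_fin; apply: shifted_ge0; exact: disc_ge0.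
- apply: emeasurable_funM; apply/measurable_EFinP; first exact: measurable_inside2.
  exact: measurable_dist_le.
- by move=> z; rewrite mule_ge0// lee_fin ?ler0n// inside2_ge0.
have trans a (f : R -> \bar R) : measurable_fun [set: R] f -> (forall z, 0 <= f z)%E ->
    (\int[mu]_x f (a + x)%R = \int[mu]_x f x)%E.
  move=> mf f0; rewrite !muE//; first exact: integral_translation.
  by apply: measurableT_comp => //; exact: measurable_funD.
pose F w : \bar R := (inside2 n%:R w * dist_le r x w)%:E.
have mF : measurable_fun [set: R * R] F.
  by apply/measurable_EFinP; apply: measurable_funM; [exact: measurable_inside2|exact: measurable_dist_le].
have F0 w : (0 <= F w)%E by rewrite lee_fin mulr_ge0 ?inside2_ge0 ?ler0n.
have mF1 := measurable_fun_fubini_tonelli_F (m2 := mu) F mF F0.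
transitivity (\int[mu]_u \int[mu]_v F (u, v))%E; first by [].
rewrite -(trans x.1 (fun u => \int[mu]_v F (u, v))%E mF1); last first.
  by move=> u; apply: integral_ge0 => v _; exact: F0.
apply: eq_integral => u _.
rewrite -(trans x.2); last 2 first.
- exact: (measurableT_comp mF).
- by move=> v; exact: F0.
apply: eq_integral => v _; rewrite /F /inside2 /shifted dist_leE ?ltW//=.
congr EFin; rewrite mulrC; congr (disc _ _ * _).
by congr pair; rewrite addrAC subrr add0r.
Qed.

Let I x := (\int[A]_z (shifted (disc r) n%:R x z)%:E)%E.
Let c : R := n%:R ^- 2.

Let measurable_disc' s : measurable_fun setT (disc s : R * R -> R).
Proof. exact: (measurable_disc s (f := id)). Qed.

Let c0 : (0 <= c%:E)%E.
Proof. by rewrite lee_fin invr_ge0 exprn_ge0. Qed.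

Let I_ge0 x : (0 <= I x)%E.
Proof. by apply: integral_ge0 => z _; rewrite lee_fin; apply: shifted_ge0; exact: disc_ge0. Qed.

Let measurable_I : measurable_fun [set: R * R] I.
Proof.
apply: (measurable_fun_fubini_tonelli_F (m2 := A)
  (fun w : (R * R) * (R * R) => (shifted (disc r) n%:R w.1 w.2)%:E)).
  apply/measurable_EFinP; apply: measurable_shifted; [exact: measurable_disc'|..];
  by measurability.
by move=> w; rewrite lee_fin; apply: shifted_ge0; exact: disc_ge0.
Qed.

Lemma integral_dist_le_mean : r <= n%:R ->
  (\int[nu]_x \int[nu]_y (dist_le r x y)%:E =
   (pi * r ^+ 2 / n%:R ^+ 2 - 8 * r ^+ 3 / (3 * n%:R ^+ 3) + r ^+ 4 / (2 * n%:R ^+ 4))%:E)%E.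
Proof.
move=> rn; under eq_integral do rewrite integral_dist_le.
rewrite nuE; last 2 first.
- by apply: emeasurable_funM => //; exact: measurable_cst.
- by move=> x; rewrite mule_ge0 ?I_ge0.
have -> : (\int[A]_z ((inside2 n%:R z)%:E * (c%:E * I z)) = c%:E *
    \int[A]_z ((inside2 n%:R z)%:E * I z))%E.
  rewrite -ge0_integralZl//.
  - by apply: eq_integral => z _; rewrite muleCA.
  - by apply: emeasurable_funM => //; apply/measurable_EFinP; exact: measurable_inside2.
  - by move=> z _; rewrite mule_ge0 ?I_ge0// lee_fin inside2_ge0.
rewrite (mean_overlap muE integral_area (measurable_disc' r) (disc_ge0 r)).
rewrite (integral_mean_overlap muE r0 rn) -!EFinM /c; congr EFin; field.
by rewrite pnatr_eq0 -lt0n.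
Qed.

Lemma integral_dist_le_sqr : 2 * r <= n%:R ->
  (\int[nu]_x (\int[nu]_y (dist_le r x y)%:E * \int[nu]_y (dist_le r x y)%:E) =
   ((pi ^+ 2 * r ^+ 4 * n%:R ^+ 2 - (8 / 3 * pi + 256 / 45) * r ^+ 5 * n%:R
    + (59 / 48 * pi + 8 / 9) * r ^+ 6) / n%:R ^+ 6)%:E)%E.
Proof.
move=> rn; under eq_integral do rewrite integral_dist_le.
rewrite nuE; last 2 first.
- by apply: emeasurable_funM; apply: emeasurable_funM => //; exact: measurable_cst.
- by move=> x; rewrite !mule_ge0 ?I_ge0.
have alg (i x y : \bar R) : (i * (x * y * (x * y)) = x * x * (i * (y * y)))%E.
  by rewrite [X in (_ * X)%E = _]muleACA [LHS]muleCA.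
have -> : (\int[A]_z ((inside2 n%:R z)%:E * (c%:E * I z * (c%:E * I z))) = (c * c)%:E *
    \int[A]_z ((inside2 n%:R z)%:E * (I z * I z)))%E.
  rewrite -ge0_integralZl//.
  - by apply: eq_integral => z _; exact: alg.
  - apply: emeasurable_funM; last exact: emeasurable_funM.
    by apply/measurable_EFinP; exact: measurable_inside2.
  - by move=> z _; rewrite !mule_ge0 ?I_ge0// lee_fin inside2_ge0.
  - by rewrite lee_fin mulr_ge0.
rewrite (mean_sqr_overlap muE integral_area (measurable_disc' r) (disc_ge0 r)).
rewrite (integral_mean_sqr_overlap muE r0 rn) -!EFinM /c; congr EFin; field.
by rewrite pnatr_eq0 -lt0n.
Qed.

End Uniform.

(** * The uniform law as normalised area *)

Section UniformLaw.
Context {R : realType}.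

Lemma distC (x y : R * R) : dist x y = dist y x.
Proof. by rewrite /dist -(sqrrN (x.1 - _)) opprB -(sqrrN (x.2 - _)) opprB. Qed.

Lemma measurable_square n : measurable (square n : set (R * R)).
Proof. exact: measurableX. Qed.

Lemma area_rectangle (B C : set R) : measurable B -> measurable C ->
  area (B `*` C) = (lebesgue_measure B * lebesgue_measure C)%E.
Proof. by move=> mB mC; rewrite /area product_measure1E. Qed.

Lemma area_square n : area (square n : set (R * R)) = (n%:R ^+ 2)%:E.
Proof.
rewrite area_rectangle// !lebesgue_measure_itv/= lte_fin ltr0n sube0.
by case: n => [|n]/=; rewrite ?mul0e ?expr0n -?EFinM -?expr2.
Qed.

Lemma area_square_fin n (B : set (R * R)) : measurable B -> area (B `&` square n) \is a fin_num.
Proof.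
move=> mB; have mS := @measurable_square n.
rewrite ge0_fin_numE ?areaE ?measure_ge0//; try exact: measurableI.
apply: (@le_lt_trans _ _ ((leb \x leb)%E (square n))).
  by apply: le_measure; rewrite ?inE//; exact: measurableI.
by rewrite -areaE// area_square ltry.
Qed.

Variable A : {sigma_finite_measure set (R * R)%type -> \bar R}.
Hypothesis AE : forall B, measurable B -> A B = area B.
Variable n : nat.
Variable nu : {measure set (R * R)%type -> \bar R}.
Hypothesis nu_square : forall B, measurable B ->
  nu B = (fine (area (B `&` square n)) / n%:R ^+ 2)%:E.

Lemma inside2E (x : R * R) : inside2 n%:R x = (x \in square n)%:R.
Proof.
rewrite /inside2 /inside -natrM mulnb; congr (_ %:R); congr nat_of_bool.
by apply/idP/idP; rewrite in_setE /square/= !in_itv/= => /andP.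
Qed.

(** The complement of the square is null for [nu], and on subsets of the square [nu] is the area
    divided by n^2. *)
Lemma integral_uniform (f : R * R -> \bar R) :
  measurable_fun [set: R * R] f -> (forall z, 0 <= f z)%E ->
  (\int[nu]_z f z = (n%:R ^- 2)%:E * \int[A]_z ((inside2 n%:R z)%:E * f z))%E.
Proof.
move=> mf f0; have mS := @measurable_square n.
have c0 : 0 <= n%:R ^- 2 :> R by rewrite invr_ge0 exprn_ge0.
have nuC : nu (~` square n) = 0%E.
  by rewrite nu_square ?setICl ?areaE ?measure0 ?mul0r//; exact: measurableC.
transitivity (\int[nu]_(z in square n) f z)%E.
  rewrite -(setvU (square n)) ge0_integral_setU//; first last.
  - exact/disj_setPCr.
  - by rewrite setvU.
  - exact: measurableC.
  rewrite (null_set_integral (measurableC mS) _ nuC) ?add0e//.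
  exact: measurable_funTS.
transitivity (\int[mscale (NngNum c0) A]_(z in square n) f z)%E.
  apply: eq_measure_integral => B mB BS.
  have fB : area B \is a fin_num by rewrite -(setIidl BS); exact: area_square_fin.
  rewrite -[RHS]/(((n%:R ^- 2)%:E * A B)%E) nu_square// (setIidl BS) AE//.
  by rewrite EFinM fineK// muleC.
rewrite ge0_integral_mscale//=; last exact: measurable_funTS.
congr (_ * _)%E; rewrite integral_mkcond; apply: eq_integral => z _.
by rewrite inside2E /patch; case: ifP; rewrite ?mul1e ?mul0e.
Qed.

End UniformLaw.

(** * Two independent points with a common law, and their conditional expectations *)

Section UniformPairLaw.
Context {R : realType} {d : measure_display} {T : measurableType d}.
Variables (Q : probability T R) (U V : {RV Q >-> plane R}).
Variable nu : probability (R * R)%type R.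
Hypothesis nuU : forall B, measurable B -> distribution Q U B = nu B.
Hypothesis nuV : forall B, measurable B -> distribution Q V B = nu B.
Hypothesis UV : independent Q U V.

Lemma integral_lawU (f : R * R -> \bar R) :
  measurable_fun [set: R * R] f -> (forall x, 0 <= f x)%E ->
  (\int[Q]_w f (U w) = \int[nu]_x f x)%E.
Proof.
move=> mf f0; rewrite -(ge0_integral_distribution U mf f0).
by apply: eq_measure_integral => B mB _; exact: nuU.
Qed.

(** Independence says that the joint law and the product measure agree on rectangles, hence
    everywhere by uniqueness of the product measure. *)
Lemma integral_pair (F : (R * R) * (R * R) -> \bar R) :
  measurable_fun [set: (R * R) * (R * R)] F -> (forall z, 0 <= F z)%E ->
  (\int[Q]_w F (U w, V w) = \int[nu]_x \int[nu]_y F (x, y))%E.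
Proof.
move=> mF F0.
pose UVf w := (U w, V w).
have mUV : measurable_fun [set: T] UVf by apply: measurable_fun_pair.
transitivity (\int[pushforward Q UVf]_z F z)%E.
  by rewrite (ge0_integral_pushforward mUV).
transitivity (\int[(nu \x nu)%E]_z F z)%E; last first.
  exact: (fubini_tonelli1 (m1 := nu) (m2 := nu) F mF F0).
apply: eq_measure_integral => B mB _; apply/esym/product_measure_unique => //.
move=> B1 B2 mB1 mB2.
transitivity (distribution Q U B1 * distribution Q V B2)%E; last first.
  by congr (_ * _)%E; [exact: nuU|exact: nuV].
exact: (UV mB1 mB2).
Qed.

Definition closeness s x : R := fine (\int[nu]_y (dist_le s x y)%:E)%E.

Lemma dist_le01 s (x y : R * R) : 0 <= dist_le s x y <= 1.
Proof. by rewrite /dist_le ler0n lern1 leq_b1. Qed.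

Lemma integral_prob_le1 (f : R * R -> \bar R) :
  measurable_fun [set: R * R] f -> (forall x, 0 <= f x <= 1)%E ->
  (0 <= \int[nu]_x f x <= 1)%E.
Proof.
move=> mf f01; apply/andP; split.
  by apply: integral_ge0 => y _; case/andP: (f01 y).
apply: (@le_trans _ _ (\int[nu]_x (cst 1%E) x)%E).
  apply: ge0_le_integral => //; last by move=> y _; case/andP: (f01 y).
  by move=> y _; case/andP: (f01 y).
by rewrite integral_cst// mul1e probability_le1.
Qed.

Lemma measurable_dist_le_snd s (x : R * R) :
  measurable_fun [set: R * R] (fun y => (dist_le s x y)%:E).
Proof. by apply/measurable_EFinP; apply: measurable_dist_le. Qed.

Lemma closenessE s x : (\int[nu]_y (dist_le s x y)%:E = (closeness s x)%:E)%E.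
Proof.
rewrite fineK//.
have /andP[h1 h2] : (0 <= \int[nu]_y (dist_le s x y)%:E <= 1)%E.
  by apply: integral_prob_le1 => [|y]; [exact: measurable_dist_le_snd|exact: dist_le01].
by rewrite fin_numElt (lt_le_trans _ h1) ?ltNyr// (le_lt_trans h2) ?ltry.
Qed.

Lemma closeness01 s x : 0 <= closeness s x <= 1.
Proof.
rewrite -!lee_fin -closenessE; apply: integral_prob_le1 => [|y].
  exact: measurable_dist_le_snd.
exact: dist_le01.
Qed.

Lemma measurable_closeness s : measurable_fun [set: R * R] (closeness s).
Proof.
apply/measurable_EFinP.
rewrite (_ : _ \o _ = fun x => (\int[nu]_y (dist_le s x y)%:E)%E); last first.
  by apply/funext => x; rewrite /= closenessE.
apply: (measurable_fun_fubini_tonelli_F (m2 := nu)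
  (fun z : (R * R) * (R * R) => (dist_le s z.1 z.2)%:E)).
  by apply/measurable_EFinP; apply: measurable_dist_le.
by move=> z; rewrite lee_fin ler0n.
Qed.

Lemma dist_leC s (x y : R * R) : dist_le s x y = dist_le s y x.
Proof. by rewrite /dist_le distC. Qed.

Definition mean_closeness s : R := fine (\int[nu]_x (closeness s x)%:E)%E.

Definition mean_closeness2 s s' : R :=
  fine (\int[nu]_x (closeness s x * closeness s' x)%:E)%E.

Lemma bounded_integrable (f : R * R -> R) (M : R) : measurable_fun setT f ->
  (forall x, `|f x| <= M) -> nu.-integrable setT (EFin \o f).
Proof.
move=> mf fM; apply: measurable_bounded_integrable => //.
  by rewrite (le_lt_trans (probability_le1 _ _))// ltry.
exists M; split; first exact: num_real.
by move=> N MN x _; rewrite /= (le_trans (fM x))// ltW.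
Qed.

Lemma integrable_closeness s : nu.-integrable setT (EFin \o closeness s).
Proof.
apply: (@bounded_integrable _ 1); first exact: measurable_closeness.
by move=> x; case/andP: (closeness01 s x) => ? ?; rewrite ger0_norm.
Qed.

Lemma integrable_closeness2 s s' :
  nu.-integrable setT (EFin \o (fun x => closeness s x * closeness s' x)).
Proof.
apply: (@bounded_integrable _ 1); first by apply: measurable_funM; exact: measurable_closeness.
move=> x; case/andP: (closeness01 s x) => ? ?; case/andP: (closeness01 s' x) => ? ?.
by rewrite ger0_norm ?mulr_ge0// mulr_ile1.
Qed.

Lemma mean_closenessE s : (\int[nu]_x (closeness s x)%:E = (mean_closeness s)%:E)%E.
Proof. by rewrite fineK//; apply: integrable_fin_num => //; exact: integrable_closeness. Qed.

Lemma mean_closeness2E s s' : (\int[nu]_x (closeness s x * closeness s' x)%:E =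
  (mean_closeness2 s s')%:E)%E.
Proof. by rewrite fineK//; apply: integrable_fin_num => //; exact: integrable_closeness2. Qed.

Lemma mean_closeE s : mean_close Q U V s = mean_closeness s.
Proof.
rewrite /mean_close unlock /mean_closeness; congr fine.
rewrite (integral_pair (F := fun z => (dist_le s z.1 z.2)%:E))/=.
- by apply: eq_integral => x _; rewrite closenessE.
- by apply/measurable_EFinP; apply: measurable_dist_le.
- by move=> z; rewrite lee_fin ler0n.
Qed.

Lemma integral_law (f : R * R -> \bar R) : measurable_fun [set: R * R] f ->
  (\int[Q]_w f (U w) = \int[nu]_x f x)%E.
Proof.
move=> mf; rewrite integralE [RHS]integralE; congr (_ - _)%E.
  have := integral_lawU (measurable_funepos mf) (funepos_ge0 f).
  by apply: etrans; apply: eq_integral => w _; rewrite !funeposE.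
have := integral_lawU (measurable_funeneg mf) (funeneg_ge0 f).
by apply: etrans; apply: eq_integral => w _; rewrite !funenegE.
Qed.

Lemma preimage_law (B : set (R * R)) : measurable B -> Q (V @^-1` B) = nu B.
Proof. by move=> mB; rewrite -[LHS]/(distribution Q V B) nuV. Qed.

Lemma integral_dist_le_preimage s (B : set (R * R)) : measurable B ->
  (\int[Q]_(w in V @^-1` B) (dist_le s (U w) (V w))%:E =
   \int[nu]_(y in B) (closeness s y)%:E)%E.
Proof.
move=> mB.
pose F (z : (R * R) * (R * R)) : \bar R := (\1_B z.2 * dist_le s z.1 z.2)%:E.
have mF : measurable_fun [set: _] F.
  apply/measurable_EFinP; apply: measurable_funM; last exact: measurable_dist_le.
  by apply: measurableT_comp => //; exact: measurable_indic.
have F0 z : (0 <= F z)%E by rewrite lee_fin mulr_ge0 ?ler0n.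
transitivity (\int[Q]_w F (U w, V w))%E.
  rewrite integral_mkcond; apply: eq_integral => w _.
  rewrite /F/= indicE /patch.
  have -> : (w \in V @^-1` B) = (V w \in B) by apply/idP/idP; rewrite !inE.
  by case: ifP; rewrite ?mul1r ?mul0r.
rewrite (integral_pair mF F0).
apply: (etrans (fubini_tonelli (m1 := nu) (m2 := nu) F mF F0)).
rewrite [RHS]integral_mkcond; apply: eq_integral => y _; rewrite /patch -closenessE /F/= indicE.
case: ifP => _; first by apply: eq_integral => x _; rewrite mul1r dist_leC.
by apply: integral0_eq => x _; rewrite mul0r.
Qed.

(** Both functions have the same integral over each measurable set, so they agree almost everywhere.
    Equality at every point cannot be had, because any version of the conditional expectation is
    allowed. *)
Lemma cond_expectation_closeness s (h : R * R -> R) :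
  cond_expectation (fun w => hker Q U V (U w) (V w) s) V h ->
  ae_eq nu setT (EFin \o h) (EFin \o (fun x => closeness s x - mean_closeness s)).
Proof.
move=> [mh ih Eh].
have toV B : measurable B -> (\int[distribution Q V]_(x in B) (h x)%:E =
    \int[nu]_(x in B) (h x)%:E)%E.
  by move=> mB; apply: eq_measure_integral => C mC _; exact: nuV.
have mg : measurable_fun setT (fun x => closeness s x - mean_closeness s).
  by apply: measurable_funB => //; exact: measurable_closeness.
apply: integral_ae_eq => //.
- apply/integrableP; split; first exact/measurable_EFinP.
  case/integrableP: ih => _; congr (_ < _)%E.
  by apply: eq_measure_integral => C mC _; exact: nuV.
- exact/measurable_EFinP.
- move=> B _ mB; rewrite -toV// Eh// /hker mean_closeE.
  have mVB : measurable (V @^-1` B).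
    by rewrite -[X in measurable X]setTI; exact: measurable_funP.
  have iQ : Q.-integrable (V @^-1` B) (EFin \o (fun w => dist_le s (U w) (V w))).
    apply: measurable_bounded_integrable => //.
    + by rewrite (le_lt_trans (probability_le1 _ _))// ltry.
    + by apply: measurable_funTS; apply: measurable_dist_le.
    + exists 1; split; first exact: num_real.
      move=> N N1 w _; rewrite /= ger0_norm ?ler0n// (le_trans _ (ltW N1))//.
      by case/andP: (dist_le01 s (U w) (V w)).
  have icQ c : Q.-integrable (V @^-1` B) (EFin \o cst c).
    exact: finite_measure_integrable_cst.
  have ic c : nu.-integrable B (EFin \o cst c) by exact: finite_measure_integrable_cst.
  have ig : nu.-integrable B (EFin \o closeness s).
    by apply: integrableS (integrable_closeness s).
  rewrite (integralB_EFin mVB iQ (icQ _)) (integralB_EFin mB ig (ic _)).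
  rewrite integral_dist_le_preimage//; congr (_ - _)%E.
  apply: (etrans (integral_cst Q mVB (mean_closeness s)%:E)); apply/esym.
  by apply: (etrans (integral_cst nu mB (mean_closeness s)%:E)); congr (_ * _)%E; exact/esym/preimage_law.
Qed.

Lemma integral_cst_prob (c : R) : (\int[nu]_x (cst c x)%:E = c%:E)%E.
Proof.
by apply: (etrans (integral_cst nu measurableT c%:E)); rewrite [X in (_ * X)%E](probability_setT nu) mule1.
Qed.

Section CondExpectation.
Variables (s s' : R) (h h' : R * R -> R).
Hypothesis Hh : cond_expectation (fun w => hker Q U V (U w) (V w) s) V h.
Hypothesis Hh' : cond_expectation (fun w => hker Q U V (U w) (V w) s') V h'.

Lemma integral_closeness_centered2 :
  (\int[nu]_x ((closeness s x - mean_closeness s) * (closeness s' x - mean_closeness s'))%:E =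
   (mean_closeness2 s s' - mean_closeness s * mean_closeness s')%:E)%E.
Proof.
have alg (v x y : R) : (v%:E - ((x * y)%:E + (y * x)%:E - (x * y)%:E) = (v - x * y)%:E)%E.
  by rewrite -!EFinD; congr EFin; ring.
set e := mean_closeness s; set e' := mean_closeness s'.
transitivity (\int[nu]_x (closeness s x * closeness s' x -
   ((e * closeness s' x + e' * closeness s x) - e * e'))%:E)%E.
  by apply: eq_integral => x _; congr EFin; ring.
have mT := @measurableT _ (R * R)%type.
have i1 := integrable_closeness2 s s'.
have ic c : nu.-integrable setT (EFin \o cst c) by exact: finite_measure_integrable_cst.
have i2 c t : nu.-integrable setT (EFin \o (fun x => c * closeness t x)).
  have := integrableZl mT c (integrable_closeness t).
  by apply: eq_integrable.
have i3 : nu.-integrable setT (EFin \o (fun x => e * closeness s' x + e' * closeness s x)).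
  by have := integrableD mT (i2 e s') (i2 e' s); apply: eq_integrable.
have i4 : nu.-integrable setT (EFin \o (fun x => e * closeness s' x + e' * closeness s x - e * e')).
  by have := integrableB mT i3 (ic (e * e')); apply: eq_integrable.
rewrite (integralB_EFin mT i1 i4) (integralB_EFin mT i3 (ic (e * e'))).
rewrite (integralD_EFin mT (i2 e s') (i2 e' s)).
have Zl c t : (\int[nu]_x (c * closeness t x)%:E = (c * mean_closeness t)%:E)%E.
  rewrite [RHS]EFinM -mean_closenessE -[RHS](integralZl mT (integrable_closeness t)).
  by apply: eq_integral => x _; rewrite -EFinM.
rewrite !Zl mean_closeness2E integral_cst_prob.
exact: alg.
Qed.

(** With this centring, the covariance of two such functions is the mean of their product and the
    variance is the second moment. *)
Lemma expectation_cond : ('E_Q[fun w => h (U w)] = 0)%E.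
Proof.
have [mh _ _] := Hh.
rewrite unlock (integral_law (f := EFin \o h)); last exact/measurable_EFinP.
rewrite (ae_eq_integral (EFin \o (fun x => closeness s x - mean_closeness s)))//.
- have ic : nu.-integrable setT (EFin \o cst (mean_closeness s)).
    exact: finite_measure_integrable_cst.
  rewrite (integralB_EFin measurableT (integrable_closeness s) ic).
  by rewrite mean_closenessE integral_cst_prob subee.
- exact/measurable_EFinP.
- by apply/measurable_EFinP; apply: measurable_funB => //; exact: measurable_closeness.
- exact: cond_expectation_closeness.
Qed.

Let ae_h : ae_eq nu setT (EFin \o h) (EFin \o (fun x => closeness s x - mean_closeness s)).
Proof. exact: cond_expectation_closeness. Qed.

Let ae_h' : ae_eq nu setT (EFin \o h') (EFin \o (fun x => closeness s' x - mean_closeness s')).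
Proof. exact: cond_expectation_closeness. Qed.

Lemma integral_condM : (\int[Q]_w (h (U w) * h' (U w))%:E =
  (mean_closeness2 s s' - mean_closeness s * mean_closeness s')%:E)%E.
Proof.
have [mh _ _] := Hh; have [mh' _ _] := Hh'.
have mhh : measurable_fun [set: R * R] (fun x => (h x * h' x)%:E).
  by apply/measurable_EFinP; exact: measurable_funM.
rewrite (integral_law mhh) -integral_closeness_centered2.
apply: ae_eq_integral => //.
  apply/measurable_EFinP; apply: measurable_funM; apply: measurable_funB => //;
  exact: measurable_closeness.
move: ae_h ae_h'; apply: filterS2 => x + + _ => /(_ I) /= [->] /(_ I) /= [->].
by [].
Qed.

End CondExpectation.

Lemma covariance_cond s s' (h h' : R * R -> R) :
  cond_expectation (fun w => hker Q U V (U w) (V w) s) V h ->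
  cond_expectation (fun w => hker Q U V (U w) (V w) s') V h' ->
  covariance Q (fun w => h (U w)) (fun w => h' (U w)) =
  (mean_closeness2 s s' - mean_closeness s * mean_closeness s')%:E.
Proof.
move=> Hh Hh'; rewrite unlock (expectation_cond Hh) (expectation_cond Hh').
rewrite unlock -(integral_condM Hh Hh'); apply: eq_integral => w _.
by rewrite /= !fctE /= !subr0.
Qed.

Lemma expectation_cond_sqr s (h : R * R -> R) :
  cond_expectation (fun w => hker Q U V (U w) (V w) s) V h ->
  ('E_Q[(fun w => h (U w) ^+ 2)%R] = (mean_closeness2 s s - mean_closeness s ^+ 2)%:E)%E.
Proof. by move=> Hh; rewrite unlock -(integral_condM Hh Hh). Qed.

End UniformPairLaw.

(** * Pairs in an independent sequence *)

Section IidSequence.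
Context {R : realType} {C : finType}.
Variable p : C -> R.
Hypothesis p1 : \sum_c p c = 1.
Implicit Types (F G : seq C -> R) (f : C -> R) (D : C -> C -> R) (k : nat).

(** The expectation of [F] at a word of k independent letters with law [p]. The recursion conditions
    on the first letter, which makes each moment below an induction on k. *)
Fixpoint iid_mean k F : R :=
  if k is k'.+1 then \sum_c p c * iid_mean k' (fun s => F (c :: s)) else F [::].

Lemma eq_iid_mean k F G : F =1 G -> iid_mean k F = iid_mean k G.
Proof.
elim: k F G => [|k IH] F G FG /=; first exact: FG.
by apply: eq_bigr => c _; congr (_ * _); apply: IH => s; exact: FG.
Qed.

Lemma eq_iid_mean_size k F G : (forall s, size s = k -> F s = G s) ->
  iid_mean k F = iid_mean k G.
Proof.
elim: k F G => [|k IH] F G FG /=; first exact: FG.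
by apply: eq_bigr => c _; congr (_ * _); apply: IH => s sk; apply: FG; rewrite /= sk.
Qed.

Lemma iid_meanD k F G : iid_mean k (fun s => F s + G s) = iid_mean k F + iid_mean k G.
Proof.
elim: k F G => //= k IH F G; rewrite -big_split; apply: eq_bigr => c _ /=.
by rewrite IH mulrDr.
Qed.

Lemma iid_meanZ k a F : iid_mean k (fun s => a * F s) = a * iid_mean k F.
Proof.
elim: k F => //= k IH F; rewrite mulr_sumr; apply: eq_bigr => c _ /=.
by rewrite IH mulrCA.
Qed.

Lemma iid_mean_cst k a : iid_mean k (fun=> a) = a.
Proof. by elim: k => //= k IH; under eq_bigr do rewrite IH; rewrite -mulr_suml p1 mul1r. Qed.

Lemma iid_mean_sum k (I : Type) (r : seq I) (F : I -> seq C -> R) :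
  iid_mean k (fun s => \sum_(i <- r) F i s) = \sum_(i <- r) iid_mean k (F i).
Proof.
elim: r => [|i r IH].
  rewrite big_nil -[RHS](iid_mean_cst k); apply: eq_iid_mean => s.
  by rewrite big_nil.
rewrite big_cons -IH -iid_meanD; apply: eq_iid_mean => s.
by rewrite big_cons.
Qed.

Definition mean1 f : R := \sum_c p c * f c.

Lemma mean1D f f' : mean1 (fun c => f c + f' c) = mean1 f + mean1 f'.
Proof. by rewrite /mean1 -big_split; apply: eq_bigr => c _ /=; rewrite mulrDr. Qed.

Lemma mean1Z a f : mean1 (fun c => a * f c) = a * mean1 f.
Proof. by rewrite /mean1 mulr_sumr; apply: eq_bigr => c _ /=; rewrite mulrCA. Qed.

Lemma mean1_cst a : mean1 (fun=> a) = a.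
Proof. by rewrite /mean1 -mulr_suml p1 mul1r. Qed.

Lemma eq_mean1 f f' : f =1 f' -> mean1 f = mean1 f'.
Proof. by move=> ff; apply: eq_bigr => c _; rewrite ff. Qed.

Lemma mean1C (D : C -> C -> R) :
  mean1 (fun c => mean1 (D c)) = mean1 (fun x => mean1 (D ^~ x)).
Proof.
rewrite /mean1; under eq_bigr do rewrite mulr_sumr.
rewrite exchange_big; apply: eq_bigr => x _ /=; rewrite mulr_sumr.
by apply: eq_bigr => c _; rewrite mulrCA.
Qed.

Definition sum_seq f (s : seq C) : R := \sum_(x <- s) f x.

(** For a symmetric [D] this is the sum over the ordered pairs of distinct positions; the factor 2
    counts both orders of the pairs that contain the first letter. *)
Fixpoint pair_sum D (s : seq C) : R :=
  if s is c :: s' then pair_sum D s' + 2 * sum_seq (D c) s' else 0.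

Lemma iid_meanS k F : iid_mean k.+1 F = mean1 (fun c => iid_mean k (fun s => F (c :: s))).
Proof. by []. Qed.

Lemma iid_mean_sum_seq k f : iid_mean k (sum_seq f) = k%:R * mean1 f.
Proof.
elim: k => [|k IH]; first by rewrite /= /sum_seq big_nil mul0r.
rewrite iid_meanS; transitivity (mean1 (fun c => f c + iid_mean k (sum_seq f))).
  apply: eq_mean1 => c; rewrite -(iid_mean_cst k (f c)) -iid_meanD.
  by apply: eq_iid_mean => s; rewrite /sum_seq big_cons.
by rewrite mean1D mean1_cst IH -natr1 mulrDl mul1r addrC.
Qed.

Lemma iid_mean_sum_seqM k f f' : iid_mean k (fun s => sum_seq f s * sum_seq f' s) =
  k%:R * mean1 (fun c => f c * f' c) + k%:R * (k%:R - 1) * (mean1 f * mean1 f').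
Proof.
elim: k => [|k IH]; first by rewrite /= /sum_seq !big_nil !mul0r addr0.
rewrite iid_meanS.
transitivity (mean1 (fun c => f c * f' c + (k%:R * mean1 f' * f c + k%:R * mean1 f * f' c
   + iid_mean k (fun s => sum_seq f s * sum_seq f' s)))).
  apply: eq_mean1 => c.
  transitivity (iid_mean k (fun s => f c * f' c + (f c * sum_seq f' s + (f' c * sum_seq f s
     + sum_seq f s * sum_seq f' s)))).
    by apply: eq_iid_mean => s; rewrite /sum_seq !big_cons; ring.
  rewrite !iid_meanD !iid_meanZ iid_mean_cst !iid_mean_sum_seq; ring.
by rewrite !mean1D !mean1Z mean1_cst IH -natr1; ring.
Qed.

Lemma iid_mean_pair_sum k D : iid_mean k (pair_sum D) =
  k%:R * (k%:R - 1) * mean1 (fun c => mean1 (D c)).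
Proof.
elim: k => [|k IH]; first by rewrite /= !mul0r.
rewrite iid_meanS.
transitivity (mean1 (fun c => iid_mean k (pair_sum D) + 2 * k%:R * mean1 (D c))).
  apply: eq_mean1 => c; rewrite /= iid_meanD; congr (_ + _).
  by rewrite iid_meanZ iid_mean_sum_seq mulrA.
by rewrite mean1D mean1Z mean1_cst IH -natr1; ring.
Qed.

(** The single letter either is one of the two letters of the pair, which gives the factor 2, or is
    independent of both. *)
Lemma iid_mean_pair_sum_sum_seq k D f : (forall x y, D x y = D y x) ->
  iid_mean k (fun s => pair_sum D s * sum_seq f s) =
  2 * k%:R * (k%:R - 1) * mean1 (fun c => mean1 (D c) * f c) +
  k%:R * (k%:R - 1) * (k%:R - 2) * mean1 (fun c => mean1 (D c)) * mean1 f.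
Proof.
move=> DC; elim: k => [|k IH]; first by rewrite /= !(mul0r, mulr0) addr0.
rewrite iid_meanS.
pose e := mean1 (fun c => mean1 (D c)).
transitivity (mean1 (fun c => iid_mean k (fun s => pair_sum D s * sum_seq f s)
   + (k%:R * (k%:R - 1) * e * f c + (2 * k%:R * (f c * mean1 (D c)) +
     (2 * k%:R * mean1 (fun x => D c x * f x) +
      2 * k%:R * (k%:R - 1) * mean1 f * mean1 (D c)))))).
  apply: eq_mean1 => c.
  transitivity (iid_mean k (fun s => pair_sum D s * sum_seq f s + (f c * pair_sum D s
     + (2 * f c * sum_seq (D c) s + 2 * (sum_seq (D c) s * sum_seq f s))))).
    by apply: eq_iid_mean => s; rewrite /= /sum_seq !big_cons; ring.
  rewrite !iid_meanD !iid_meanZ iid_mean_pair_sum !iid_mean_sum_seq iid_mean_sum_seqM.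
  rewrite -/e; ring.
rewrite !mean1D !mean1Z mean1_cst IH.
have -> : mean1 (fun c => mean1 (fun x => D c x * f x)) = mean1 (fun c => mean1 (D c) * f c).
  rewrite mean1C; apply: eq_mean1 => x; rewrite mulrC -mean1Z.
  by apply: eq_mean1 => c; rewrite DC mulrC.
have -> : mean1 (fun c => f c * mean1 (D c)) = mean1 (fun c => mean1 (D c) * f c).
  by apply: eq_mean1 => c; rewrite mulrC.
rewrite -/e -natr1; ring.
Qed.

(** A new first letter c adds twice [sum_seq (D c)] to one factor and twice [sum_seq (D' c)] to the
    other. The mixed products have the means just computed. *)
Lemma iid_mean_pair_sumM k D D' :
  (forall x y, D x y = D y x) -> (forall x y, D' x y = D' y x) ->
  iid_mean k (fun s => pair_sum D s * pair_sum D' s) =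
  2 * k%:R * (k%:R - 1) * mean1 (fun c => mean1 (fun x => D c x * D' c x)) +
  4 * k%:R * (k%:R - 1) * (k%:R - 2) * mean1 (fun c => mean1 (D c) * mean1 (D' c)) +
  k%:R * (k%:R - 1) * (k%:R - 2) * (k%:R - 3) *
    (mean1 (fun c => mean1 (D c)) * mean1 (fun c => mean1 (D' c))).
Proof.
move=> DC DC'; elim: k => [|k IH]; first by rewrite /= !(mul0r, mulr0) !addr0.
rewrite iid_meanS.
pose e := mean1 (fun c => mean1 (D c)); pose e' := mean1 (fun c => mean1 (D' c)).
transitivity (mean1 (fun c => iid_mean k (fun s => pair_sum D s * pair_sum D' s)
   + (4 * k%:R * (k%:R - 1) * mean1 (fun x => mean1 (D x) * D' c x) +
      (2 * k%:R * (k%:R - 1) * (k%:R - 2) * e * mean1 (D' c) +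
      (4 * k%:R * (k%:R - 1) * mean1 (fun x => mean1 (D' x) * D c x) +
      (2 * k%:R * (k%:R - 1) * (k%:R - 2) * e' * mean1 (D c) +
      (4 * k%:R * mean1 (fun x => D c x * D' c x) +
       4 * k%:R * (k%:R - 1) * (mean1 (D c) * mean1 (D' c))))))))).
  apply: eq_mean1 => c.
  transitivity (iid_mean k (fun s => pair_sum D s * pair_sum D' s +
     (2 * (pair_sum D s * sum_seq (D' c) s) + (2 * (pair_sum D' s * sum_seq (D c) s)
     + 4 * (sum_seq (D c) s * sum_seq (D' c) s))))).
    by apply: eq_iid_mean => s; rewrite /=; ring.
  rewrite !iid_meanD !iid_meanZ iid_mean_sum_seqM.
  rewrite (iid_mean_pair_sum_sum_seq k _ DC) (iid_mean_pair_sum_sum_seq k _ DC').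
  rewrite -/e -/e'; ring.
rewrite !mean1D !mean1Z mean1_cst IH.
have swap (d : C -> C -> R) (g : C -> R) : (forall x y, d x y = d y x) ->
    mean1 (fun c => mean1 (fun x => g x * d c x)) = mean1 (fun c => g c * mean1 (d c)).
  move=> dC; rewrite mean1C; apply: eq_mean1 => x; rewrite -mean1Z.
  by apply: eq_mean1 => c; rewrite dC.
rewrite (swap _ _ DC) (swap _ _ DC').
have -> : mean1 (fun c => mean1 (D' c) * mean1 (D c)) = mean1 (fun c => mean1 (D c) * mean1 (D' c)).
  by apply: eq_mean1 => c; rewrite mulrC.
rewrite -/e -/e' -natr1; ring.
Qed.

(** The pair sum of a word, seen as a function of the numbers of occurrences of its letters; the
    last sum removes the pairs of a position with itself. *)
Definition count_pairs D (kappa : C -> nat) : R :=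
  \sum_c \sum_c' D c c' * ((kappa c)%:R * (kappa c')%:R) - \sum_c D c c * (kappa c)%:R.

Lemma sum_count f (s : seq C) : \sum_c f c * (count_mem c s)%:R = sum_seq f s.
Proof.
rewrite /sum_seq; elim: s => [|x s IH]; first by rewrite big_nil big1// => c _; rewrite mulr0.
rewrite big_cons -IH; under eq_bigr do rewrite /= natrD mulrDr.
rewrite big_split/=; congr (_ + _).
rewrite (bigD1 x)//= eqxx mulr1 big1 ?addr0// => c cx.
by rewrite eq_sym (negbTE cx) mulr0.
Qed.

Lemma count_pairsE D (s : seq C) : (forall x y, D x y = D y x) ->
  count_pairs D (fun c => count_mem c s) = pair_sum D s.
Proof.
move=> DC; rewrite /count_pairs.
have E t : \sum_c \sum_c' D c c' * ((count_mem c t)%:R * (count_mem c' t)%:R) =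
    sum_seq (fun c => sum_seq (D c) t) t.
  rewrite -sum_count; apply: eq_bigr => c _; rewrite -sum_count mulr_suml.
  by apply: eq_bigr => c' _; rewrite mulrAC mulrA.
rewrite E sum_count; elim: s => [|x s IH]; first by rewrite /sum_seq !big_nil subrr.
rewrite /= -IH /sum_seq !big_cons.
under [X in _ + _ + X - _]eq_bigr do rewrite big_cons.
rewrite big_split /=; under [X in _ + _ + (X + _) - _]eq_bigr do rewrite DC.
ring.
Qed.

(** The multinomial distribution. A first letter x lowers [kappa x] by one, and the resulting terms
    carry the factors [kappa x], whose sum is k + 1. *)
Lemma iid_mean_counts k (kappa : C -> nat) :
  iid_mean k (fun s => [forall c, count_mem c s == kappa c]%:R) =
  (\sum_c kappa c == k)%N%:R * k`!%:R * \prod_c (p c ^+ kappa c / (kappa c)`!%:R).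
Proof.
elim: k kappa => [|k IH] kappa.
  rewrite /= sum_nat_eq0 mulr1.
  have -> : [forall c, 0 == kappa c] = [forall i, kappa i == 0].
    by apply: eq_forallb => c; rewrite eq_sym.
  case: forallP => [k0|]; last by rewrite mul0r.
  by rewrite big1 ?mulr1// => c _; rewrite (eqP (k0 c)) expr0 divr1.
rewrite iid_meanS.
(* The subtraction is truncated: for [kappa x] = 0 nothing is lowered, but x cannot then be the
   first letter, and the factor [(0 < kappa x)] removes the term. *)
pose low x c := (kappa c - (c == x))%N.
transitivity (mean1 (fun x => (0 < kappa x)%N%:R * ((\sum_c low x c == k)%N%:R * k`!%:R *
   \prod_c (p c ^+ low x c / (low x c)`!%:R)))).
  apply: eq_mean1 => x; rewrite -IH -iid_meanZ; apply: eq_iid_mean => s.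
  rewrite -natrM mulnb; congr (_ %:R); congr nat_of_bool.
  apply/forallP/andP => [H|[kx /forallP H] c].
    split; first by rewrite -(eqP (H x)) /= eqxx.
    apply/forallP => c; rewrite /low -(eqP (H c)) /= [c == x]eq_sym.
    by rewrite addKn.
  have := H c; rewrite /low /= => /eqP ->; rewrite [c == x]eq_sym.
  by case: (eqVneq x c) => [<-|_]; rewrite ?subn0// subnKC.
have sum_low x : (0 < kappa x)%N -> (\sum_c kappa c = (\sum_c low x c).+1)%N.
  move=> kx; rewrite (bigD1 x)//= [in RHS](bigD1 x)//= /low eqxx -addSn subn1 prednK//.
  by congr (_ + _)%N; apply: eq_bigr => c /negbTE ->; rewrite subn0.
have prod_low x : (0 < kappa x)%N ->
    p x * \prod_c (p c ^+ low x c / (low x c)`!%:R) =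
    (kappa x)%:R * \prod_c (p c ^+ kappa c / (kappa c)`!%:R).
  move=> kx; rewrite (bigD1 x)//= [in RHS](bigD1 x)//= /low eqxx subn1 !mulrA.
  congr (_ * _); last by apply: eq_bigr => c /negbTE ->; rewrite subn0.
  rewrite -{3 4 5}(prednK kx) factS natrM exprS; field.
  by rewrite pnatr_eq0 -lt0n fact_gt0 addrC natr1 pnatr_eq0.
transitivity (\sum_x (kappa x)%:R * ((\sum_c kappa c == k.+1)%N%:R * k`!%:R *
   \prod_c (p c ^+ kappa c / (kappa c)`!%:R))).
  apply: eq_bigr => x _; case: (posnP (kappa x)) => [->|kx]; first by rewrite !mul0r mulr0.
  rewrite mul1r mulrCA (prod_low _ kx) (sum_low _ kx) eqSS; ring.
rewrite -mulr_suml -natr_sum; case: eqP => [->|_]; last by rewrite !(mul0r, mulr0).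
by rewrite factS natrM; ring.
Qed.

End IidSequence.

(** * Counts of a Poisson process in the cells of a partition *)

Section Points.
Context {d : measure_display} {T : measurableType d} {R : realType}.
Variables (P : probability T R) (rho : R) (X : T -> set (plane R)).
Hypothesis HX : poisson_process P rho X.
Variable n : nat.

Definition points (w : T) : seq (plane R) := fset_set (X w `&` square n).

Lemma bounded_square (B : set (plane R)) : B `<=` square n -> bounded_set B.
Proof.
move=> Bn; exists n%:R; split; first exact: num_real.
move=> M nM x /Bn[] /=; rewrite !in_itv/= => /andP[x0 x1] /andP[y0 y1].
by rewrite prod_normE/= ge_max !ger0_norm// !(le_trans _ (ltW nM)).
Qed.

Lemma finite_points w : finite_set (X w `&` square n).
Proof. by apply: (pp_locally_finite HX); exact: bounded_square. Qed.

Lemma mem_points w x : (x \in points w) = (x \in X w `&` square n).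
Proof. by rewrite -(in_fset_set (finite_points w)). Qed.

Lemma uniq_points w : uniq (points w).
Proof. exact: fset_uniq. Qed.

Lemma size_points w : size (points w) = num_points X (square n) w.
Proof. by []. Qed.

Definition pairs (K : plane R -> plane R -> R) (w : T) : R :=
  \sum_(x <- points w) \sum_(y <- points w) K x y - \sum_(x <- points w) K x x.

(** The points in the square are finitely many and listed without repetition, so that distinct
    points are the same as distinct positions in the list. *)
Lemma close_pairsE r : close_pairs n X r = pairs (dist_le r).
Proof.
apply/funext => w; rewrite /close_pairs /pairs.
set S := [set p : plane R * plane R | _].
pose s := [seq p <- [seq (x, y) | x <- points w, y <- points w] | p.1 != p.2].
have us : uniq s.
  apply: filter_uniq; apply: allpairs_uniq; [exact: uniq_points|exact: uniq_points|].
  by move=> [x1 x2] [y1 y2].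
have Ss : S = [set` s].
  apply/seteqP; split => -[x y]; rewrite /S /= mem_filter/=.
    move=> [Ax Ay xy]; apply/andP; split; first exact/eqP.
    apply/allpairsP; exists (x, y); split => //=; rewrite mem_points; exact/mem_set.
  move=> /andP[/eqP xy] /allpairsP[[u v] [/= + + [ux vy]]]; subst u v.
  by rewrite !mem_points => /set_mem Ax /set_mem Ay; split.
rewrite Ss -(fsbig_seq _ _ us) /s big_filter big_mkcond big_allpairs -sumrB.
rewrite [LHS]big_seq [RHS]big_seq; apply: eq_bigr => x xA.
rewrite [in RHS](bigD1_seq x)//= ?uniq_points// addrAC subrr add0r [RHS]big_mkcond.
by apply: eq_bigr => y _; rewrite eq_sym.
Qed.

Variables (C : finType) (q : plane R -> C).

Definition cell (c : C) : set (plane R) := square n `&` q @^-1` [set c].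

Lemma cell_square c : cell c `<=` square n.
Proof. exact: subIsetl. Qed.

Lemma num_points_cell c w :
  num_points X (cell c) w = count_mem c [seq q x | x <- points w].
Proof.
have fin : finite_set (X w `&` cell c).
  by apply: sub_finite_set (finite_points w); apply: setIS; exact: cell_square.
rewrite /num_points count_map -size_filter; apply: perm_size; apply: uniq_perm.
- exact: fset_uniq.
- by apply: filter_uniq; exact: uniq_points.
move=> x; rewrite mem_filter mem_points (in_fset_set fin).
apply/idP/andP => [/set_mem[Xx [nx qx]]|[/eqP qx /set_mem[Xx nx]]].
  by split; [exact/eqP|exact/mem_set].
exact/mem_set.
Qed.

Lemma pairs_count D w : (forall x y, D x y = D y x) ->
  pairs (fun x y => D (q x) (q y)) w =
  count_pairs D (fun c => num_points X (cell c) w).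
Proof.
move=> DC; rewrite [X in count_pairs _ X](_ : _ = fun c => count_mem c [seq q x | x <- points w]).
  rewrite /count_pairs sum_count /pairs.
  have -> : \sum_c \sum_c' D c c' * ((count_mem c [seq q x | x <- points w])%:R *
      (count_mem c' [seq q x | x <- points w])%:R) =
    sum_seq (fun c => sum_seq (D c) [seq q x | x <- points w]) [seq q x | x <- points w].
    rewrite -sum_count; apply: eq_bigr => c _; rewrite -sum_count mulr_suml.
    by apply: eq_bigr => c' _; rewrite mulrAC mulrA.
  rewrite /sum_seq !big_map; congr (_ - _); apply: eq_bigr => x _.
  by rewrite big_map.
by apply/funext => c; exact: num_points_cell.
Qed.

Lemma num_points_sum w :
  (\sum_c num_points X (cell c) w = num_points X (square n) w)%N.
Proof.
under eq_bigr do rewrite num_points_cell.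
rewrite -size_points -(size_map q) -sum1_size.
elim: [seq q x | x <- points w] => [|c s IH]; first by rewrite big_nil big1.
rewrite big_cons -IH; under eq_bigr do rewrite /=.
rewrite big_split/=; congr (_ + _)%N.
by rewrite (bigD1 c)//= eqxx big1 ?addn0// => c' /negbTE; rewrite eq_sym => ->.
Qed.

(** At a = 0 the convention 0^0 = 1 gives the mass at 0, in agreement with [poisson_prob]. Cells of
    area 0 do occur: the last cells of the grids are parts of an edge of the square. *)
Definition poisson_mass (a : R) (k : nat) : R := a ^+ k / k`!%:R * expR (- a).

Lemma poisson_probE (a : R) k : 0 <= a -> poisson_prob a 0 [set k] = (poisson_mass a k)%:E.
Proof.
rewrite /poisson_prob le_eqVlt => /predU1P[<-|a0].
  rewrite ltxx diracE /poisson_mass oppr0 expR0 mulr1 expr0n.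
  by case: k => [|k]; rewrite ?divr1 ?mul0r; [rewrite mem_set|rewrite memNset].
by rewrite a0 esum_set1 ?lee_fin ?poisson_pmf_ge0// /poisson_pmf a0.
Qed.

Hypothesis rho0 : 0 < rho.
Hypothesis n0 : (0 < n)%N.
Hypothesis mq : forall c, measurable (q @^-1` [set c]).

Lemma mcell c : measurable (cell c).
Proof. by apply: measurableI => //; exact: measurable_square. Qed.

Definition cell_mean c : R := rho * fine (area (cell c)).

Lemma cell_mean_ge0 c : 0 <= cell_mean c.
Proof. by apply: mulr_ge0; [exact: ltW|apply: fine_ge0; rewrite /area; exact: measure_ge0]. Qed.

Lemma bounded_cell c : bounded_set (cell c).
Proof. by apply: bounded_square; exact: cell_square. Qed.

Lemma law_cell c k : P (num_points X (cell c) @^-1` [set k]) = (poisson_mass (cell_mean c) k)%:E.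
Proof.
rewrite (pp_law HX); [|exact: mcell|exact: bounded_cell].
exact/poisson_probE/cell_mean_ge0.
Qed.

(** The cells are disjoint as preimages of distinct points. Independence is stated for families
    indexed by ordinals, hence the enumeration of [C]. *)
Lemma law_cells (kappa : C -> nat) :
  P [set w | forall c, num_points X (cell c) w = kappa c] =
  (\prod_c poisson_mass (cell_mean c) (kappa c))%:E.
Proof.
have tB : trivIset setT (fun i : 'I_#|C| => cell (enum_val i)).
  apply/trivIsetP => i j _ _ ij; rewrite -subset0 => x [[_ /= xi] [_ /= xj]].
  by case/negP: ij; apply/eqP/enum_val_inj; rewrite -xi -xj.
have mI := pp_independent HX (fun i : 'I_#|C| => mcell (enum_val i)) (fun i => bounded_cell (enum_val i)) tB.
have := mI (fun i : 'I_#|C| => [set kappa (enum_val i)]) (fun=> I).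
have -> : \bigcap_(i : 'I_#|C|) (num_points X (cell (enum_val i)) @^-1` [set kappa (enum_val i)]) =
    [set w | forall c, num_points X (cell c) w = kappa c].
  apply/seteqP; split => w /= H => [c|i _]; last exact: H.
  by have := H (enum_rank c) I; rewrite /= enum_rankK.
move=> ->; transitivity (\prod_(i < #|C|)
    (poisson_mass (cell_mean (enum_val i)) (kappa (enum_val i)))%:E)%E.
  by apply: eq_bigr => i _; exact: law_cell.
rewrite prodEFin; congr EFin; apply/esym.
rewrite -(big_enum_val (A := C) (fun c => poisson_mass (cell_mean c) (kappa c))).
by apply: eq_bigl => c.
Qed.

Definition cell_prob c : R := fine (area (cell c)) / n%:R ^+ 2.

Let a := rho * n%:R ^+ 2.

Let n20 : n%:R ^+ 2 != 0 :> R.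
Proof. by rewrite expf_neq0// pnatr_eq0 -lt0n. Qed.

Lemma cell_meanE c : cell_mean c = a * cell_prob c.
Proof. by rewrite /cell_mean /a /cell_prob; field; rewrite pnatr_eq0 -lt0n. Qed.

Lemma poisson_mass_ge0 (b : R) k : 0 <= b -> 0 <= poisson_mass b k.
Proof. by move=> b0; rewrite !mulr_ge0 ?expR_ge0 ?invr_ge0 ?exprn_ge0. Qed.

Lemma area_cell_fin c : area (cell c) \is a fin_num.
Proof.
rewrite -(setIidl (cell_square (c := c))).
apply: area_square_fin; exact: mcell.
Qed.

Lemma sum_enum_fsbig (f : C -> \bar R) : (\sum_(c \in [set: C]) f c = \sum_c f c)%E.
Proof.
rewrite (fsbigE (enum C)) ?enum_uniq//=.
  by rewrite big_enum_cond; apply: eq_bigl => c; rewrite in_setT.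
by move=> c _; rewrite mem_enum.
Qed.

Lemma cell_prob_sum : \sum_c cell_prob c = 1.
Proof.
rewrite /cell_prob -mulr_suml; suff -> : \sum_c fine (area (cell c)) = n%:R ^+ 2.
  by rewrite divff.
rewrite sum_fine; last by move=> c _; exact: area_cell_fin.
have <- : area (square n) = (\sum_c area (cell c))%E.
  have -> : square n = \bigcup_(c in [set: C]) cell c :> set (plane R).
    by apply/seteqP; split => [x nx|x [c _ []]//]; exists (q x).
  rewrite areaE; last by apply: fin_bigcup_measurable => [|c _]; [exact: finite_finset|exact: mcell].
  rewrite measure_fin_bigcup//; [|exact: finite_finset| |by move=> c _; exact: mcell].
    by apply: (etrans (sum_enum_fsbig _)); apply: eq_bigr => c _; apply/esym/areaE; exact: mcell.
  by apply/trivIsetP => c c' _ _ cc'; rewrite -subset0 => x [[_ /= xc] [_ /= xc']];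
    case/eqP: cc'; rewrite -xc -xc'.
by rewrite area_square.
Qed.

(** Independent Poisson counts with total k have, up to the probability of that total, the
    multinomial law: the cell means add up to a, and their exponentials multiply to e^(-a). *)
Lemma prod_poisson_mass k (kappa : C -> nat) : (\sum_c kappa c = k)%N ->
  \prod_c poisson_mass (cell_mean c) (kappa c) =
  poisson_mass a k * (k`!%:R * \prod_c (cell_prob c ^+ kappa c / (kappa c)`!%:R)).
Proof.
move=> kk; rewrite /poisson_mass big_split/= -expR_sum sumrN.
have -> : \sum_c cell_mean c = a.
  by under eq_bigr do rewrite cell_meanE; rewrite -mulr_sumr cell_prob_sum mulr1.
have -> : \prod_c (cell_mean c ^+ kappa c / (kappa c)`!%:R) =
    a ^+ k * \prod_c (cell_prob c ^+ kappa c / (kappa c)`!%:R).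
  rewrite -kk -prodrXr -big_split/=; apply: eq_bigr => c _.
  by rewrite cell_meanE exprMn mulrA.
have k0 : k`!%:R != 0 :> R by rewrite pnatr_eq0 -lt0n fact_gt0.
by field.
Qed.

Definition counts w : C -> nat := fun c => num_points X (cell c) w.

(** On N = k the counts take finitely many values, listed by the functions from [C] to ['I_k.+1].
    Each value has the probability [poisson_mass a k] times its multinomial weight, and summing over
    the values gives back the mean over independent letters. *)
Lemma counts_mean k (F : (C -> nat) -> R) :
  (\int[P]_w ((num_points X (square n) w == k)%:R * F (counts w))%:E =
   (poisson_mass a k * iid_mean cell_prob k (fun s => F (fun c => count_mem c s)))%:E)%E.
Proof.
pose K := {ffun C -> 'I_k.+1}.
pose nk (f : K) : C -> nat := fun c => f c.
pose E (f : K) := [set w | forall c, num_points X (cell c) w = nk f c].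
have mE f : measurable (E f).
  have -> : E f = \bigcap_(c in [set: C]) (num_points X (cell c) @^-1` [set nk f c]).
    by apply/seteqP; split => w /= H c; [move=> _|]; exact: H.
  apply: fin_bigcap_measurable => [|c _]; first exact: finite_finset.
  rewrite -[X in measurable X]setTI.
  by apply: (pp_measurable HX (@mcell c) (@bounded_cell c)).
have find (m : C -> nat) : (\sum_c m c = k)%N -> exists f : K, nk f = m.
  move=> mk; have mle c : (m c < k.+1)%N by rewrite ltnS -mk (bigD1 c)//= leq_addr.
  by exists [ffun c => Ordinal (mle c)]; apply/funext => c; rewrite /nk ffunE.
have nk_inj f f' : nk f = nk f' -> f = f'.
  move=> ff; apply/ffunP => c; apply/val_inj; exact: (congr1 (fun g => g c) ff).
(* The sum retains the only function with counts [m]. It is used twice, for the counts of a point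
   configuration and for those of a word. *)
have pick (m : C -> nat) (G : (C -> nat) -> R) : \sum_(f : K) ((\sum_c nk f c == k)%N%:R *
    G (nk f) * `[< nk f = m >]%:R) = (\sum_c m c == k)%N%:R * G m.
  case: eqP => [mk|mk].
    have [f fm] := find m mk.
    rewrite (bigD1 f)//= fm mk eqxx asboolT// mulr1 big1 ?addr0// => g gf.
    by rewrite asboolF ?mulr0// => gm; case/eqP: gf; apply: nk_inj; rewrite gm.
  rewrite mul0r big1// => f _; case: asboolP => [fm|]; rewrite ?mulr0// fm.
  by case: eqP => //; rewrite !mul0r.
pose wt (f : K) : R := (\sum_c nk f c == k)%N%:R * F (nk f).
transitivity (\int[P]_w (\sum_(f : K) (wt f * \1_(E f) w)%:E))%E.
  apply: eq_integral => w _; rewrite sumEFin; congr EFin.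
  rewrite -num_points_sum -[LHS](pick (counts w) F); apply: eq_bigr => f _.
  rewrite /wt indicE; congr (_ * _%:R); congr nat_of_bool.
  by apply/asboolP/idP => [fw|/set_mem fw]; [apply/mem_set => c; rewrite fw|apply/funext => c; rewrite -fw].
have iE f : P.-integrable setT (fun w => (wt f * \1_(E f) w)%:E).
  have iI : P.-integrable setT (EFin \o \1_(E f)) by exact: integrable_indic.
  by have := integrableZl measurableT (wt f) iI; apply: eq_integrable.
rewrite (integral_sum measurableT iE).
transitivity (\sum_(f : K) (wt f * \prod_c poisson_mass (cell_mean c) (nk f c))%:E)%E.
  apply: eq_bigr => f _; rewrite EFinM -law_cells.
  have iI : P.-integrable setT (EFin \o \1_(E f)) by exact: integrable_indic.
  apply: (etrans (integralZl measurableT iI (wt f))).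
  by rewrite integral_indic// setIT.
rewrite sumEFin; congr EFin.
transitivity (\sum_(f : K) poisson_mass a k * (F (nk f) * iid_mean cell_prob k
   (fun s => [forall c, count_mem c s == nk f c]%:R))).
  apply: eq_bigr => f _; rewrite iid_mean_counts /wt; case: eqP => kk.
    by rewrite !mul1r (prod_poisson_mass kk); ring.
  by rewrite !mul0r !mulr0.
rewrite -mulr_sumr; congr (_ * _).
under eq_bigr do rewrite -iid_meanZ.
rewrite -iid_mean_sum//; last exact: cell_prob_sum.
apply: eq_iid_mean_size => s sk.
have sumk : (\sum_c count_mem c s = k)%N.
  rewrite -sk -sum1_size; elim: s {sk} => [|x s IH]; first by rewrite big_nil big1.
  rewrite big_cons -IH; under eq_bigr do rewrite /=.
  rewrite big_split/=; congr (_ + _)%N.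
  by rewrite (bigD1 x)//= eqxx big1 ?addn0// => c /negbTE; rewrite eq_sym => ->.
have := pick (fun c => count_mem c s) F; rewrite sumk eqxx mul1r => <-.
apply: eq_bigr => f _.
have -> : [forall c, count_mem c s == nk f c] = `[< nk f = fun c => count_mem c s >].
  apply/forallP/asboolP => [H|-> //]; apply/funext => c; exact/esym/eqP.
case: asboolP => [->|_]; last by rewrite !mulr0.
by rewrite sumk eqxx mul1r.
Qed.

(* Two ordered pairs taken from [k] points share two points in 2 ways, one point in 4 ways, and no
   point in 1 way. *)
Definition pair_moment k (w v e e' : R) : R :=
  2 * k%:R * (k%:R - 1) * w + 4 * k%:R * (k%:R - 1) * (k%:R - 2) * v +
  k%:R * (k%:R - 1) * (k%:R - 2) * (k%:R - 3) * (e * e').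

Lemma cell_pairs_mean k (D D' : C -> C -> R) :
  (forall x y, D x y = D y x) -> (forall x y, D' x y = D' y x) ->
  (\int[P]_w ((num_points X (square n) w == k)%:R *
     (pairs (fun x y => D (q x) (q y)) w * pairs (fun x y => D' (q x) (q y)) w))%:E =
   (poisson_mass a k * pair_moment k
     (mean1 cell_prob (fun c => mean1 cell_prob (fun x => D c x * D' c x)))
     (mean1 cell_prob (fun c => mean1 cell_prob (D c) * mean1 cell_prob (D' c)))
     (mean1 cell_prob (fun c => mean1 cell_prob (D c)))
     (mean1 cell_prob (fun c => mean1 cell_prob (D' c))))%:E)%E.
Proof.
move=> DC DC'.
rewrite /pair_moment -iid_mean_pair_sumM//; last exact: cell_prob_sum.
transitivity (\int[P]_w ((num_points X (square n) w == k)%:R *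
    (count_pairs D (counts w) * count_pairs D' (counts w)))%:E)%E.
  by apply: eq_integral => w _; rewrite !pairs_count.
rewrite (counts_mean k (fun m => count_pairs D m * count_pairs D' m)).
congr (_ * _)%:E; apply: eq_iid_mean => s.
by rewrite !count_pairsE.
Qed.

Lemma measurable_num_points (B : set (plane R)) : measurable B -> B `<=` square n ->
  measurable_fun setT (fun w => (num_points X B w)%:R : R).
Proof.
move=> mB Bn; have := pp_measurable HX mB (bounded_square Bn).
by move=> h _ Y _; exact: (h measurableT ((fun k : nat => k%:R : R) @^-1` Y) I).
Qed.

Lemma measurable_cell_pairs (D : C -> C -> R) : (forall x y, D x y = D y x) ->
  measurable_fun setT (pairs (fun x y => D (q x) (q y))).
Proof.
move=> DC; rewrite (_ : pairs _ = fun w => count_pairs D (counts w)); last first.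
  by apply/funext => w; exact: pairs_count.
have mN c : measurable_fun setT (fun w => (counts w c)%:R : R).
  by apply: measurable_num_points; [exact: mcell|exact: cell_square].
rewrite /count_pairs; apply: measurable_funB.
  apply: measurable_sum => c; apply: measurable_sum => c'.
  by apply: measurable_funM => //; exact: measurable_funM.
by apply: measurable_sum => c; exact: measurable_funM.
Qed.

Variable nu : probability (plane R) R.
Hypothesis nu_square : forall B, measurable B ->
  nu B = (fine (area (B `&` square n)) / n%:R ^+ 2)%:E.

Lemma measurable_cell_fun (f : C -> R) : measurable_fun [set: plane R] (f \o q).
Proof.
rewrite (_ : f \o q = fun x => \sum_c f c * \1_(q @^-1` [set c]) x).
  by apply: measurable_sum => c; apply: measurable_funM => //; exact: measurable_indic.
apply/funext => x /=; rewrite (bigD1 (q x))//= indicE mem_set// mulr1 big1 ?addr0// => c cx.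
by rewrite indicE memNset ?mulr0// => /= qx; rewrite qx eqxx in cx.
Qed.

Lemma integral_cell (f : C -> R) :
  (\int[nu]_x (f (q x))%:E = (mean1 cell_prob f)%:E)%E.
Proof.
transitivity (\int[nu]_x (\sum_c (f c * \1_(q @^-1` [set c]) x)%:E))%E.
  apply: eq_integral => x _; rewrite sumEFin; congr EFin.
  rewrite (bigD1 (q x))//= indicE mem_set// mulr1 big1 ?addr0// => c cx.
  by rewrite indicE memNset ?mulr0// => /= qx; rewrite qx eqxx in cx.
have iI c : nu.-integrable setT (EFin \o \1_(q @^-1` [set c])).
  by apply: integrable_indic.
rewrite integral_sum//; last first.
  by move=> c; have := integrableZl measurableT (f c) (iI c); apply: eq_integrable.
rewrite /mean1 -sumEFin; apply: eq_bigr => c _.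
apply: (etrans (integralZl measurableT (iI c) (f c))).
rewrite integral_indic// setIT EFinM muleC; congr (_ * _)%E.
apply: (etrans (nu_square (mq c))); congr (fine (area _) / _)%:E.
by rewrite setIC.
Qed.

End Points.

(** * The limit of finer grids *)

Section Grid.
Context {R : realType}.
Variable n : nat.
Hypothesis n0 : (0 < n)%N.
Implicit Types (m : nat) (t r : R) (x y : plane R).

(* The end point [t = n] has the index [m.+1]; negative [t] and [t] beyond the last interval get junk
   indices. *)
Definition grid_coord m t : 'I_m.+2 :=
  inord (Num.truncn (Num.max 0 t * (m.+1%:R / n%:R))).

Definition grid_index m x : 'I_m.+2 * 'I_m.+2 := (grid_coord m x.1, grid_coord m x.2).

(** Closeness is rounded upwards: points of the square at distance at most r are close in every
    grid, and only pairs at a larger distance need a fine mesh. *)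
Definition grid_close m r (c c' : 'I_m.+2 * 'I_m.+2) : R :=
  `[< exists x y, [/\ square n x, square n y, grid_index m x = c,
                      grid_index m y = c' & dist x y <= r] >]%:R.

Lemma grid_closeC m r c c' : grid_close (m := m) r c c' = grid_close r c' c.
Proof.
by congr (nat_of_bool _)%:R; apply: asbool_equiv_eq; split => -[x [y [? ? ? ? ?]]];
  exists y, x; split => //; rewrite distC.
Qed.

Lemma measurable_grid_coord m (k : 'I_m.+2) : measurable (grid_coord m @^-1` [set k]).
Proof.
(* [inord] sends every index out of range to 0, so that several integers j may yield the same
   cell. *)
have -> : grid_coord m @^-1` [set k] = \bigcup_(j in [set j | inord j = k])
    [set t | j%:R <= Num.max 0 t * (m.+1%:R / n%:R) < j.+1%:R].
  have c0 t : 0 <= Num.max 0 t * (m.+1%:R / n%:R).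
    by rewrite mulr_ge0// le_max lexx.
  apply/seteqP; split => t /=.
    move=> tk; exists (Num.truncn (Num.max 0 t * (m.+1%:R / n%:R))) => //=.
    by rewrite -truncn_eq.
  by move=> [j /= jk]; rewrite -truncn_eq// => /eqP e; rewrite /grid_coord e.
apply: bigcup_measurable => j _.
have mf : measurable_fun [set: R] (fun t => Num.max 0 t * (m.+1%:R / n%:R)) by measurability.
have : measurable_fun [set: R] (fun t => (j%:R <= Num.max 0 t * (m.+1%:R / n%:R)) &&
    (Num.max 0 t * (m.+1%:R / n%:R) < j.+1%:R)).
  by apply: measurable_and; [exact: measurable_fun_ler|exact: measurable_fun_ltr].
by move=> /(_ measurableT [set true] I); rewrite setTI.
Qed.

Lemma measurable_grid_index m c : measurable (grid_index m @^-1` [set c]).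
Proof.
have -> : grid_index m @^-1` [set c] =
    (grid_coord m @^-1` [set c.1]) `*` (grid_coord m @^-1` [set c.2]).
  case: c => c1 c2; apply/seteqP; split => x /=; first by move=> [<- <-].
  by move=> [/= e1 e2]; rewrite /grid_index e1 e2.
by apply: measurableX; exact: measurable_grid_coord.
Qed.

Lemma grid_coord_near m t t' : 0 <= t <= n%:R -> 0 <= t' <= n%:R ->
  grid_coord m t = grid_coord m t' -> `|t - t'| <= n%:R / m.+1%:R.
Proof.
have n0' : 0 < n%:R :> R by rewrite ltr0n.
pose c : R := m.+1%:R / n%:R; have c0 : 0 < c by rewrite divr_gt0.
have bound s : 0 <= s <= n%:R -> (Num.truncn (s * c) < m.+2)%N /\
    ((Num.truncn (s * c))%:R <= s * c < (Num.truncn (s * c)).+1%:R).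
  move=> /andP[s0 sn]; have sc0 : 0 <= s * c by rewrite mulr_ge0// ltW.
  split; last by rewrite truncn_itv.
  rewrite ltnS -(ler_nat R) (@le_trans _ _ (s * c))// ?truncn_le//.
  by rewrite /c mulrCA ler_piMr// ler_pdivrMr// mul1r.
move=> tn t'n; rewrite /grid_coord !max_r; [|by case/andP: t'n|by case/andP: tn].
have [b1 /andP[l1 u1]] := bound _ tn; have [b2 /andP[l2 u2]] := bound _ t'n.
move=> /(congr1 val); rewrite /= !inordK// => E.
rewrite E in l1 u1.
have -> : n%:R / m.+1%:R = c^-1 by rewrite /c invf_div.
rewrite -[leRHS]mul1r ler_pdivlMr// -(ger0_norm (ltW c0)) -normrM ler_norml mulrBl.
move: l1 u1 l2 u2; move: (t * c) (t' * c) => u v; rewrite -natr1; move: (_%:R) => k ? ? ? ?.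
by apply/andP; split; lra.
Qed.

Lemma grid_close_cvg r x y : 0 < r -> square n x -> square n y ->
  exists M, forall m, (M <= m)%N ->
    grid_close r (grid_index m x) (grid_index m y) = dist_le r x y.
Proof.
move=> r0 nx ny; rewrite /dist_le /grid_close; case: (leP (dist x y) r) => [xyr|rxy].
  by exists 0%N => m _; rewrite asboolT//; exists x, y.
have n0' : 0 < n%:R :> R by rewrite ltr0n.
pose sq (x y : plane R) := (x.1 - y.1) ^+ 2 + (x.2 - y.2) ^+ 2.
have sq_le x' y' : (dist x' y' <= r) = (sq x' y' <= r ^+ 2).
  by rewrite -{1}(ger0_norm (ltW r0)) -sqrtr_sqr ler_sqrt// sqr_ge0.
have eta0 : 0 < sq x y - r ^+ 2 by rewrite subr_gt0 ltNge -sq_le -ltNge.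
(* With mesh delta, moving both points inside their cells changes each squared coordinate difference
   by at most 4 n delta, hence the squared distance by at most 8 n delta. The constant 16 leaves a
   margin of a factor 2. *)
exists (Num.truncn (16 * n%:R ^+ 2 / (sq x y - r ^+ 2))) => m Mm.
rewrite asboolF// => -[x' [y' [nx' ny' /= [e1 e2] [e3 e4]]]].
rewrite sq_le; apply/negP; rewrite -ltNge.
pose delta : R := n%:R / m.+1%:R.
have d0 : 0 < delta by rewrite divr_gt0.
have dn : delta <= n%:R by rewrite ler_pdivrMr// ler_peMr ?ler1n// ltW.
have deta : 16 * n%:R * delta < sq x y - r ^+ 2.
  have : 16 * n%:R ^+ 2 / (sq x y - r ^+ 2) < m.+1%:R.
    apply: (lt_le_trans (truncnS_gt _)).
    by rewrite ler_nat ltnS.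
  rewrite ltr_pdivrMr// => h.
  by rewrite /delta mulrA ltr_pdivrMr// -mulrA -expr2 [ltRHS]mulrC.
have sub_sqr u v u' v' : 0 <= u <= n%:R -> 0 <= v <= n%:R -> 0 <= u' <= n%:R ->
    0 <= v' <= n%:R -> `|u - u'| <= delta -> `|v - v'| <= delta ->
    (u - v) ^+ 2 <= (u' - v') ^+ 2 + 4 * n%:R * delta.
  move=> /andP[u0 un] /andP[v0 vn] /andP[u'0 u'n] /andP[v'0 v'n].
  rewrite !ler_norml => /andP[h1 h2] /andP[h3 h4].
  rewrite -lerBlDl subr_sqr; set A := _ - _ - _; set B := _ - _ + _.
  have A1 : `|A| <= 2 * delta by rewrite ler_norml /A; apply/andP; split; lra.
  have B1 : `|B| <= 2 * n%:R by rewrite ler_norml /B; apply/andP; split; lra.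
  apply: (le_trans (ler_norm _)); rewrite normrM.
  apply: (le_trans (ler_pM _ _ A1 B1)) => //.
  by rewrite le_eqVlt; apply/orP; left; apply/eqP; ring.
have inn (z : plane R) : square n z -> (0 <= z.1 <= n%:R) /\ (0 <= z.2 <= n%:R).
  by move=> [/= h1 h2]; move: h1 h2; rewrite !in_itv.
have [[x1 x2] [y1 y2]] := (inn _ nx, inn _ ny).
have [[x1' x2'] [y1' y2']] := (inn _ nx', inn _ ny').
have s1 := sub_sqr _ _ _ _ x1 y1 x1' y1' (grid_coord_near x1 x1' (esym e1))
  (grid_coord_near y1 y1' (esym e3)).
have s2 := sub_sqr _ _ _ _ x2 y2 x2' y2' (grid_coord_near x2 x2' (esym e2))
  (grid_coord_near y2 y2' (esym e4)).
have nd : 0 <= n%:R * delta by rewrite mulr_ge0 ?ler0n// ltW.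
by move: deta s1 s2 nd; rewrite /sq -!mulrA; lra.
Qed.

End Grid.

Section FinerGrids.
Context {d : measure_display} {T : measurableType d} {R : realType}.
Variables (P : probability T R) (rho : R) (X : T -> set (plane R)).
Hypothesis HX : poisson_process P rho X.
Variable n : nat.
Hypothesis rho0 : 0 < rho.
Hypothesis n0 : (0 < n)%N.
Variable nu : probability (plane R) R.
Hypothesis nu_square : forall B, measurable B ->
  nu B = (fine (area (B `&` square n)) / n%:R ^+ 2)%:E.

Lemma pairs_ge0 (K : plane R -> plane R -> R) w : (forall x y, 0 <= K x y) ->
  0 <= pairs X n K w.
Proof.
move=> K0; rewrite /pairs -sumrB big_seq sumr_ge0// => x xA.
by rewrite (bigD1_seq x)//= ?uniq_points// addrAC subrr add0r sumr_ge0.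
Qed.

Lemma pairs1 w : pairs X n (fun _ _ => 1) w =
  (num_points X (square n) w)%:R * ((num_points X (square n) w)%:R - 1).
Proof.
rewrite /pairs; under eq_bigr do rewrite big_const_seq count_predT iter_addr_0.
by rewrite !big_const_seq !count_predT !iter_addr_0 size_points -mulrnA natrM mulrBr mulr1.
Qed.

(** Sums over pairs are monotone: nonnegativity is applied to [K] and to 1 - [K]. *)
Lemma pairs_bound (K : plane R -> plane R -> R) w : (forall x y, 0 <= K x y <= 1) ->
  0 <= pairs X n K w <=
    (num_points X (square n) w)%:R * ((num_points X (square n) w)%:R - 1).
Proof.
move=> K01; have K0 x y : 0 <= K x y by case/andP: (K01 x y).
rewrite pairs_ge0// -pairs1 -subr_ge0.
have -> : pairs X n (fun _ _ => 1) w - pairs X n K w = pairs X n (fun x y => 1 - K x y) w.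
  rewrite /pairs sumrB; under [X in _ = X - _]eq_bigr do rewrite sumrB.
  by rewrite sumrB; ring.
by apply: pairs_ge0 => x y; rewrite subr_ge0; case/andP: (K01 x y).
Qed.

Lemma cvg_pairs (K_ : nat -> plane R -> plane R -> R) (K : plane R -> plane R -> R) w :
  (forall x y, square n x -> square n y -> (K_ ^~ x) ^~ y @ \oo --> K x y) ->
  (pairs X n (K_ m) w) @[m --> \oo] --> pairs X n K w.
Proof.
move=> cK; have An x : x \in points X n w -> square n x.
  by rewrite (mem_points HX) => /set_mem[].
have cadd := @add_continuous R.
apply: cvgB; last first.
  rewrite [X in _ --> X]big_seq; under eq_cvg do rewrite big_seq.
  by apply: cvg_big => //= x /An nx; exact: cK.
rewrite [X in _ --> X]big_seq; under eq_cvg do rewrite big_seq.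
apply: cvg_big => //= x /An nx.
rewrite [X in _ --> X]big_seq; under eq_cvg do rewrite big_seq.
by apply: cvg_big => //= y /An ny; exact: cK.
Qed.

(** Dominated convergence with the bound 1; convergence on the square suffices because its
    complement is null for [nu]. *)
Lemma cvg_uniform_mean (f_ : nat -> plane R -> R) (f : plane R -> R) (s_ : nat -> R) (s : R) :
  (forall m, measurable_fun setT (f_ m)) -> measurable_fun setT f ->
  (forall m x, 0 <= f_ m x <= 1) ->
  (forall x, square n x -> f_ m x @[m --> \oo] --> f x) ->
  (forall m, (\int[nu]_x (f_ m x)%:E = (s_ m)%:E)%E) -> (\int[nu]_x (f x)%:E = s%:E)%E ->
  s_ m @[m --> \oo] --> s.
Proof.
move=> mf_ mf f01 cf Ef_ Ef.
have [//|||||_ _] := @dominated_convergence _ _ _ nu setT measurableT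
  (fun m x => (f_ m x)%:E) (fun x => (f x)%:E) (fun=> 1%:E).
- by move=> m; exact/measurable_EFinP.
- exact/measurable_EFinP.
- exists (~` square n); split.
  + by apply: measurableC; exact: measurable_square.
  + apply: (etrans (nu_square _)); first by apply: measurableC; exact: measurable_square.
    by rewrite setICl areaE// measure0 mul0r.
  + move=> x /= nx sx; apply: nx => _.
    by apply: cvg_EFin; [exact: nearW|exact: cf].
- exact: finite_measure_integrable_cst.
- by apply: aeW => x m _; rewrite /= lee_fin ger0_norm; case/andP: (f01 m x).
move=> h; have : (s_ m)%:E @[m --> \oo] --> s%:E.
  by rewrite -Ef; under eq_cvg do rewrite -Ef_; exact: h.
by move=> /fine_cvgP[_].
Qed.

Let grid_kernel m s (x y : plane R) : R :=
  grid_close n s (grid_index n m x) (grid_index n m y).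

Let prob m := cell_prob n (@grid_index R n m).
Arguments prob : clear implicits.

Let mgrid m c : measurable (@grid_index R n m @^-1` [set c]).
Proof. exact: measurable_grid_index. Qed.

Let grid_kernel01 m s x y : 0 <= grid_kernel m s x y <= 1.
Proof. by rewrite ler0n lern1 leq_b1. Qed.

Let cvg_grid_kernel s x y : 0 < s -> square n x -> square n y ->
  grid_kernel m s x y @[m --> \oo] --> dist_le s x y.
Proof.
move=> s0 nx ny; have [M HM] := grid_close_cvg n0 s0 nx ny.
by apply: cvg_near_cst; exists M => // m /= Mm; exact: HM.
Qed.

Let mean1_01 m (f : 'I_m.+2 * 'I_m.+2 -> R) : (forall c, 0 <= f c <= 1) ->
  0 <= mean1 (prob m) f <= 1.
Proof.
move=> f01; rewrite -!lee_fin -(integral_cell (mgrid (m := m)) nu_square).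
apply: integral_prob_le1 => [|x]; last exact: f01.
by apply/measurable_EFinP; exact: (measurable_cell_fun (mgrid (m := m))).
Qed.

Let close01 m (s : R) c c' : 0 <= grid_close (m := m) n s c c' <= 1.
Proof. by rewrite ler0n lern1 leq_b1. Qed.

Let cvg_mean1 (f_ : forall m, 'I_m.+2 * 'I_m.+2 -> R) (f : plane R -> R) s :
  (forall m c, 0 <= f_ m c <= 1) -> measurable_fun setT f ->
  (forall x, square n x -> f_ m (grid_index n m x) @[m --> \oo] --> f x) ->
  (\int[nu]_x (f x)%:E = s%:E)%E ->
  mean1 (prob m) (f_ m) @[m --> \oo] --> s.
Proof.
move=> f01 mf cf Ef.
apply: (cvg_uniform_mean (f_ := fun m x => f_ m (grid_index n m x)) (f := f)) => //.
- by move=> m; exact: (measurable_cell_fun (mgrid (m := m)) (f_ m)).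
- by move=> m; exact: (integral_cell (mgrid (m := m)) nu_square (f_ m)).
Qed.

Let cvg_closeness s x : 0 < s -> square n x ->
  mean1 (prob m) (grid_close n s (grid_index n m x)) @[m --> \oo] --> closeness nu s x.
Proof.
move=> s0 nx.
apply: (cvg_mean1 (f_ := fun m => grid_close n s (grid_index n m x)) (f := dist_le s x)).
- by move=> m c; exact: close01.
- exact: measurable_dist_le.
- by move=> y ny; exact: cvg_grid_kernel.
- exact: closenessE.
Qed.

Let cvg_mean_closeness s : 0 < s ->
  mean1 (prob m) (fun c => mean1 (prob m) (grid_close n s c)) @[m --> \oo] -->
  mean_closeness nu s.
Proof.
move=> s0.
apply: (cvg_mean1 (f_ := fun m c => mean1 (prob m) (grid_close n s c)) (f := closeness nu s)).
- by move=> m c; apply: mean1_01 => c'; exact: close01.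
- exact: measurable_closeness.
- by move=> x nx; exact: cvg_closeness.
- exact: mean_closenessE.
Qed.

Lemma dist_leM r r' (x y : plane R) : r <= r' -> dist_le r x y * dist_le r' x y = dist_le r x y.
Proof.
move=> rr'; rewrite /dist_le; case: (leP (dist x y) r) => xr; last by rewrite mul0r.
by rewrite (le_trans xr rr') mulr1.
Qed.

(** The grid versions are polynomials in the counts of the cells, and [close_pairs] is their
    pointwise limit. *)
Lemma measurable_close_pairs r : 0 < r -> measurable_fun setT (close_pairs n X r).
Proof.
move=> r0; rewrite (close_pairsE HX).
apply: (measurable_fun_cvg (h := fun m => pairs X n (grid_kernel m r))).
- move=> m.
  exact: (measurable_cell_pairs HX n (mgrid (m := m)) (D := grid_close (m := m) n r) (grid_closeC _ _)).
- by move=> w _; apply: cvg_pairs => x y; exact: cvg_grid_kernel.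
Qed.

(** For r <= r' the product of the two closeness indicators is the one for r, whence
    [mean_closeness nu r] for two pairs that share both points. *)
Lemma close_pairs_mean k r r' : 0 < r -> r <= r' ->
  (\int[P]_w ((num_points X (square n) w == k)%:R *
     (close_pairs n X r w * close_pairs n X r' w))%:E =
   (poisson_mass (rho * n%:R ^+ 2) k * pair_moment k (mean_closeness nu r)
     (mean_closeness2 nu r r') (mean_closeness nu r) (mean_closeness nu r'))%:E)%E.
Proof.
move=> r0 rr'; have r'0 := lt_le_trans r0 rr'.
pose f_ m w := (num_points X (square n) w == k)%:R *
  (pairs X n (grid_kernel m r) w * pairs X n (grid_kernel m r') w).
pose f w := (num_points X (square n) w == k)%:R *
     (close_pairs n X r w * close_pairs n X r' w).
have mN : measurable_fun setT (fun w => (num_points X (square n) w == k)%:R : R).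
  have h := pp_measurable HX (@measurable_square R n) (bounded_square (@subset_refl _ _)).
  by move=> _ Y _; exact: (h measurableT ((fun j : nat => (j == k)%:R : R) @^-1` Y) I).
have mK m s : measurable_fun setT (pairs X n (grid_kernel m s)).
  exact: (measurable_cell_pairs HX n (mgrid (m := m)) (D := grid_close (m := m) n s) (grid_closeC _ _)).
have cf w : f_ m w @[m --> \oo] --> f w.
  apply: cvgM; first exact: cvg_cst.
  rewrite !(close_pairsE HX).
  by apply: cvgM; apply: cvg_pairs => x y; exact: cvg_grid_kernel.
have [//|||||_ _] := @dominated_convergence _ _ _ P setT measurableT
  (fun m w => (f_ m w)%:E) (fun w => (f w)%:E) (fun=> ((k%:R * (k%:R - 1)) ^+ 2)%:E).
- by move=> m; apply/measurable_EFinP; apply: measurable_funM => //; exact: measurable_funM.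
- apply/measurable_EFinP; apply: measurable_funM => //.
  by apply: measurable_funM; exact: measurable_close_pairs.
- by apply: aeW => w _; apply: cvg_EFin; [exact: nearW|exact: cf].
- exact: finite_measure_integrable_cst.
(* Off the event N = k the integrand is 0; on it, each of the two pair sums is at most k (k - 1) in
   every grid. *)
- apply: aeW => w m _; rewrite /= lee_fin /f_; case: eqP => [Nk|_]; last first.
    by rewrite mul0r normr0 sqr_ge0.
  have /andP[a0 a1] := pairs_bound w (grid_kernel01 m r).
  have /andP[b0 b1] := pairs_bound w (grid_kernel01 m r').
  rewrite mul1r ger0_norm ?mulr_ge0//; rewrite Nk in a1 b1.
  by rewrite expr2 ler_pM.
move=> h.
pose F m := poisson_mass (rho * n%:R ^+ 2) k * pair_moment k
  (mean1 (prob m) (fun c => mean1 (prob m) (fun x => grid_close n r c x * grid_close n r' c x)))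
  (mean1 (prob m) (fun c => mean1 (prob m) (grid_close n r c) * mean1 (prob m) (grid_close n r' c)))
  (mean1 (prob m) (fun c => mean1 (prob m) (grid_close n r c)))
  (mean1 (prob m) (fun c => mean1 (prob m) (grid_close n r' c))).
have {}h : (F m)%:E @[m --> \oo] --> (\int[P]_w (f w)%:E)%E.
  have FE m : (\int[P]_w (f_ m w)%:E = (F m)%:E)%E.
    apply: (cell_pairs_mean HX rho0 n0 (mgrid (m := m)) k); exact: grid_closeC.
  by under eq_cvg do rewrite -FE; exact: h.
apply: (cvg_unique _ h) => //.
apply: cvg_EFin; first exact: nearW.
rewrite /F /pair_moment /=; apply: cvgM; first exact: cvg_cst.
apply: cvgD; first apply: cvgD; apply: cvgM; try exact: cvg_cst.
- apply: (cvg_mean1 (f_ := fun m c => mean1 (prob m) (fun x => grid_close n r c x * grid_close n r' c x))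
    (f := closeness nu r)).
  + move=> m c; apply: mean1_01 => c'; have /andP[? ?] := close01 r c c'.
    by have /andP[? ?] := close01 r' c c'; rewrite mulr_ge0// mulr_ile1.
  + exact: measurable_closeness.
  + move=> x nx.
    apply: (cvg_mean1 (f := dist_le r x) (f_ := fun m y =>
      grid_close n r (grid_index n m x) y * grid_close n r' (grid_index n m x) y)).
    * move=> m c; have /andP[? ?] := close01 r (grid_index n m x) c.
      by have /andP[? ?] := close01 r' (grid_index n m x) c; rewrite mulr_ge0// mulr_ile1.
    * exact: measurable_dist_le.
    * move=> y ny; rewrite -(dist_leM x y rr').
      by apply: cvgM; exact: cvg_grid_kernel.
    * exact: closenessE.
  + exact: mean_closenessE.
- apply: (cvg_mean1 (f_ := fun m c => mean1 (prob m) (grid_close n r c) * mean1 (prob m) (grid_close n r' c))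
    (f := fun x => closeness nu r x * closeness nu r' x)).
  + move=> m c; have /andP[? ?] := mean1_01 (close01 r c).
    by have /andP[? ?] := mean1_01 (close01 r' c); rewrite mulr_ge0// mulr_ile1.
  + by apply: measurable_funM; exact: measurable_closeness.
  + by move=> x nx; apply: cvgM; exact: cvg_closeness.
  + exact: mean_closeness2E.
- by apply: cvgM; exact: cvg_mean_closeness.
Qed.

End FinerGrids.

(** * Moments of the Ripley statistics *)

Section CountMoments.
Context {d : measure_display} {T : measurableType d} {R : realType}.
Variables (P : probability T R) (rho : R) (X : T -> set (plane R)).
Hypothesis HX : poisson_process P rho X.
Variable n : nat.
Hypothesis rho0 : 0 < rho.
Hypothesis n0 : (0 < n)%N.

Let N := num_points X (square n).
Let a := rho * n%:R ^+ 2.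

Let a_gt0 : 0 < a.
Proof. by rewrite mulr_gt0// exprn_gt0// ltr0n. Qed.

Lemma measurable_fun_num_points (g : nat -> R) : measurable_fun setT (fun w => g (N w)).
Proof.
have h := pp_measurable HX (@measurable_square R n) (bounded_square (@subset_refl _ _)).
by move=> _ Y _; exact: (h measurableT (g @^-1` Y) I).
Qed.

Lemma num_points_law k : P (N @^-1` [set k]) = (poisson_mass a k)%:E.
Proof.
rewrite (pp_law HX); [|exact: measurable_square|exact: (bounded_square (@subset_refl _ _))].
rewrite area_square// poisson_probE//; exact: ltW.
Qed.

Lemma integral_split_num_points (f : T -> R) : measurable_fun setT f ->
  (forall w, 0 <= f w) ->
  (\int[P]_w (f w)%:E = \sum_(0 <= k <oo) \int[P]_w ((N w == k)%:R * f w)%:E)%E.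
Proof.
move=> mf f0; have b0 w k : (0 <= ((N w == k)%:R * f w)%:E)%E.
  by rewrite lee_fin mulr_ge0.
rewrite -(integral_nneseries _ measurableT); first last.
- by move=> k w _; exact: b0.
- move=> k; apply/measurable_EFinP; apply: measurable_funM => //.
  exact: (measurable_fun_num_points (fun j => (j == k)%:R)).
apply: eq_integral => w _; rewrite (nneseriesD1 (n := N w))//.
rewrite eqxx mul1r eseries0 ?adde0// => i _ /=; rewrite eq_sym => /negbTE ->.
by rewrite mul0r.
Qed.

Lemma num_points_mean (g : nat -> R) : (forall k, 0 <= g k) ->
  (\int[P]_w (g (N w))%:E = \sum_(0 <= k <oo) (g k * poisson_mass a k)%:E)%E.
Proof.
move=> g0; rewrite integral_split_num_points//; last exact: measurable_fun_num_points.
apply: eq_eseriesr => k _.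
have mE : measurable (N @^-1` [set k]).
  rewrite -[X in measurable X]setTI.
  by apply: (pp_measurable HX (@measurable_square R n) (bounded_square (@subset_refl _ _))).
rewrite EFinM -num_points_law.
transitivity (\int[P]_w ((g k)%:E * (\1_(N @^-1` [set k]) w)%:E))%E.
  apply: eq_integral => w _; rewrite indicE -EFinM; congr EFin.
  case: eqP => [<-|Nk]; first by rewrite mem_set// mulr1 mul1r.
  by rewrite memNset// mulr0 mul0r.
have iI : P.-integrable setT (EFin \o \1_(N @^-1` [set k])) by exact: integrable_indic.
apply: (etrans (integralZl measurableT iI (g k))).
by rewrite integral_indic// setIT.
Qed.

(** The falling factorial (k + 1)^_(j + 1) times the mass at k + 1 is a times k^_j times the mass at
    k. A shift of the index thus multiplies the moment by a. *)
Lemma ffact_moment j : (\int[P]_w ((N w) ^_ j)%:R%:E = (a ^+ j)%:E)%E.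
Proof.
elim: j => [|j IH].
  rewrite expr0; under eq_integral do rewrite ffactn0.
  apply: (etrans (integral_cst P measurableT 1%:E)).
  by rewrite [X in (_ * X)%E](probability_setT P) mul1e.
rewrite (num_points_mean (g := fun k => (k ^_ j.+1)%:R))//.
rewrite (nneseries_split 0 1); last first.
  by move=> k _; rewrite lee_fin mulr_ge0// poisson_mass_ge0// ltW.
rewrite big_nat1 mul0r add0e add0n.
rewrite -nneseries_addn; last first.
  by move=> k; rewrite lee_fin mulr_ge0// poisson_mass_ge0// ltW.
transitivity (\sum_(0 <= k <oo) (a%:E * ((k ^_ j)%:R * poisson_mass a k)%:E))%E.
  apply: eq_eseriesr => k _; rewrite -EFinM; congr EFin.
  rewrite addn1 ffactSS /poisson_mass factS !natrM exprS.
  have k1 : k.+1%:R != 0 :> R by rewrite pnatr_eq0.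
  have k2 : k`!%:R != 0 :> R by rewrite pnatr_eq0 -lt0n fact_gt0.
  field; by rewrite k2 addrC natr1 k1.
rewrite nneseriesZl; last first.
  by move=> k _; rewrite lee_fin mulr_ge0// poisson_mass_ge0// ltW.
by rewrite -(num_points_mean (g := fun k => (k ^_ j)%:R))// IH exprS EFinM.
Qed.

End CountMoments.

Section PairMoments.
Context {d : measure_display} {T : measurableType d} {R : realType}.
Variables (P : probability T R) (rho : R) (X : T -> set (plane R)).
Hypothesis HX : poisson_process P rho X.
Variable n : nat.
Hypothesis rho0 : 0 < rho.
Hypothesis n0 : (0 < n)%N.
Variable nu : probability (plane R) R.
Hypothesis nu_square : forall B, measurable B ->
  nu B = (fine (area (B `&` square n)) / n%:R ^+ 2)%:E.

Let N := num_points X (square n).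
Let S := close_pairs n X.
Let e := mean_closeness nu.

Lemma close_pairs_bound r w : 0 <= S r w <= (N w)%:R * ((N w)%:R - 1).
Proof. by rewrite /S (close_pairsE HX); apply: pairs_bound => x y; exact: dist_le01. Qed.

Lemma natr_ffactS k j : (k ^_ j.+1)%:R = (k ^_ j)%:R * (k%:R - j%:R) :> R.
Proof.
rewrite ffactnSr natrM; case: (leqP j k) => [jk|kj]; first by rewrite natrB.
by rewrite ffact_small// !mul0r.
Qed.

(** The factors k - 2 and k - 3 may be negative, but the products are falling factorials of k. *)
Lemma pair_moment_ge0 k (w v x y : R) : 0 <= w -> 0 <= v -> 0 <= x -> 0 <= y ->
  0 <= pair_moment k w v x y.
Proof.
move=> w0 v0 x0 y0; have -> : pair_moment k w v x y =
    2 * (k ^_ 2)%:R * w + 4 * (k ^_ 3)%:R * v + (k ^_ 4)%:R * (x * y).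
  by rewrite !natr_ffactS ffactn0 /pair_moment; ring.
by rewrite !addr_ge0// !mulr_ge0.
Qed.

Lemma mean_closeness_ge0 s : 0 <= e s.
Proof.
apply: fine_ge0; apply: integral_ge0 => x _.
by rewrite lee_fin; case/andP: (closeness01 nu s x).
Qed.

Lemma mean_closeness2_ge0 s s' : 0 <= mean_closeness2 nu s s'.
Proof.
apply: fine_ge0; apply: integral_ge0 => x _; rewrite lee_fin.
by rewrite mulr_ge0//; [case/andP: (closeness01 nu s x)|case/andP: (closeness01 nu s' x)].
Qed.

(** The means on the events N = k are summed over k; the nonnegativity of [phi] allows the sum and
    the integral to be exchanged. *)
Lemma close_pairs_weighted_mean (phi : nat -> R) r r' : (forall k, 0 <= phi k) ->
  0 < r -> r <= r' ->
  (\int[P]_w (phi (N w) * (S r w * S r' w))%:E =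
   \int[P]_w (phi (N w) * pair_moment (N w) (e r) (mean_closeness2 nu r r') (e r) (e r'))%:E)%E.
Proof.
move=> phi0 r0 rr'.
have S0 s w : 0 <= S s w by case/andP: (close_pairs_bound s w).
have mS s : 0 < s -> measurable_fun setT (S s) by exact: (measurable_close_pairs HX n0).
pose G k := pair_moment k (e r) (mean_closeness2 nu r r') (e r) (e r').
have G0 k : 0 <= G k.
  by apply: pair_moment_ge0; rewrite ?mean_closeness_ge0 ?mean_closeness2_ge0.
rewrite (num_points_mean HX rho0 n0 (g := fun k => phi k * G k)); last first.
  by move=> k; rewrite mulr_ge0.
rewrite (integral_split_num_points HX n); first last.
- by move=> w; rewrite !mulr_ge0.
- apply: measurable_funM; first exact: (measurable_fun_num_points HX).
  by apply: measurable_funM; apply: mS => //; exact: lt_le_trans rr'.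
apply: eq_eseriesr => k _.
transitivity (\int[P]_w ((phi k)%:E * ((num_points X (square n) w == k)%:R *
    (close_pairs n X r w * close_pairs n X r' w))%:E))%E.
  apply: eq_integral => w _; rewrite -EFinM; congr EFin.
  by case: eqP => [<-|_]; rewrite ?mul1r// !mul0r mulr0.
rewrite ge0_integralZl//; first last.
- by rewrite lee_fin.
- by move=> w _; rewrite lee_fin !mulr_ge0.
- apply/measurable_EFinP; apply: measurable_funM.
    exact: (measurable_fun_num_points HX n (fun j => (j == k)%:R)).
  by apply: measurable_funM; apply: mS => //; exact: lt_le_trans rr'.
rewrite (close_pairs_mean HX rho0 n0 nu_square k r0 rr') -EFinM.
by congr EFin; rewrite mulrCA mulrC.
Qed.

Lemma integral_eq_square (f g : plane R -> R) : measurable_fun setT f -> measurable_fun setT g ->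
  (forall x, square n x -> f x = g x) ->
  (\int[nu]_x (f x)%:E = \int[nu]_x (g x)%:E)%E.
Proof.
move=> mf mg fg; apply: ae_eq_integral => //; [exact/measurable_EFinP|exact/measurable_EFinP|].
exists (~` square n); split.
- by apply: measurableC; exact: measurable_square.
- apply: (etrans (nu_square _)); first by apply: measurableC; exact: measurable_square.
  by rewrite setICl areaE// measure0 mul0r.
- by move=> x /= nx sx; apply: nx => _; rewrite fg.
Qed.

(** The radius 2n exceeds the diameter of the square, which is n times the square root of 2. *)
Lemma dist_le_square (s : R) (x y : plane R) :
  2 * n%:R <= s -> square n x -> square n y -> dist_le s x y = 1.
Proof.
move=> ns [/= + +] [/= + +]; rewrite !in_itv/= => /andP[? ?] /andP[? ?] /andP[? ?] /andP[? ?].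
rewrite /dist_le /dist; suff -> : Num.sqrt ((x.1 - y.1) ^+ 2 + (x.2 - y.2) ^+ 2) <= s by [].
apply: le_trans ns; rewrite -(@ger0_norm _ (2 * n%:R))// -sqrtr_sqr ler_sqrt ?sqr_ge0//.
have h u v : 0 <= u -> u <= n%:R -> 0 <= v -> v <= n%:R -> (u - v) ^+ 2 <= n%:R ^+ 2 :> R.
  move=> ? ? ? ?; rewrite -(ler_sqrt _ (sqr_ge0 _)) !sqrtr_sqr.
  by rewrite ler_norml (@ger0_norm _ n%:R)//; apply/andP; split; lra.
apply: (le_trans (lerD (h _ _ _ _ _ _) (h _ _ _ _ _ _))) => //.
by have := sqr_ge0 (n%:R : R); lra.
Qed.

Lemma closeness_square s (x : plane R) : 2 * n%:R <= s -> square n x -> closeness nu s x = 1.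
Proof.
move=> ns nx; apply: EFin_inj; rewrite -closenessE.
rewrite (integral_eq_square (g := cst 1))//; [exact: integral_cst_prob|exact: measurable_dist_le|].
by move=> y ny; exact: dist_le_square.
Qed.

Lemma mean_closeness_square s : 2 * n%:R <= s -> e s = 1.
Proof.
move=> ns; apply: EFin_inj; rewrite -mean_closenessE.
rewrite (integral_eq_square (g := cst 1))//; [exact: integral_cst_prob|exact: measurable_closeness|].
by move=> y ny; exact: closeness_square.
Qed.

Lemma mean_closeness2_square r s : 2 * n%:R <= s -> mean_closeness2 nu r s = e r.
Proof.
move=> ns; apply: EFin_inj; rewrite -mean_closeness2E -mean_closenessE.
apply: integral_eq_square.
- by apply: measurable_funM; exact: measurable_closeness.
- exact: measurable_closeness.
- by move=> x nx; rewrite (closeness_square ns nx) mulr1.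
Qed.

Lemma close_pairs_square s w : 2 * n%:R <= s -> S s w = (N w)%:R * ((N w)%:R - 1).
Proof.
move=> ns; rewrite /S (close_pairsE HX) -pairs1 /pairs; congr (_ - _).
  rewrite big_seq [RHS]big_seq; apply: eq_bigr => x.
  rewrite (mem_points HX) => /set_mem[_ nx].
  rewrite big_seq [RHS]big_seq; apply: eq_bigr => y.
  by rewrite (mem_points HX) => /set_mem[_ ny]; exact: dist_le_square.
rewrite big_seq [RHS]big_seq; apply: eq_bigr => x.
by rewrite (mem_points HX) => /set_mem[_ nx]; exact: dist_le_square.
Qed.

(* The first moment is the second one for a radius so large that all pairs are close. *)
Lemma close_pairs_weighted_mean1 (phi : nat -> R) r : (forall k, 0 <= phi k) -> 0 < r ->
  (\int[P]_w (phi (N w) * S r w)%:E =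
   \int[P]_w (phi (N w) * ((N w)%:R * ((N w)%:R - 1) * e r))%:E)%E.
Proof.
move=> phi0 r0; pose s : R := Num.max r (2 * n%:R).
have rs : r <= s by rewrite le_max lexx.
have ns : 2 * n%:R <= s by rewrite le_max lexx orbT.
(* For the large radius s the pair sum is N(N - 1), and [psi] divides by it. The value 0 for N <= 1
   is harmless, since there are no pairs then. *)
pose psi k : R := if (1 < k)%N then phi k / (k%:R * (k%:R - 1)) else 0.
have kk k : (1 < k)%N -> 0 < k%:R * (k%:R - 1) :> R.
  by move=> k1; rewrite mulr_gt0 ?subr_gt0 ?ltr1n ?ltr0n// ltnW.
have k1 k : (k <= 1)%N -> k%:R * (k%:R - 1) = 0 :> R.
  by case: k => [|[]]//; rewrite ?mul0r// subrr mulr0.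
have psi0 k : 0 <= psi k by rewrite /psi; case: ifP => // /kk h; rewrite divr_ge0// ltW.
have := close_pairs_weighted_mean psi0 r0 rs.
rewrite (mean_closeness_square ns) (mean_closeness2_square _ ns) => h.
transitivity (\int[P]_w (psi (N w) * (S r w * S s w))%:E)%E.
  apply: eq_integral => w _; congr EFin; rewrite (close_pairs_square w ns) /psi.
  case: ltnP => Nw.
    have := kk _ Nw => /lt0r_neq0; rewrite mulf_eq0 negb_or => /andP[? ?].
    by field; apply/andP.
  have := close_pairs_bound r w; rewrite k1// -eq_le => /eqP <-.
  by rewrite mulr0 mul0r.
rewrite h; apply: eq_integral => w _; congr EFin; rewrite /psi /pair_moment.
case: ltnP => Nw.
  have := kk _ Nw => /lt0r_neq0; rewrite mulf_eq0 negb_or => /andP[? ?].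
  by field; apply/andP.
by rewrite k1// !mul0r mulr0.
Qed.

End PairMoments.

(** * Covariances of the two statistics *)

Section RipleyCovariance.
Context {d : measure_display} {T : measurableType d} {R : realType}.
Variables (P : probability T R) (rho : R) (X : T -> set (plane R)).
Hypothesis HX : poisson_process P rho X.
Variable n : nat.
Hypothesis rho0 : 0 < rho.
Hypothesis n0 : (0 < n)%N.
Variable nu : probability (plane R) R.
Hypothesis nu_square : forall B, measurable B ->
  nu B = (fine (area (B `&` square n)) / n%:R ^+ 2)%:E.

Let N := num_points X (square n).
Let S := close_pairs n X.
Let e := mean_closeness nu.
Let a := rho * n%:R ^+ 2.

Lemma ge0_integrable (f : T -> R) (c : R) : measurable_fun setT f -> (forall w, 0 <= f w) ->
  (\int[P]_w (f w)%:E = c%:E)%E -> P.-integrable setT (EFin \o f).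
Proof.
move=> mf f0 fc; apply/integrableP; split; first exact/measurable_EFinP.
under eq_integral do rewrite /= ger0_norm//.
by rewrite fc ltry.
Qed.

Lemma integral_linear3 (f g h : T -> R) (x y z F G H : R) :
  P.-integrable setT (EFin \o f) -> P.-integrable setT (EFin \o g) ->
  P.-integrable setT (EFin \o h) ->
  (\int[P]_w (f w)%:E = F%:E)%E -> (\int[P]_w (g w)%:E = G%:E)%E ->
  (\int[P]_w (h w)%:E = H%:E)%E ->
  (\int[P]_w (x * f w + y * g w + z * h w)%:E = (x * F + y * G + z * H)%:E)%E.
Proof.
move=> fi gi hi fF gG hH.
have iZ (k : T -> R) (c K : R) : P.-integrable setT (EFin \o k) ->
    (\int[P]_w (k w)%:E = K%:E)%E ->
    P.-integrable setT (EFin \o (fun w => c * k w)) /\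
    (\int[P]_w (c * k w)%:E = (c * K)%:E)%E.
  move=> ki kK; have kZ := integralZl measurableT ki c.
  split; last by rewrite EFinM -kK; exact: kZ.
  by have := integrableZl measurableT c ki; apply: eq_integrable.
have [ix Ex] := iZ _ x _ fi fF; have [iy Ey] := iZ _ y _ gi gG.
have [iz Ez] := iZ _ z _ hi hH.
have ixy : P.-integrable setT (EFin \o (fun w => x * f w + y * g w)).
  by have := integrableD measurableT ix iy; apply: eq_integrable.
rewrite !EFinD -Ex -Ey -Ez.
transitivity (\int[P]_w (x * f w + y * g w)%:E + \int[P]_w (z * h w)%:E)%E.
  exact: (integralD measurableT ixy iz).
congr (_ + _)%E; exact: (integralD measurableT ix iy).
Qed.

(** [M] is the mean of the product of the two variables, and [A] times [e r] the mean of the first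
    of them, both rewritten as means of functions of N. *)
Lemma covariance_weighted (phi : nat -> R) r r' (M A : R) : (forall k, 0 <= phi k) ->
  0 < r -> r <= r' ->
  (\int[P]_w (phi (N w) ^+ 2 *
     pair_moment (N w) (e r) (mean_closeness2 nu r r') (e r) (e r'))%:E = M%:E)%E ->
  (\int[P]_w (phi (N w) * ((N w)%:R * ((N w)%:R - 1)))%:E = A%:E)%E ->
  covariance P (fun w => phi (N w) * S r w) (fun w => phi (N w) * S r' w) =
  (M - A ^+ 2 * (e r * e r'))%:E.
Proof.
move=> phi0 r0 rr' EM EA.
have S0 s w : 0 <= S s w by case/andP: (close_pairs_bound HX n s w).
have mS s : 0 < s -> measurable_fun setT (S s) by exact: (measurable_close_pairs HX n0).
have mphi := measurable_fun_num_points HX n phi.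
have NN0 w : 0 <= (N w)%:R * ((N w)%:R - 1) :> R.
  by have /andP[] := close_pairs_bound HX n r w; exact: le_trans.
have iNN : P.-integrable setT (EFin \o (fun w => phi (N w) * ((N w)%:R * ((N w)%:R - 1)))).
  apply: ge0_integrable EA; last by move=> w; exact: mulr_ge0.
  exact: (measurable_fun_num_points HX n (fun k => phi k * (k%:R * (k%:R - 1)))).
have ES s : 0 < s -> (\int[P]_w (phi (N w) * S s w)%:E = (A * e s)%:E)%E.
  move=> s0; apply: (etrans (close_pairs_weighted_mean1 HX rho0 n0 nu_square phi0 s0)).
  rewrite mulrC EFinM -EA; have := integralZl measurableT iNN (e s).
  by move=> <-; apply: eq_integral => w _; rewrite -EFinM; congr EFin; rewrite mulrA mulrC.
have ESS : (\int[P]_w ((phi (N w) * S r w) * (phi (N w) * S r' w))%:E = M%:E)%E.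
  rewrite -EM -(close_pairs_weighted_mean HX rho0 n0 nu_square (phi := fun k => phi k ^+ 2) _ r0 rr').
    by apply: eq_integral => w _; congr EFin; rewrite mulrACA expr2.
  by move=> k; exact: sqr_ge0.
have r'0 := lt_le_trans r0 rr'.
rewrite covarianceE.
- by rewrite unlock ES// ES// [X in (X - _)%E]ESS -EFinM -EFinB; congr EFin; move: (e r) (e r') => x y; ring.
- apply/Lfun1_integrable; apply: ge0_integrable (ES _ r0).
    by apply: measurable_funM => //; exact: mS.
  by move=> w; exact: mulr_ge0.
- apply/Lfun1_integrable; apply: ge0_integrable (ES _ r'0).
    by apply: measurable_funM => //; exact: mS.
  by move=> w; exact: mulr_ge0.
- apply/Lfun1_integrable; apply: ge0_integrable ESS.
    by apply: measurable_funM; apply: measurable_funM => //; exact: mS.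
  by move=> w; rewrite !mulr_ge0.
Qed.

Lemma covariance_ripley1 r r' : 0 < r -> r <= r' ->
  covariance P (ripley1 rho n X r) (ripley1 rho n X r') =
  (2 * e r / rho ^+ 2 + 4 * n%:R ^+ 2 / rho * mean_closeness2 nu r r')%:E.
Proof.
move=> r0 rr'; have n0' : n%:R != 0 :> R by rewrite pnatr_eq0 -lt0n.
have rho0' := lt0r_neq0 rho0.
pose c := (n%:R ^+ 2 * rho ^+ 2)^-1; pose v := mean_closeness2 nu r r'.
have iff j : P.-integrable setT (EFin \o (fun w => ((N w) ^_ j)%:R)).
  apply: ge0_integrable (ffact_moment HX rho0 n0 j) => //.
  exact: (measurable_fun_num_points HX n (fun k => (k ^_ j)%:R)).
have Eff := ffact_moment HX rho0 n0.
(* The factorial moments of N are powers of a, so the last term of [M] cancels against the product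
   of the means. The zero terms of [A] only give it the shape of [integral_linear3]. *)
rewrite (covariance_weighted (phi := fun=> c)
  (M := 2 * c ^+ 2 * e r * a ^+ 2 + 4 * c ^+ 2 * v * a ^+ 3 + c ^+ 2 * (e r * e r') * a ^+ 4)
  (A := c * a ^+ 2 + 0 * a ^+ 2 + 0 * a ^+ 2))//.
- by congr EFin; rewrite /a /c -/v; move: (e r) (e r') v => x y z; field; apply/andP.
- by move=> _; rewrite invr_ge0 mulr_ge0// sqr_ge0.
- rewrite -(integral_linear3 _ _ _ (iff 2) (iff 3) (iff 4))//.
  apply: eq_integral => w _; congr EFin.
  rewrite !natr_ffactS ffactn0 /pair_moment -/v.
  by move: (e r) (e r') v c (N w)%:R => x y z u k; ring.
- rewrite -(integral_linear3 _ _ _ (iff 2) (iff 2) (iff 2))//.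
  by apply: eq_integral => w _; congr EFin; rewrite !natr_ffactS ffactn0; ring.
Qed.

Lemma bounded_num_points_integrable (g : nat -> R) : (forall k, 0 <= g k <= 1) ->
  P.-integrable setT (EFin \o (fun w => g (N w))).
Proof.
move=> g01; apply: measurable_bounded_integrable => //.
- by rewrite (le_lt_trans (probability_le1 _ _))// ltry.
- exact: (measurable_fun_num_points HX).
exists 1; split; first exact: num_real.
move=> M M1 w _ /=; have /andP[g0 g1] := g01 (N w).
by rewrite ger0_norm// (le_trans g1)// ltW.
Qed.

Lemma num_points_indicator_mean k : (\int[P]_w (N w == k)%:R%:E = (poisson_mass a k)%:E)%E.
Proof.
rewrite -(num_points_law HX rho0 n0 k).
have mE : measurable (N @^-1` [set k]).
  rewrite -[X in measurable X]setTI.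
  by apply: (pp_measurable HX (@measurable_square R n) (bounded_square (@subset_refl _ _))).
rewrite -[X in P X]setIT -(integral_indic P measurableT mE).
apply: eq_integral => w _; congr EFin; rewrite indicE; congr (nat_of_bool _)%:R.
by apply/eqP/idP => [Nk|/set_mem//]; exact/mem_set.
Qed.

Lemma many_points_mean : (\int[P]_w (1 < N w)%N%:R%:E =
  (1 - expR (- a) - a * expR (- a))%:E)%E.
Proof.
have i0 k : P.-integrable setT (EFin \o (fun w => (N w == k)%:R)).
  by apply: (bounded_num_points_integrable (g := fun j => (j == k)%:R)) => j; rewrite ler0n lern1 leq_b1.
have i1 : P.-integrable setT (EFin \o (fun w : T => (1 : R))).
  by apply: (bounded_num_points_integrable (g := fun=> 1)) => j; rewrite ler01 lexx.
have E1 : (\int[P]_w ((1 : R)%:E) = (1 : R)%:E)%E.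
  apply: (etrans (integral_cst P measurableT 1%:E)).
  by rewrite [X in (_ * X)%E](probability_setT P) mul1e.
transitivity (\int[P]_w (1 * 1 + -1 * (N w == 0)%:R + -1 * (N w == 1)%:R : R)%:E)%E.
  apply: eq_integral => w _; congr EFin.
  by case: (N w) => [|[|k]] /=; rewrite ?mulr0 ?mulr1 ?addr0 ?subrr ?addrN.
rewrite (integral_linear3 1 (-1) (-1) i1 (i0 0%N) (i0 1%N) E1
  (num_points_indicator_mean 0) (num_points_indicator_mean 1)).
by congr EFin; rewrite /poisson_mass expr0 expr1 !divr1; ring.
Qed.

Definition pair_weight (k : nat) : R :=
  if (1 < k)%N then n%:R ^+ 2 / (k%:R * (k%:R - 1)) else 0.

Lemma ripley2E r : ripley2 n X r = fun w => pair_weight (N w) * S r w.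
Proof.
apply/funext => w; rewrite /ripley2 /pair_weight -/N /S.
by case: ifP => // _; rewrite mul0r.
Qed.

(** Dividing the conditional moment by (k(k - 1))^2 leaves (k - 2)(k - 3) / (k(k - 1)) in front of
    [e r * e r']. Since (k - 2)(k - 3) = k(k - 1) - 4(k - 2) - 2, this term distributes over the
    means of 1, of [inv_pairs_sub2] and of [inv_pairs]. With p = P(N > 1), the part left over is p -
    p^2 = p(1 - p), and 1 - p = e^(-a) (1 + a). *)
Lemma covariance_ripley2 : exists I J : R,
  [/\ ('E_P[inv_pairs n X] = I%:E)%E, ('E_P[inv_pairs_sub2 n X] = J%:E)%E &
  forall r r', 0 < r -> r <= r' ->
  covariance P (ripley2 n X r) (ripley2 n X r') =
  (2 * n%:R ^+ 4 * I * (e r - e r * e r')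
   + 4 * n%:R ^+ 4 * J * (mean_closeness2 nu r r' - e r * e r')
   + n%:R ^+ 4 * expR (- a) * (1 + a)
     * (1 - expR (- a) - a * expR (- a)) * (e r * e r'))%:E].
Proof.
pose inv k : R := if (1 < k)%N then 1 / (k%:R * (k%:R - 1)) else 0.
pose sub2 k : R := if (1 < k)%N then (k%:R - 2) / (k%:R * (k%:R - 1)) else 0.
have kk k : (1 < k)%N -> 1 <= k%:R - 1 :> R.
  by move=> k1; rewrite lerBrDr -(natrD R 1 1) ler_nat.
have inv01 k : 0 <= inv k <= 1.
  rewrite /inv; case: ifP => [k1|_]; last by rewrite lexx ler01.
  have h := kk k k1; have h2 : 0 < k%:R * (k%:R - 1) :> R by nra.
  by rewrite divr_ge0 ?ler01 ?(ltW h2)// ler_pdivrMr// mul1r; nra.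
have sub01 k : 0 <= sub2 k <= 1.
  rewrite /sub2; case: ifP => [k1|_]; last by rewrite lexx ler01.
  have h := kk k k1; have h2 : 0 < k%:R * (k%:R - 1) :> R by nra.
  by rewrite divr_ge0 ?(ltW h2)// ?ler_pdivrMr ?mul1r//; [nra|lra].
have iI := bounded_num_points_integrable inv01.
have iJ := bounded_num_points_integrable sub01.
have ip : P.-integrable setT (EFin \o (fun w => (1 < N w)%N%:R)).
  by apply: (bounded_num_points_integrable (g := fun k => (1 < k)%N%:R)) => k; rewrite ler0n lern1 leq_b1.
have toE (g : nat -> R) (k : T -> R) : P.-integrable setT (EFin \o (fun w => g (N w))) ->
  k = (fun w => g (N w)) -> (\int[P]_w (g (N w))%:E = (fine ('E_P[k]))%:E)%E.
  by move=> gi ->; rewrite fineK unlock// integrable_fin_num.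
exists (fine ('E_P[inv_pairs n X])%E), (fine ('E_P[inv_pairs_sub2 n X])%E).
have EI := toE _ (inv_pairs n X) iI erefl.
have EJ := toE _ (inv_pairs_sub2 n X) iJ erefl.
split.
- by rewrite -EI unlock.
- by rewrite -EJ unlock.
set I := fine _ in EI *; set J := fine _ in EJ *.
move=> r r' r0 rr'; pose v := mean_closeness2 nu r r'.
pose p := 1 - expR (- a) - a * expR (- a).
rewrite !ripley2E (covariance_weighted
  (M := n%:R ^+ 4 * (2 * (e r - e r * e r')) * I +
        n%:R ^+ 4 * (4 * (v - e r * e r')) * J + n%:R ^+ 4 * (e r * e r') * p)
  (A := n%:R ^+ 2 * p + 0 * p + 0 * p))//.
- by congr EFin; rewrite -/v /p; clear EI EJ; move: (e r) (e r') v I J (expR _) => x y z i j u; ring.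
- move=> k; rewrite /pair_weight; case: ifP => // k1.
  by have := kk _ k1 => h; rewrite divr_ge0 ?sqr_ge0// mulr_ge0// ?ler0n//; lra.
- rewrite -(integral_linear3 _ _ _ iI iJ ip EI EJ many_points_mean).
  apply: eq_integral => w _; congr EFin; rewrite /inv /sub2 /pair_weight /pair_moment -/v.
  move: (e r) (e r') v (N w) => x y z k.
  case: ifP => [k1|_]; last by rewrite !mulr0 expr0n mul0r !addr0.
  have h := kk _ k1; rewrite -[true%:R]/(1 : R); field; apply/andP; split; apply: lt0r_neq0; lra.
- rewrite -(integral_linear3 _ _ _ ip ip ip many_points_mean many_points_mean many_points_mean).
  apply: eq_integral => w _; congr EFin; rewrite /pair_weight.
  case: ifP => [k1|_]; last by rewrite !mul0r !mulr0 !addr0.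
  have h := kk _ k1; rewrite -[true%:R]/(1 : R); field; apply/andP; split; apply: lt0r_neq0; lra.
Qed.

End RipleyCovariance.

(** * Lebesgue measure on the plane and the final values *)

Section LebesguePlane.
Context {R : realType}.

(* The library has no canonical sigma-finite structure on the product of two sigma-finite measures
   that are not subprobabilities. *)
Definition lebesgue_plane : set (plane R) -> \bar R := (leb \x leb)%E.

Let lebesgue_plane0 : lebesgue_plane set0 = 0%E.
Proof. exact: measure0. Qed.

Let lebesgue_plane_ge0 B : (0 <= lebesgue_plane B)%E.
Proof. exact: measure_ge0. Qed.

Let lebesgue_plane_sigma_additive : semi_sigma_additive lebesgue_plane.
Proof. exact: (@measure_semi_sigma_additive _ _ _ (@leb R \x @leb R)%E). Qed.

HB.instance Definition _ := isMeasure.Build _ _ _ lebesgue_plane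
  lebesgue_plane0 lebesgue_plane_ge0 lebesgue_plane_sigma_additive.

Let lebesgue_plane_sigma_finite : sigma_finite setT lebesgue_plane.
Proof.
have /sigma_finiteP[F [TF ndF Foo]] := sigma_finiteT (@leb R).
(* The sets [F k] increase, so a point whose coordinates lie in [F i] and [F j] lies in the product
   of index max(i, j). *)
exists (fun k => F k `*` F k).
  apply/seteqP; split => [[x y] _|//].
  have [i _ Fx] : (\bigcup_k F k) x by rewrite -TF.
  have [j _ Fy] : (\bigcup_k F k) y by rewrite -TF.
  exists (maxn i j) => //; split.
  - by move: x Fx; exact/subsetPset/ndF/leq_maxl.
  - by move: y Fy; exact/subsetPset/ndF/leq_maxr.
move=> k; have [mF Fk] := Foo k; split; first exact: measurableX.
by rewrite /lebesgue_plane product_measure1E// lte_mul_pinfty// ge0_fin_numE.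
Qed.

HB.instance Definition _ := Measure_isSigmaFinite.Build _ _ _ lebesgue_plane
  lebesgue_plane_sigma_finite.

End LebesguePlane.

Section UniformCloseness.
Context {R : realType}.
Variable n : nat.
Hypothesis n0 : (0 < n)%N.
Variable nu : probability (plane R) R.
Hypothesis nu_square : forall B, measurable B ->
  nu B = (fine (area (B `&` square n)) / n%:R ^+ 2)%:E.
Variable r : R.
Hypothesis r0 : 0 < r.

Let integral_lebesgue_plane (f : plane R -> \bar R) :
  measurable_fun [set: plane R] f -> (forall z, 0 <= f z)%E ->
  (\int[lebesgue_plane]_z f z = \int[leb]_x \int[leb]_y f (x, y))%E.
Proof. by move=> mf f0; exact: (fubini_tonelli1 (m1 := leb) (m2 := leb) f mf f0). Qed.

Let lebesgue_planeE (B : set (plane R)) : measurable B -> lebesgue_plane B = area B.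
Proof. by move=> mB; rewrite areaE. Qed.

Let integral_nu := integral_uniform lebesgue_planeE nu_square.

Lemma mean_closeness_val : r <= n%:R -> mean_closeness nu r =
  pi * r ^+ 2 / n%:R ^+ 2 - 8 * r ^+ 3 / (3 * n%:R ^+ 3) + r ^+ 4 / (2 * n%:R ^+ 4).
Proof.
move=> rn; apply: EFin_inj; rewrite -mean_closenessE.
apply: etrans (integral_dist_le_mean (@integral_leb R) integral_lebesgue_plane n0 integral_nu r0 rn).
by apply: eq_integral => x _; rewrite closenessE.
Qed.

Lemma mean_closeness2_val : 2 * r <= n%:R -> mean_closeness2 nu r r =
  (pi ^+ 2 * r ^+ 4 * n%:R ^+ 2 - (8 / 3 * pi + 256 / 45) * r ^+ 5 * n%:R
    + (59 / 48 * pi + 8 / 9) * r ^+ 6) / n%:R ^+ 6.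
Proof.
move=> rn; apply: EFin_inj; rewrite -mean_closeness2E.
apply: etrans (integral_dist_le_sqr (@integral_leb R) integral_lebesgue_plane n0 integral_nu r0 rn).
by apply: eq_integral => x _; rewrite closenessE -EFinM.
Qed.

End UniformCloseness.

Theorem proposition2 (R : realType) (rho : R) (n : nat) (r r' : R)
  (rho_gt0 : 0 < rho) (n_ge1 : (1 <= n)%N) (r_gt0 : 0 < r) (rr' : r < r')
  (d : measure_display) (T : measurableType d) (P : probability T R)
  (X : T -> set (plane R)) (HX : poisson_process P rho X)
  (d' : measure_display) (T' : measurableType d') (Q : probability T' R)
  (U V : {RV Q >-> plane R})
  (HU : uniform_on_square n U) (HV : uniform_on_square n V)
  (HUV : independent Q U V)
  (h1 : plane R -> R -> R)
  (Hh1 : forall s : R, 0 < s ->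
     cond_expectation (fun w => hker Q U V (U w) (V w) s) V (h1 ^~ s)) :
  let e := mean_close Q U V in
  let K1 := ripley1 rho n X in
  let K2 := ripley2 n X in
  let h1U s := fun w => h1 (U w) s in
  let a := rho * n%:R ^+ 2 in
  [/\ [/\ 'V_P[K1 r] =
          (2 * e r / rho ^+ 2)%:E
          + (4 * n%:R ^+ 2 * e r ^+ 2 / rho)%:E
          + (4 * n%:R ^+ 2 / rho)%:E * 'E_Q[(fun w => h1U r w ^+ 2)%R],
        covariance P (K1 r) (K1 r') =
          (2 * e r / rho ^+ 2)%:E
          + (4 * n%:R ^+ 2 * e r' * e r / rho)%:E
          + (4 * n%:R ^+ 2 / rho)%:E * covariance Q (h1U r') (h1U r),
        'V_P[K2 r] =
          (2 * n%:R ^+ 4)%:E * 'E_P[inv_pairs n X] * (e r - e r ^+ 2)%:E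
          + (4 * n%:R ^+ 4)%:E * 'E_P[inv_pairs_sub2 n X]
              * 'E_Q[(fun w => h1U r w ^+ 2)%R]
          + (n%:R ^+ 4 * expR (- a) * (1 + a)
              * (1 - expR (- a) - a * expR (- a)) * e r ^+ 2)%:E
      & covariance P (K2 r) (K2 r') =
          (2 * n%:R ^+ 4)%:E * 'E_P[inv_pairs n X] * (e r - e r' * e r)%:E
          + (4 * n%:R ^+ 4)%:E * 'E_P[inv_pairs_sub2 n X]
              * covariance Q (h1U r') (h1U r)
          + (n%:R ^+ 4 * expR (- a) * (1 + a)
              * (1 - expR (- a) - a * expR (- a)) * e r' * e r)%:E]%E,
      forall s, s \in [:: r; r'] -> s <= n%:R ->
        e s = pi * s ^+ 2 / n%:R ^+ 2 - 8 * s ^+ 3 / (3 * n%:R ^+ 3)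
              + s ^+ 4 / (2 * n%:R ^+ 4)
    & 2 * r <= n%:R ->
        'E_Q[(fun w => h1U r w ^+ 2)%R]%E =
          (r ^+ 5 / n%:R ^+ 5 * (8 / 3 * pi - 256 / 45)
           + r ^+ 6 / n%:R ^+ 6 * (11 / 48 * pi - 56 / 9)
           + 8 / 3 * (r ^+ 7 / n%:R ^+ 7)
           - 1 / 4 * (r ^+ 8 / n%:R ^+ 8))%:E].
Proof.
have r'_gt0 := lt_trans r_gt0 rr'.
have [nu [nuU nuV nu_square]] : exists nu : probability (plane R) R,
    [/\ forall B, measurable B -> distribution Q U B = nu B,
        forall B, measurable B -> distribution Q V B = nu B &
        forall B, measurable B -> nu B = (fine (area (B `&` square n)) / n%:R ^+ 2)%:E].
  (* The two laws coincide on measurable sets by uniformity, so either may serve as [nu]. *)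
  exists (distribution Q V); split=> B mB; [|by []|exact: HV].
  exact: etrans (HU B mB) (esym (HV B mB)).
have h1sqr := expectation_cond_sqr nuU nuV HUV (Hh1 r r_gt0).
have h1cov := covariance_cond nuU nuV HUV (Hh1 r' r'_gt0) (Hh1 r r_gt0).
have covK1 := covariance_ripley1 HX rho_gt0 n_ge1 nu_square.
have [I [J [EI EJ covK2]]] := covariance_ripley2 HX rho_gt0 n_ge1 nu_square.
have m2C : mean_closeness2 nu r' r = mean_closeness2 nu r r'.
  by rewrite /mean_closeness2; under eq_integral do rewrite mulrC.
have e_val s : 0 < s -> s <= n%:R -> mean_closeness nu s = _ :=
  mean_closeness_val n_ge1 nu_square (r := s).
have m2_val := mean_closeness2_val n_ge1 nu_square r_gt0.
have -> : mean_close Q U V = mean_closeness nu.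
  by apply/funext => s; exact: mean_closeE.
rewrite /= EI EJ h1sqr h1cov m2C.
(* The variance is by definition the covariance with itself, and the lemmas for r <= r' include r =
   r'. *)
have var1 : ('V_P[ripley1 rho n X r] = _)%E := covK1 r r r_gt0 (lexx r).
have var2 : ('V_P[ripley2 n X r] = _)%E := covK2 r r r_gt0 (lexx r).
rewrite var1 var2 (covK1 _ _ r_gt0 (ltW rr')) (covK2 _ _ r_gt0 (ltW rr')).
move: e_val m2_val; clear - r_gt0 r'_gt0 n_ge1.
move: (mean_closeness nu) (mean_closeness2 nu) => e m2 e_val m2_val; split.
(* For the first statistic, E g_r g_r' is split into e_r e_r' and the covariance of the versions of
   h_1. *)
- by split; rewrite -?EFinM -?EFinD; congr EFin; ring.
- by move=> s; rewrite !inE => /orP[] /eqP-> sn; exact: e_val.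
(* The closed form of e_r may be used because 2r <= n implies r <= n. *)
move=> rn; rewrite m2_val// e_val//; last by lra.
by congr EFin; field; rewrite pnatr_eq0 -lt0n.
Qed.
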